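(* Let $d\ge 2$. For $\lambda\in[\lambda_0,\infty)$ let $V_\lambda\subset\mathcal P_\lambda$ be the set of vertices (extreme points) of the convex hull of $\mathcal P_\lambda$, and for integers $n\ge\lambda_0$ let $V_n'\subset\mathcal X_n$ be the set of vertices of the convex hull of $\mathcal X_n$. Then the point process $T^{(\lambda)}(V_\lambda)$ converges in distribution to ${\rm Ext}(\mathcal P)$ as $\lambda\to\infty$, and the point process $T^{(n)}(V_n')$ converges in distribution to ${\rm Ext}(\mathcal P)$ as $n\to\infty$.
   Context: Gaussian samples: $\phi(x)=(2\pi)^{-d/2}\exp(-|x|^2/2)$ is the standard normal density on $\mathbb R^d$; $\mathcal P_\lambda$ is a Poisson point process on $\mathbb R^d$ with intensity $\lambda\phi(x)\,dx$; $\mathcal X_n=\{X_1,\dots,X_n\}$ with $X_i$ i.i.d. of density $\phi$. $|\cdot|$ is the Euclidean norm. Scaling transform: $R_\lambda:=\sqrt{2\log\lambda-\log(2(2\pi)^d\log\lambda)}$ and $\lambda_0$ is chosen so that $R_\lambda\in[1,\infty)$ for all $\lambda\ge\lambda_0$. Let $u_0=(0,\dots,0,1)\in\mathbb R^d$, and identify the tangent space $T_{u_0}$ of the unit sphere $\mathbb S^{d-1}$ at $u_0$ with $\mathbb R^{d-1}$. The exponential map $\exp_{d-1}:\mathbb R^{d-1}\to\mathbb S^{d-1}$ is $\exp_{d-1}(v)=\cos(|v|)u_0+\sin(|v|)(v/|v|,0)$ for $v\ne\mathbf 0$, $\exp_{d-1}(\mathbf 0)=u_0$; its inverse $\exp_{d-1}^{-1}$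 is defined on $\mathbb S^{d-1}\setminus\{-u_0\}$ with values in the ball of radius $\pi$ centered at the origin, and one puts $\exp_{d-1}^{-1}(-u_0)=(0,\dots,0,\pi)$. For $x\in\mathbb R^d\setminus\{\mathbf 0\}$, $$T^{(\lambda)}(x):=\Big(R_\lambda\exp_{d-1}^{-1}\tfrac{x}{|x|},\ R_\lambda^2\big(1-\tfrac{|x|}{R_\lambda}\big)\Big)\in\mathbb R^{d-1}\times\mathbb R,\qquad T^{(\lambda)}(\mathbf 0):=(\mathbf 0,R_\lambda^2).$$ Limit process: $\mathcal P$ is a Poisson point process on $\mathbb R^{d-1}\times\mathbb R$ (points $w=(v,h)$) with intensity $e^h\,dh\,dv$. $\Pi^{\downarrow}:=\{(v,h):h\le-|v|^2/2\}$ and $\Pi^{\downarrow}(w):=w\oplus\Pi^{\downarrow}$ (translate by $w$). $\Phi(\mathcal P)$ is the union of all $\Pi^{\downarrow}(w)$, $w\in\mathbb R^{d-1}\times\mathbb R$, such that $\mathcal P\cap{\rm int}(\Pi^{\downarrow}(w))=\emptyset$. ${\rm Ext}(\mathcal P)$ is the set of points of $\mathcal P$ lying on $\partial\Phi(\mathcal P)$. *)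

(* Defs.v *)
From HB Require Import structures.
From mathcomp Require Import all_boot all_order all_algebra.
From mathcomp Require Import all_classical all_reals all_analysis.
From mathcomp Require Import measurable_realfun.
Import Order.TTheory GRing.Theory Num.Theory.
Import numFieldNormedType.Exports.

Set Implicit Arguments.
Unset Strict Implicit.
Unset Printing Implicit Defensive.

Local Open Scope classical_set_scope.
Local Open Scope ring_scope.

(* Every process below is simple, so a point configuration is a locally finite
   subset [S] of [E], identified with the counting measure
   [B |-> counting (S `&` B)]. *)

Definition borel {E : topologicalType} : set (set E) := <<s open >>.

Definition locally_finite {E : topologicalType} : set (set E) :=
  [set S | forall K : set E, compact K -> finite_set (S `&` K)].

Definition test_function {R : realType} {E : topologicalType} (f : E -> R) :=
  continuous f /\ compact (closure [set x | f x != 0]).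

(* On a locally finite [S] the sum has finite support, hence is the integral
   of [f] against the counting measure of [S]. *)
Definition integrate_tests {R : realType} {E : topologicalType} (S : set E) :
    {ptws {f : E -> R | test_function f} -> R} :=
  fun f => \sum_(x \in S) sval f x.

(* The vague topology: the coarsest one for which integration against every
   test function is continuous. It is only meaningful on [locally_finite]. *)
Definition vague (R : realType) (E : topologicalType) : topologicalType :=
  initial_topology (@integrate_tests R E).

Definition point_process {R : realType} {E : topologicalType}
    {d : measure_display} {Omega : measurableType d} (xi : Omega -> set E) :=
  (forall w, locally_finite (xi w)) /\
  (forall B, borel B ->
    measurable_fun setT (fun w => counting (xi w `&` B) : \bar R)).

(* The random elements of the family may live on different probability
   spaces. Functionals are only constrained on [locally_finite], the space of
   configurations; [{within _, continuous _}] refers to its subspace topology. *)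
Definition converges_in_distribution {R : realType} {E : topologicalType}
    {I : Type} (F : set_system I)
    {d : I -> measure_display} {Omega : forall i, measurableType (d i)}
    (P : forall i, probability (Omega i) R) (xi : forall i, Omega i -> set E)
    {d' : measure_display} {Omega' : measurableType d'}
    (P' : probability Omega' R) (zeta : Omega' -> set E) :=
  [/\ \forall i \near F, point_process (R := R) (xi i),
      point_process (R := R) zeta &
      forall G : vague R E -> R,
        {within (locally_finite : set (vague R E)), continuous G} ->
        [bounded G S | S in locally_finite] ->
        ('E_(P i)[fun w => G (xi i w)] @[i --> F]
          --> 'E_P'[fun w => G (zeta w)])%E ].

(* [mu] is the intensity measure, given by its values on Borel sets. The laws
   of the counts on sets of infinite intensity follow by countable additivity.
   The second argument of [poisson_prob] is not used by the library. *)
Definition poisson_process {R : realType} {E : topologicalType}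
    {d : measure_display} {Omega : measurableType d} (P : probability Omega R)
    (mu : set E -> \bar R) (xi : Omega -> set E) :=
  [/\ point_process (R := R) xi,
      forall B, borel B -> (mu B < +oo)%E -> forall k : nat,
        P [set w | counting (xi w `&` B) = k%:R%:E :> \bar R] =
        poisson_prob (fine (mu B)) k [set k] &
      forall (m : nat) (B : 'I_m -> set E) (k : 'I_m -> nat),
        (forall i, borel (B i)) -> trivIset setT B ->
        P (\bigcap_i [set w | counting (xi w `&` B i) = (k i)%:R%:E :> \bar R]) =
        (\prod_(i < m)
          P [set w | counting (xi w `&` B i) = (k i)%:R%:E :> \bar R])%E ].

(* Integral over [R^n] as an iterated Lebesgue integral; for nonnegative Borel
   functions this is the integral against n-dimensional Lebesgue measure, by
   Tonelli's theorem. *)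
Fixpoint integral_rV {R : realType} (n : nat) :
    ('rV[R]_n -> \bar R) -> \bar R :=
  match n with
  | 0 => fun f => f 0
  | m.+1 => fun f =>
      (\int[lebesgue_measure]_(x in [set: R])
        integral_rV (fun v : 'rV[R]_m => f (row_mx (x%:M : 'rV[R]_1) v)))%E
  end.

(* The norm that the library puts on ['rV[R]_n] is the sup norm. *)
Definition enorm {R : realType} {n : nat} (x : 'rV[R]_n) : R :=
  Num.sqrt (\sum_(i < n) x 0 i ^+ 2).

Definition std_normal {R : realType} {d : nat} (x : 'rV[R]_d) : R :=
  (2 * pi) `^ (- (d%:R / 2)) * expR (- (enorm x ^+ 2 / 2)).

Definition gauss_intensity {R : realType} (d : nat) (lambda : R)
    (B : set 'rV[R]_d) : \bar R :=
  integral_rV (fun x => (lambda * std_normal x * \1_B x)%:E).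

Definition iid_std_normal {R : realType} {d : nat}
    {dO : measure_display} {Omega : measurableType dO} (P : probability Omega R)
    (X : nat -> Omega -> 'rV[R]_d) :=
  [/\ forall i B, borel B -> measurable (X i @^-1` B),
      forall i B, borel B ->
        P (X i @^-1` B) = integral_rV (fun x => (std_normal x * \1_B x)%:E) &
      forall (m : nat) (B : 'I_m -> set 'rV[R]_d), (forall i, borel (B i)) ->
        P (\bigcap_(i : 'I_m) (X i @^-1` B i)) =
        (\prod_(i < m) P (X i @^-1` B i))%E ].

Definition convex_hull {R : realType} {M : lmodType R} (A : set M) : set M :=
  smallest (@convex_set R M) A.

Definition extreme_points {R : realType} {M : lmodType R} (C : set M) : set M :=
  [set x | C x /\
    forall (y z : M) (t : R), C y -> C z -> 0 < t < 1 ->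
      x = t *: y + (1 - t) *: z -> y = x /\ z = x].

Definition hull_vertices {R : realType} {M : lmodType R} (A : set M) : set M :=
  extreme_points (convex_hull A).

(* From here on [n] stands for [d - 1]: the ambient space [R^d] is
   ['rV[R]_(n + 1)], and [row_mx v h] is the point with first [n] coordinates
   [v] and last coordinate [h]. *)

Definition scaling_radius {R : realType} (d : nat) (lambda : R) : R :=
  Num.sqrt (2 * ln lambda - ln (2 * (2 * pi) ^+ d * ln lambda)).

Definition north {R : realType} (n : nat) : 'rV[R]_(n + 1) :=
  row_mx 0 (1%:M : 'rV[R]_1).

Definition exp_map {R : realType} (n : nat) (v : 'rV[R]_n) : 'rV[R]_(n + 1) :=
  if v == 0 then north n
  else cos (enorm v) *: north n +
       sin (enorm v) *: row_mx ((enorm v)^-1 *: v) (0 : 'rV[R]_1).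

(* For a unit vector [u] other than [- north n] the set given to [xget] is a
   singleton. *)
Definition exp_map_inv {R : realType} (n : nat) (u : 'rV[R]_(n + 1)) :
    'rV[R]_n :=
  if u == - north n then \row_(i < n) (if i.+1 == n then pi else 0)
  else xget 0 [set v | enorm v < pi /\ exp_map v = u].

Definition scaling_transform {R : realType} (n : nat) (lambda : R)
    (x : 'rV[R]_(n + 1)) : 'rV[R]_n * R :=
  let r := scaling_radius (n + 1) lambda in
  if x == 0 then (0, r ^+ 2)
  else (r *: exp_map_inv ((enorm x)^-1 *: x), r ^+ 2 * (1 - enorm x / r)).

Definition limit_intensity {R : realType} (n : nat) (B : set ('rV[R]_n * R)) :
    \bar R :=
  integral_rV (fun v : 'rV[R]_n =>
    \int[lebesgue_measure]_(h in [set: R]) (expR h * \1_B (v, h))%:E)%E.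

Definition paraboloid {R : realType} (n : nat) : set ('rV[R]_n * R) :=
  [set w | w.2 <= - (enorm w.1 ^+ 2 / 2)].

Definition paraboloid_at {R : realType} (n : nat) (w : 'rV[R]_n * R) :
    set ('rV[R]_n * R) :=
  [set w + z | z in @paraboloid R n].

Definition paraboloid_hull {R : realType} (n : nat) (P : set ('rV[R]_n * R)) :
    set ('rV[R]_n * R) :=
  \bigcup_(w in [set w | P `&` (paraboloid_at w)° = set0]) paraboloid_at w.

Definition boundary {E : topologicalType} (A : set E) : set E :=
  closure A `\` A°.

Definition paraboloid_ext {R : realType} (n : nat) (P : set ('rV[R]_n * R)) :
    set ('rV[R]_n * R) :=
  P `&` boundary (paraboloid_hull P).

(* Main.v *)
Require Import Defs.
From HB Require Import structures.
From mathcomp Require Import all_boot all_order all_algebra.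
From mathcomp Require Import all_classical all_reals all_analysis.
From mathcomp Require Import measurable_realfun.
From mathcomp Require Import ring lra zify.
Import Order.TTheory GRing.Theory Num.Theory.
Import numFieldNormedType.Exports.

Set Implicit Arguments.
Unset Strict Implicit.
Unset Printing Implicit Defensive.

Local Open Scope classical_set_scope.
Local Open Scope ring_scope.

(** Write [r] for the scaling radius. In the affine coordinates
    [(v, h) = (y, r (r - z))] of a point [(y, z)] of the ambient space, the
    Gaussian intensity near the top of the ball of radius [r] is nearly
    [exp (h - |v|^2 / 2)], and an affine change of coordinates preserves convex
    hulls. Adding [|v|^2 / 2] to the height (the map [shear]) gives the limit
    process the same intensity [exp (h - |v|^2 / 2)] and turns the empty downward
    paraboloids into empty lower half-spaces. So in both problems the extreme
    points are the vertices of a lower convex hull, read off from point sets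
    that are asymptotically the same Poisson process; the scaling transform,
    expressed in the affine coordinates, tends to [unshear] locally uniformly.

    Deterministic part. For a set [S], [strictly_exposed S] is contained in the
    set of extreme points, which is contained in [weakly_exposed S]; this holds
    for the vertices of a convex hull ([strict_aff_hull_vertices],
    [aff_hull_vertices_weak]) and for the points on the boundary of the
    paraboloid hull ([strict_shear_paraboloid_ext], [shear_paraboloid_ext_weak]).
    Cut a large window into cubes of side [1 / q] and record which cubes are
    occupied. If [S] is in general position ([nice]), this finite code nearly
    determines the exposed points of every set with the same code, no point in
    the far region and no two nearby points in one cube; hence it nearly
    determines the value of any vaguely continuous functional
    ([images_integral], [nice_not_bad]).

    Probabilistic part. The probability that a set of cubes is empty tends to
    [exp (- sum of the masses)]; by inclusion-exclusion the law of the code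
    converges ([code_mass_limit]). Together with bounds on double points and on
    the far region this gives convergence of expectations
    ([family_convergence]). These inputs ([asymptotically_poisson]) are checked
    by explicit integrals for the Poisson processes ([poisson_family]), for the
    samples ([binomial_family]) and for the limit itself ([limit_family]).

    The limit is almost surely in general position ([nice_ae]): given the code
    of the other points, a point that is weakly but not strictly exposed has its
    height prescribed up to a bounded number of cubes in its column
    ([ambiguous_spread]), and summing the masses of these cubes gives a bound of
    order [1 / q] ([touching_ae]). *)

(** * Separation and the vertices of a convex hull *)

Section dot_product.
Context {R : realType} {m : nat}.
Implicit Types u v w : 'rV[R]_m.

Definition dotr u v : R := \sum_(i < m) u 0 i * v 0 i.

Lemma dotrC u v : dotr u v = dotr v u.
Proof. by apply: eq_bigr => i _; rewrite mulrC. Qed.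

Lemma dotrDr u v w : dotr u (v + w) = dotr u v + dotr u w.
Proof. by rewrite -big_split; apply: eq_bigr => i _; rewrite mxE mulrDr. Qed.

Lemma dotrZr (a : R) u v : dotr u (a *: v) = a * dotr u v.
Proof.
by rewrite mulr_sumr; apply: eq_bigr => i _; rewrite mxE mulrCA.
Qed.

Lemma dotrDl u v w : dotr (u + v) w = dotr u w + dotr v w.
Proof. by rewrite dotrC dotrDr !(dotrC w). Qed.

Lemma dotrZl (a : R) u v : dotr (a *: u) v = a * dotr u v.
Proof. by rewrite dotrC dotrZr dotrC. Qed.

Lemma dotrNr u v : dotr u (- v) = - dotr u v.
Proof. by rewrite -scaleN1r dotrZr mulN1r. Qed.

Lemma dotrNl u v : dotr (- u) v = - dotr u v.
Proof. by rewrite dotrC dotrNr dotrC. Qed.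

Lemma dotrBr u v w : dotr u (v - w) = dotr u v - dotr u w.
Proof. by rewrite dotrDr dotrNr. Qed.

Lemma dotrBl u v w : dotr (u - v) w = dotr u w - dotr v w.
Proof. by rewrite dotrDl dotrNl. Qed.

Lemma dotr0 u : dotr u 0 = 0.
Proof. by rewrite -[0](scale0r (0 : 'rV[R]_m)) dotrZr mul0r. Qed.

Lemma dot0r u : dotr 0 u = 0.
Proof. by rewrite dotrC dotr0. Qed.

Lemma dotr_suml (I : Type) (r : seq I) (F : I -> 'rV[R]_m) u :
  dotr (\sum_(i <- r) F i) u = \sum_(i <- r) dotr (F i) u.
Proof.
by apply: (big_morph (dotr^~ u)) => [v w|]; [exact: dotrDl|exact: dot0r].
Qed.

Lemma dotr_gt0 u : u != 0 -> 0 < dotr u u.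
Proof.
move=> u0; have [i ui] : exists i, u 0 i != 0.
  apply: contrapT => /forallNP h; move/eqP: u0; apply; apply/rowP => i.
  by rewrite mxE; apply/eqP; move: (h i) => /negP; rewrite negbK.
rewrite /dotr (bigD1 i)//=; apply: ltr_wpDr.
  by apply: sumr_ge0 => j _; rewrite -expr2 sqr_ge0.
by rewrite -expr2 lt_def sqr_ge0 sqrf_eq0 ui.
Qed.

Lemma enormE u : enorm u ^+ 2 = dotr u u.
Proof.
rewrite /enorm sqr_sqrtr; last by apply: sumr_ge0 => i _; exact: sqr_ge0.
by apply: eq_bigr => i _; rewrite expr2.
Qed.

Lemma enorm_ge0 u : 0 <= enorm u.
Proof. exact: sqrtr_ge0. Qed.

(** Gordan's alternative. The induction removes the last vector [s] by
    projecting the others on its orthogonal complement: a functional that is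
    negative on the projections can be tilted slightly towards [- s], and a
    vanishing combination of the projections is a combination of the original
    vectors equal to a multiple of [s]. *)
Lemma gordan (s : seq 'rV[R]_m) :
  (exists c, forall t, t \in s -> dotr c t < 0) \/
  (exists w : nat -> R, [/\ forall i, 0 <= w i,
     0 < \sum_(i < size s) w i & \sum_(i < size s) w i *: s`_i = 0]).
Proof.
have [k sk] := ubnP (size s); elim: k => // k IH in s sk *.
case: s sk => [|a s] /=; first by left; exists 0 => t; rewrite in_nil.
rewrite ltnS => sk.
have [a0|a0] := eqVneq a 0.
  right; exists (fun i => (i == 0)%:R); split => [i||]; first exact: ler0n.
  - by rewrite big_ord_recl /= ltr_pwDl// sumr_ge0.
  - rewrite big_ord_recl /= a0 scaler0 add0r big1// => i _.
    by rewrite scale0r.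
have [[c hc]|[w [w0 ws we]]] := IH s sk; last first.
  right; exists (fun i => if i is j.+1 then w j else 0); split.
  - by case.
  - by rewrite big_ord_recl /= add0r.
  - by rewrite big_ord_recl /= scale0r add0r.
have [ca|ca] := ltP (dotr c a) 0.
  left; exists c => t; rewrite inE => /orP[/eqP->//|]; exact: hc.
have aa := dotr_gt0 a0.
pose p (v : 'rV[R]_m) := v - (dotr v a / dotr a a) *: a.
have pa v : dotr (p v) a = 0.
  by rewrite dotrBl dotrZl divfK ?gt_eqF// subrr.
have [|[c' hc']|[w [w0 ws we]]] := IH (map p s); first by rewrite size_map.
  have hcp t : t \in s -> dotr (p c') t < 0.
    move=> ts; have := hc' _ (map_f p ts).
    have -> : dotr c' (p t) = dotr (p c') (p t).
      rewrite {2}/p dotrBl dotrZl (dotrC a) pa mulr0 subr0//.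
    by rewrite {2}/p dotrBr dotrZr pa mulr0 subr0.
  have [e e0 he] : exists2 e, 0 < e &
      forall t, t \in s -> dotr (p c') t - e * dotr a t < 0.
    elim: (s) hcp => [|b l IHl] hb; first by exists 1.
    have [|e e0 he] := IHl; first by move=> t tl; apply: hb; rewrite inE tl orbT.
    have hbb : dotr (p c') b < 0 by apply: hb; rewrite inE eqxx.
    pose e1 := - dotr (p c') b / (`|dotr a b| + 1) / 2.
    have e10 : 0 < e1 by rewrite /e1 !divr_gt0 ?oppr_gt0 ?ltr_wpDl.
    exists (Num.min e e1); first by rewrite lt_min e0.
    move=> t; rewrite inE => /orP[/eqP->|tl].
      have h1 : - (Num.min e e1 * dotr a b) <= e1 * `|dotr a b|.
        rewrite -mulrN (le_trans (ler_wpM2l _ (ler_norm _)))//.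
          by rewrite le_min !ltW.
        by rewrite normrN ler_wpM2r// ge_min lexx orbT.
      apply: le_lt_trans (_ : dotr (p c') b + e1 * (`|dotr a b| + 1) < 0).
        by rewrite lerD2l (le_trans h1)// ler_wpM2l ?lerDl// ltW.
      rewrite /e1 [X in _ + X](_ : _ = - dotr (p c') b / 2); last first.
        have : `|dotr a b| + 1 != 0 by rewrite gt_eqF// ltr_wpDl.
        by move: (`|_| + 1) => z z0; field.
      lra.
    have [at0|at0] := leP 0 (dotr a t).
      apply: le_lt_trans (_ : dotr (p c') t < 0).
        by rewrite gerBl mulr_ge0// le_min !ltW.
      by apply: hb; rewrite inE tl orbT.
    apply: le_lt_trans (he _ tl).
    rewrite lerD2l lerN2; apply: ler_wnM2r; first exact: ltW.
    by rewrite ge_min lexx.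
  left; exists (p c' - e *: a) => t; rewrite dotrBl dotrZl inE.
  move=> /orP[/eqP->|]; last exact: he.
  by rewrite pa sub0r oppr_lt0 mulr_gt0.
rewrite size_map in ws we.
pose v := \sum_(i < size s) w i *: s`_i.
pose b := dotr v a / dotr a a.
have vb : v = b *: a.
  apply/eqP; rewrite -subr_eq0 -we /v /b.
  have -> : \sum_(i < size s) w i *: (map p s)`_i = p v.
    rewrite (eq_bigr (fun i : 'I__ => w i *: s`_i - (w i * dotr s`_i a / dotr a a) *: a)).
      rewrite sumrB; congr (_ - _).
      rewrite -scaler_suml -mulr_suml; congr (_ / _ *: _).
      by rewrite /v dotr_suml; apply: eq_bigr => i _; rewrite dotrZl.
    move=> i _; rewrite (nth_map 0)// /p scalerBr scalerA.
    by rewrite mulrA.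
  done.
right; exists (fun i => if i is j.+1 then w j else - b).
have b0 : b <= 0.
  rewrite leNgt; apply/negP => b0.
  have : dotr c v < 0.
    have cs (i : 'I_(size s)) : dotr c s`_i < 0 by apply/hc/mem_nth.
    have -> : dotr c v = \sum_(i < size s) w i * dotr c s`_i.
      by rewrite dotrC dotr_suml; apply: eq_bigr => i _; rewrite dotrZl dotrC.
    have [i wi] : exists i : 'I_(size s), 0 < w i.
      apply: contrapT => /forallNP h; move: ws.
      rewrite big1 ?ltxx// => i _; apply/eqP; rewrite eq_le w0 andbT leNgt.
      exact/negP.
    rewrite (bigD1 i)//=.
    apply: le_lt_trans (_ : w i * dotr c s`_i < 0); last by rewrite pmulr_rlt0.
    rewrite gerDl.
    by apply: sumr_le0 => j _; rewrite mulr_ge0_le0// ltW.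
  by rewrite vb dotrZr ltNge mulr_ge0// ltW.
split; first by case=> [|i]//=; rewrite oppr_ge0.
- by rewrite big_ord_recl /= ltr_wpDl// oppr_ge0.
- by rewrite big_ord_recl /= -/v vb scaleNr addNr.
Qed.

End dot_product.

Section convexity.
Context {R : realType} {M : lmodType R}.
Implicit Types A : set M.

Lemma convex_setP A : convex_set A <-> forall x y (t : R), A x -> A y ->
  0 <= t -> t <= 1 -> A (t *: x + (1 - t) *: y).
Proof.
split=> [cA x y t Ax Ay t0 t1|cA x y l].
  have := cA x y (Itv01 t0 t1); rewrite !inE => /(_ Ax Ay).
  by congr (A _).
rewrite !inE => Ax Ay; apply: (cA x y l%:num) => //; exact: le1.
Qed.

Lemma convex_setI_family (F : set (set M)) :
  (forall A, F A -> convex_set A) -> convex_set (\bigcap_(A in F) A).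
Proof.
move=> cF; apply/convex_setP => x y t Ax Ay t0 t1 A FA.
by have /convex_setP := cF A FA; apply=> //; [exact: Ax|exact: Ay].
Qed.

Lemma convex_hull_convex A : convex_set (convex_hull A).
Proof. by apply: convex_setI_family => B [] . Qed.

Lemma sub_convex_hull A : A `<=` convex_hull A.
Proof. by move=> x Ax B [_]; exact. Qed.

Lemma convex_hull_min A B : convex_set B -> A `<=` B -> convex_hull A `<=` B.
Proof. by move=> cB AB x; apply. Qed.

Lemma convex_combination A (s : seq M) (w : nat -> R) : convex_set A ->
  (forall x, x \in s -> A x) -> (forall i, 0 <= w i) ->
  0 < \sum_(i < size s) w i ->
  A ((\sum_(i < size s) w i)^-1 *: \sum_(i < size s) w i *: s`_i).
Proof.
move=> /convex_setP cA; elim: s w => [|a s IH] w sA w0.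
  by rewrite big_ord0 ltxx.
rewrite !big_ord_recl /=.
set W := \sum_(i < size s) w (lift ord0 i).
set V := \sum_(i < size s) _ => ww0.
have sA' x : x \in s -> A x by move=> xs; apply: sA; rewrite inE xs orbT.
have Aa : A a by apply: sA; rewrite inE eqxx.
have [W0|W0] := leP W 0.
  have {}W0 : W = 0 by apply/eqP; rewrite eq_le W0 sumr_ge0.
  have -> : V = 0.
    apply: big1 => i _; suff -> : w (lift ord0 i) = 0 by rewrite scale0r.
    apply/eqP; rewrite eq_le w0 andbT -W0 /W (bigD1 i)//= lerDl.
    by apply: sumr_ge0.
  move: ww0; rewrite W0 !addr0 => ww0.
  by rewrite scalerA mulVf ?gt_eqF// scale1r.
have := IH (fun i => w i.+1) sA' (fun i => w0 _) W0.
rewrite -/W -/V => AV.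
have t0 : 0 <= w 0 / (w 0 + W) by rewrite divr_ge0// ltW.
have t1 : w 0 / (w 0 + W) <= 1 by rewrite ler_pdivrMr// mul1r lerDl ltW.
have := cA _ _ (w 0 / (w 0 + W)) Aa AV t0 t1.
have -> : 1 - w 0 / (w 0 + W) = W / (w 0 + W) by field; rewrite gt_eqF.
rewrite scalerA [W / _ * _](_ : _ = (w 0 + W)^-1); last first.
  by field; rewrite !gt_eqF.
by rewrite mulrC -scalerA -scalerDr.
Qed.

Lemma extreme_pointsD1_convex A x : convex_set A -> extreme_points A x ->
  convex_set (A `\ x).
Proof.
move=> /convex_setP cA [Ax ex]; apply/convex_setP => y z t [Ay yx] [Az zx] t0 t1.
split; first exact: cA.
move: t0; rewrite le_eqVlt => /orP[/eqP<-|t0].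
  by rewrite scale0r add0r subr0 scale1r.
move: t1; rewrite le_eqVlt => /orP[/eqP->|t1].
  by rewrite subrr scale0r addr0 scale1r.
by move=> /= e; have [] // := ex y z t Ay Az; rewrite ?t0.
Qed.

Lemma hull_vertices_sub A : hull_vertices A `<=` A.
Proof.
move=> x xA; apply: contrapT => nAx.
have h := extreme_pointsD1_convex (@convex_hull_convex A) xA.
case: xA => Cx _.
have : (convex_hull A `\ x) x; last by case=> _; apply.
apply: convex_hull_min Cx => // y Ay; split; first exact: sub_convex_hull.
by move=> /= yx; apply: nAx; rewrite -yx.
Qed.

End convexity.

Section vertices.
Context {R : realType} {m : nat}.
Implicit Types (A T : set 'rV[R]_m) (x : 'rV[R]_m).

(** If the functional did not exist, Gordan's alternative would write [x] as a
    convex combination of points of [T], whereas removing an extreme point leaves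
    the hull convex. *)
Lemma hull_vertices_separated A x T : hull_vertices A x -> finite_set T ->
  T `<=` A -> ~ T x -> exists c, forall y, T y -> dotr c y < dotr c x.
Proof.
move=> Ax /finite_seqP[s ->] sA sx.
have [[c hc]|[w [w0 ws we]]] := gordan [seq y - x | y <- s].
  by exists c => y ys; rewrite -subr_lt0 -dotrBr; apply: hc; exact: map_f.
have h := extreme_pointsD1_convex (@convex_hull_convex _ _ A) Ax.
rewrite size_map in ws we; exfalso.
have : (convex_hull A `\ x) x; last by case=> _; apply.
have e : (\sum_(i < size s) w i)^-1 *: \sum_(i < size s) w i *: s`_i = x.
  rewrite -[RHS]scale1r -(mulVf (lt0r_neq0 ws)) -scalerA; congr (_ *: _).
  rewrite scaler_suml; apply/eqP; rewrite -subr_eq0; apply/eqP.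
  rewrite -[RHS]we -sumrB.
  by apply: eq_bigr => i _; rewrite (nth_map 0)// scalerBr.
rewrite -[X in _ X]e.
apply: convex_combination; [exact: h| |exact: w0|exact: ws].
move=> y ys; split.
  by apply: sub_convex_hull; apply: sA.
by move=> /= yx; apply: sx; rewrite -yx.
Qed.

(** A segment through [x] with endpoints in the hull involves finitely many
    points of [A] only, so that separation from finite sets is enough. *)
Lemma separated_hull_vertices A x : A x ->
  (forall T, finite_set T -> T `<=` A `\ x ->
    exists c, forall y, T y -> dotr c y < dotr c x) ->
  hull_vertices A x.
Proof.
move=> Ax sep; split; first exact: sub_convex_hull.
pose U := [set p | exists T, [/\ finite_set T, T `<=` A & convex_hull T p]].
have hU : convex_hull A `<=` U.
  apply: convex_hull_min => [|y Ay]; last first.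
    exists [set y]; split; [exact: finite_set1|by move=> _ ->|].
    exact: sub_convex_hull.
  apply/convex_setP => y z t [T [fT TA Ty]] [T' [fT' TA' Tz]] t0 t1.
  exists (T `|` T'); split; first by rewrite finite_setU.
    by move=> p [/TA|/TA'].
  have /convex_setP := @convex_hull_convex _ _ (T `|` T'); apply => //.
    by apply: convex_hull_min Ty; [exact: convex_hull_convex|
      move=> p Tp; apply: sub_convex_hull; left].
  by apply: convex_hull_min Tz; [exact: convex_hull_convex|
    move=> p Tp; apply: sub_convex_hull; right].
move=> y z t /hU[T [fT TA Ty]] /hU[T' [fT' TA' Tz]] /andP[t0 t1] xe.
have [| |c hc] := sep ((T `|` T') `\ x).
- by apply: finite_setD; rewrite finite_setU.
- by move=> p [[/TA|/TA'] ? ?].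
pose W := [set p | p = x \/ dotr c p < dotr c x].
have cW : convex_set W.
  have [le1 le2] : (forall p, W p -> dotr c p <= dotr c x) /\ True.
    by split=> // p [->//|/ltW].
  apply/convex_setP => p q r Wp Wq r0 r1.
  move: r0 r1; rewrite !le_eqVlt => /orP[/eqP<-|r0].
    by rewrite scale0r add0r subr0 scale1r.
  move=> /orP[/eqP->|r1]; first by rewrite subrr scale0r addr0 scale1r.
  have := le1 _ Wp; have := le1 _ Wq => cq cp.
  have r1' : 0 < 1 - r by rewrite subr_gt0.
  case: Wp => [->|hp].
    case: Wq => [->|hq]; first by left; rewrite -scalerDl addrCA subrr addr0 scale1r.
    by right; rewrite dotrDr !dotrZr; nra.
  by right; rewrite dotrDr !dotrZr; nra.
have TW : T `|` T' `<=` W.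
  move=> p Tp; have [->|/eqP px] := eqVneq p x; first by left.
  by right; apply: hc.
have Wy : W y by apply: convex_hull_min Ty => // p Tp; apply: TW; left.
have Wz : W z by apply: convex_hull_min Tz => // p Tp; apply: TW; right.
have r1' : 0 < 1 - t by rewrite subr_gt0.
have : dotr c x = t * dotr c y + (1 - t) * dotr c z.
  by rewrite {1}xe dotrDr !dotrZr.
case: Wy => [->|hy]; case: Wz => [->|hz] // e; exfalso; nra.
Qed.

End vertices.

(** * Topology of finite-dimensional spaces *)

Section finite_dimensional.
Context {R : realType} {n : nat}.
Local Notation E := ('rV[R]_n * R)%type.

Lemma normr_coord (v : 'rV[R]_n) i : `|v 0 i| <= `|v|.
Proof.
have /mapP[j Hj ->] : `|v ord0 i| \in [seq `|v x.1 x.2| | x : 'I_1 * 'I_n].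
  by apply/mapP; exists (ord0, i) => //=; rewrite mem_enum.
by rewrite [leRHS]mx_normrE; apply/bigmax_geP; right => /=; exists j.
Qed.

Lemma normr_rV_le (v : 'rV[R]_n) (M : R) : 0 <= M ->
  (forall i, `|v 0 i| <= M) -> `|v| <= M.
Proof.
move=> M0 h; rewrite [leLHS]mx_normrE; apply: bigmax_le => //= -[i j] _ /=.
by rewrite ord1.
Qed.

Lemma normr_fst (p : E) : `|p.1| <= `|p|.
Proof. by rewrite prod_normE le_max lexx. Qed.

Lemma normr_snd (p : E) : `|p.2| <= `|p|.
Proof. by rewrite prod_normE le_max lexx orbT. Qed.

Lemma normr_pair_le (p : E) (M : R) : `|p.1| <= M -> `|p.2| <= M -> `|p| <= M.
Proof. by move=> h1 h2; rewrite prod_normE ge_max h1 h2. Qed.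

Lemma rV_continuous (T : topologicalType) (f : T -> 'rV[R]_n) :
  (forall i, continuous (fun t => f t 0 i)) -> continuous f.
Proof.
move=> cf t A [P hP hA].
have : \forall s \near t, forall i, P 0 i (f s 0 i).
  by apply: filter_forall => i; apply: (cf i t); exact: hP.
by apply: filterS => s hs; apply: hA => i j; rewrite !ord1.
Qed.

Lemma pair_continuous (T U V : topologicalType) (f : T -> U) (g : T -> V) :
  continuous f -> continuous g -> continuous (fun t => (f t, g t)).
Proof. by move=> cf cg t; apply: cvg_pair; [exact: cf|exact: cg]. Qed.

Lemma coord_fst_continuous i : continuous (fun p : E => p.1 0 i).
Proof.
move=> p; apply: (@continuous_comp _ _ _ fst (fun v : 'rV[R]_n => v 0 i)).
  exact: cvg_fst.
exact: coord_continuous.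
Qed.

Lemma coord_snd_continuous : continuous (fun p : E => p.2).
Proof. by move=> p; exact: cvg_snd. Qed.

Lemma continuousD_fun (T : topologicalType) (f g : T -> R) :
  continuous f -> continuous g -> continuous (fun t => f t + g t).
Proof. by move=> cf cg t; apply: cvgD; [exact: cf|exact: cg]. Qed.

Lemma continuousM_fun (T : topologicalType) (f g : T -> R) :
  continuous f -> continuous g -> continuous (fun t => f t * g t).
Proof. by move=> cf cg t; apply: cvgM; [exact: cf|exact: cg]. Qed.

Lemma continuousN_fun (T : topologicalType) (f : T -> R) :
  continuous f -> continuous (fun t => - f t).
Proof. by move=> cf t; apply: cvgN; exact: cf. Qed.

Lemma continuous_norm_fun (T : topologicalType) (f : T -> R) :
  continuous f -> continuous (fun t => `|f t|).
Proof. by move=> cf t; apply: cvg_norm; exact: cf. Qed.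

Lemma continuous_cst_fun (T : topologicalType) (c : R) :
  continuous (fun _ : T => c).
Proof. by move=> t; exact: cvg_cst. Qed.

Lemma continuous_sum (T : topologicalType) (I : finType) (F : I -> T -> R) :
  (forall i, continuous (F i)) -> continuous (fun t => \sum_i F i t).
Proof.
move=> cF; apply: continuous_big => //.
by move=> p; apply: cvgD; [exact: cvg_fst|exact: cvg_snd].
Qed.

Lemma continuous_dotr (T : topologicalType) (f g : T -> 'rV[R]_n) :
  continuous f -> continuous g -> continuous (fun t => dotr (f t) (g t)).
Proof.
move=> cf cg; apply: continuous_sum => i; apply: continuousM_fun.
  by move=> t; apply: (@continuous_comp _ _ _ f (fun v : 'rV[R]_n => v 0 i));
    [exact: cf|exact: coord_continuous].
by move=> t; apply: (@continuous_comp _ _ _ g (fun v : 'rV[R]_n => v 0 i));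
    [exact: cg|exact: coord_continuous].
Qed.

Lemma closed_le_fun (T : topologicalType) (f g : T -> R) :
  continuous f -> continuous g -> closed [set t | f t <= g t].
Proof.
move=> cf cg.
rewrite (_ : mkset _ = (fun t => g t - f t) @^-1` [set x | 0 <= x]); last first.
  by apply/seteqP; split=> t /=; rewrite subr_ge0.
apply: closed_comp; last exact: closed_ge.
move=> t _; apply: continuousD_fun => //; exact: continuousN_fun.
Qed.

Lemma open_lt_fun (T : topologicalType) (f g : T -> R) :
  continuous f -> continuous g -> open [set t | f t < g t].
Proof.
move=> cf cg; rewrite -closedC.
rewrite (_ : ~` _ = [set t | g t <= f t]); first exact: closed_le_fun.
by apply/seteqP; split=> t /=; rewrite leNgt => /negP.
Qed.

Lemma compact_rV_ball (M : R) : compact [set v : 'rV[R]_n | `|v| <= M].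
Proof.
apply: bounded_closed_compact.
  exists M; split; first exact: num_real.
  by move=> x Mx v /= /le_trans; apply; exact: ltW.
by apply: closed_le_fun; [exact: norm_continuous|exact: continuous_cst_fun].
Qed.

Lemma compact_pair_ball (M : R) : compact [set p : E | `|p| <= M].
Proof.
rewrite (_ : mkset _ = [set v : 'rV[R]_n | `|v| <= M] `*` `[- M, M]%classic).
  by apply: compact_setX; [exact: compact_rV_ball|exact: segment_compact].
apply/seteqP; split=> [p /= h|p [/= h]].
  split => /=; first exact: le_trans (normr_fst _) h.
  by rewrite in_itv/= -ler_norml; exact: le_trans (normr_snd _) h.
by rewrite in_itv/= -ler_norml => h'; exact: normr_pair_le.
Qed.

Lemma compact_pair_bounded (K : set E) : compact K ->
  exists M : R, forall p, K p -> `|p| <= M.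
Proof.
move=> /compact_bounded[M [_ hM]]; exists (M + 1) => p Kp.
by apply: hM => //; rewrite ltrDl.
Qed.

(** A cluster point, in the form used below: it belongs to every closed set that
    eventually contains the sequence. *)
Lemma compact_sequence_cluster (T : topologicalType) (K : set T)
    (u : nat -> T) : compact K -> (forall k, K (u k)) ->
  exists2 p, K p & forall C, closed C -> (\forall k \near \oo, C (u k)) -> C p.
Proof.
move=> cK Ku; have [|p [Kp up]] := cK (u @ \oo) _.
  by exists 0%N => // k _; exact: Ku.
exists p => // C cC uC; apply: cC => U pU.
by have [q [? ?]] := up C U uC pU; exists q.
Qed.

End finite_dimensional.

Arguments compact_sequence_cluster {T}.

(** * Exposed points in affine coordinates *)

Section exposed.
Context {R : realType} {n : nat}.
Local Notation E := ('rV[R]_n * R)%type.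
Implicit Types (S : set E) (p x y : E) (a v : 'rV[R]_n).

Definition pairing (c p : E) : R := dotr c.1 p.1 + c.2 * p.2.

(** Extreme points lie between the next two sets, which agree for sets in general
    position. The first one is stable under limits, the second one under
    perturbations. *)
Definition weakly_exposed S : set E := [set x | S x /\
  exists2 c : E, c != 0 & forall y, S y -> pairing c x <= pairing c y].

Definition strictly_exposed S : set E := [set x | S x /\
  exists a, forall y, S y -> y <> x -> dotr a (y.1 - x.1) < y.2 - x.2].

Definition l1norm a : R := \sum_i `|a 0 i|.

Lemma l1norm_ge0 a : 0 <= l1norm a.
Proof. exact: sumr_ge0. Qed.

Lemma dotr_l1 a v : `|dotr a v| <= l1norm a * `|v|.
Proof.
apply: le_trans (ler_norm_sum _ _ _) _; rewrite mulr_suml.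
by apply: ler_sum => i _; rewrite normrM ler_wpM2l// normr_coord.
Qed.

Lemma dotr_l1_le a v (b d : R) : l1norm a <= b -> `|v| <= d ->
  dotr a v <= b * d.
Proof.
move=> ab vd; apply: le_trans (ler_norm _) _; apply: le_trans (dotr_l1 _ _) _.
by rewrite ler_pM// l1norm_ge0.
Qed.

Lemma dotr_l1_ge a v (b d : R) : l1norm a <= b -> `|v| <= d ->
  - (b * d) <= dotr a v.
Proof.
by move=> ab vd; rewrite -lerN2 opprK -dotrNr dotr_l1_le// normrN.
Qed.

Lemma l1norm_norm a : l1norm a <= n%:R * `|a|.
Proof.
have -> : n%:R * `|a| = \sum_(i < n) `|a| by rewrite sumr_const card_ord mulr_natl.
by apply: ler_sum => i _; exact: normr_coord.
Qed.

Lemma pairing_le (c p : E) : `|pairing c p| <= (n.+1)%:R * `|c| * `|p|.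
Proof.
apply: le_trans (ler_normD _ _) _.
rewrite -natr1 !mulrDl lerD//.
  apply: le_trans (dotr_l1 _ _) _; rewrite ler_pM ?l1norm_ge0 ?normr_fst//.
  apply: le_trans (l1norm_norm _) _; rewrite ler_wpM2l ?normr_fst//.
by rewrite normrM mul1r ler_pM ?normr_snd.
Qed.

Lemma pairingBr (c p q : E) : pairing c (p - q) = pairing c p - pairing c q.
Proof. by rewrite /pairing /= dotrBr; ring. Qed.

Lemma pairingZl (k : R) (c p : E) : pairing (k *: c) p = k * pairing c p.
Proof. by rewrite /pairing /= dotrZl; rewrite /GRing.scale/=; ring. Qed.

Lemma continuous_pairing p : continuous (fun c : E => pairing c p).
Proof.
apply: continuousD_fun.
  apply: continuous_dotr; last by move=> c; exact: cvg_cst.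
  by move=> c; exact: cvg_fst.
apply: continuousM_fun; first exact: coord_snd_continuous.
exact: continuous_cst_fun.
Qed.

(** By compactness of the unit sphere, functionals that support larger and larger
    parts of [S] at [x], up to smaller and smaller errors, have a cluster point. *)
Lemma weakly_exposed_limit S x : S x ->
  (forall k : nat, exists c : E, `|c| = 1 /\
    forall y, S y -> `|y| <= k%:R ->
      pairing c x <= pairing c y + k.+1%:R^-1) ->
  weakly_exposed S x.
Proof.
move=> Sx /choice[u hu']; split => //.
have u1 k := (hu' k).1; have hu k := (hu' k).2.
have [] := compact_sequence_cluster _ u (@compact_pair_ball R n 1).
  by move=> k /=; rewrite u1.
move=> c _ cl; exists c.
  have : [set c : E | 1 <= `|c|] c.
    apply: cl; last by near=> k; rewrite /= u1.
    by apply: closed_le_fun; [exact: continuous_cst_fun|exact: norm_continuous].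
  by move=> /=; apply: contraTneq => ->; rewrite normr0 ler10.
move=> y Sy; apply/ler_addgt0Pl => e e0.
have : [set c : E | pairing c x <= e + pairing c y] c; last by [].
apply: cl.
  apply: closed_le_fun; first exact: continuous_pairing.
  by apply: continuousD_fun; [exact: continuous_cst_fun|exact: continuous_pairing].
near=> k => /=; apply: le_trans (hu k y Sy _) _.
  by near: k; exact: nbhs_infty_ger.
rewrite addrC lerD2r; apply/ltW; near: k.
exact: near_infty_natSinv_lt (PosNum e0).
Unshelve. all: by end_near. Qed.

End exposed.

Section affine_coordinates.
Context {R : realType} {n : nat}.
Local Notation E := ('rV[R]_n * R)%type.
Implicit Types (S : set 'rV[R]_(n + 1)) (x y : 'rV[R]_(n + 1)) (r : R).

Definition height x : R := rsubmx x 0 0.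

(** Rescaled coordinates around the point at distance [r] in the direction of the
    last axis; the image of the sphere of radius [r] is nearly a paraboloid. *)
Definition aff r x : E := (lsubmx x, r * (r - height x)).

Definition unaff r (p : E) : 'rV[R]_(n + 1) := row_mx p.1 (r - p.2 / r)%:M.

Lemma affK r : r != 0 -> cancel (aff r) (unaff r).
Proof.
move=> r0 x; rewrite -[RHS]hsubmxK /unaff /aff /=; congr row_mx.
apply/rowP => i; rewrite ord1 !mxE eqxx mulr1n.
rewrite mulrAC divff// mul1r subKr /height mxE; congr (x 0 _).
Qed.

Lemma unaffK r : r != 0 -> cancel (unaff r) (aff r).
Proof.
move=> r0 [v h]; rewrite /unaff /aff /height /= row_mxKl row_mxKr !mxE /=.
by rewrite mulr1n subKr mulrC divfK.
Qed.

Lemma aff_inj r : r != 0 -> injective (aff r).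
Proof. by move=> r0; exact: can_inj (affK r0). Qed.

Lemma dotr_split (c x : 'rV[R]_(n + 1)) :
  dotr c x = dotr (lsubmx c) (lsubmx x) + height c * height x.
Proof.
rewrite /dotr big_split_ord /= big_ord1 /height !mxE; congr (_ + _).
by apply: eq_bigr => i _; rewrite !mxE.
Qed.

Lemma compact_rV_bounded (m : nat) (K : set 'rV[R]_m) : compact K ->
  exists M : R, forall p, K p -> `|p| <= M.
Proof.
move=> /compact_bounded[M [_ hM]]; exists (M + 1) => p Kp.
by apply: hM => //; rewrite ltrDl.
Qed.

(** The functionals separating [x] from the finite parts of [S] in larger and
    larger balls, normalised, have a cluster point. *)
Lemma hull_vertices_supported S x : locally_finite S -> hull_vertices S x ->
  exists2 c : 'rV[R]_(n + 1), c != 0 & forall y, S y -> dotr c y <= dotr c x.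
Proof.
move=> lfS Vx; have Sx := hull_vertices_sub Vx.
have /choice[u hu'] : forall k : nat, exists c : 'rV[R]_(n + 1), `|c| = 1 /\
    forall y, S y -> `|y| <= k%:R -> dotr c y <= dotr c x.
  move=> k; have [|||c hc] := hull_vertices_separated Vx
      (T := (S `&` [set y | `|y| <= k%:R]) `\ x).
  - by apply: finite_setD; apply: lfS; exact: compact_rV_ball.
  - by move=> y [[]].
  - by case=> _; apply.
  have [c0|c0] := eqVneq c 0.
    exists (const_mx 1); split.
      apply/eqP; rewrite eq_le; apply/andP; split.
        by apply: normr_rV_le => // i; rewrite mxE normr1.
      have := normr_coord (const_mx 1 : 'rV[R]_(n + 1)) (rshift n ord0).
      by rewrite mxE normr1.
    move=> y Sy yk; have [->//|/eqP yx] := eqVneq y x.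
    by have := hc y (conj (conj Sy yk) yx); rewrite c0 !dot0r ltxx.
  exists (`|c|^-1 *: c); split.
    by rewrite normrZ normfV normr_id mulVf// normr_eq0.
  move=> y Sy yk; have [->//|/eqP yx] := eqVneq y x.
  rewrite !dotrZl ler_wpM2l ?invr_ge0// ltW//.
  by apply: hc; split.
have u1 k := (hu' k).1; have hu k := (hu' k).2.
have [] := compact_sequence_cluster _ u (@compact_rV_ball R (n + 1) 1).
  by move=> k /=; rewrite u1.
move=> c _ cl; exists c.
  have : [set c : 'rV[R]_(n + 1) | 1 <= `|c|] c.
    apply: cl; last by near=> k; rewrite /= u1.
    by apply: closed_le_fun; [exact: continuous_cst_fun|exact: norm_continuous].
  by move=> /=; apply: contraTneq => ->; rewrite normr0 ler10.
move=> y Sy; have : [set c | dotr c y <= dotr c x] c; last by [].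
apply: cl.
  have h (q : 'rV[R]_(n + 1)) : continuous (fun c => dotr c q).
    apply: continuous_dotr; first by move=> z; exact: cvg_id.
    exact: cst_continuous.
  exact: closed_le_fun.
near=> k; apply: hu => //.
by near: k; exact: nbhs_infty_ger.
Unshelve. all: by end_near. Qed.

Lemma aff_hull_vertices_weak r S : 0 < r -> locally_finite S ->
  aff r @` hull_vertices S `<=` weakly_exposed (aff r @` S).
Proof.
move=> r0 lfS _ [x Vx <-]; split.
  by exists x => //; exact: hull_vertices_sub.
have [c c0 hc] := hull_vertices_supported lfS Vx.
have pE y : pairing (- lsubmx c, height c / r) (aff r y)
    = height c * r - dotr c y.
  by rewrite /pairing /aff /= dotr_split dotrNl; field; rewrite gt_eqF.
exists (- lsubmx c, height c / r).
  apply: contra_neq c0 => -[/eqP]; rewrite oppr_eq0 => /eqP l0 /eqP.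
  rewrite mulf_eq0 invr_eq0 (gt_eqF r0) orbF => /eqP h0.
  rewrite -[LHS]hsubmxK l0; apply/rowP => i; rewrite !mxE.
  by case: splitP => j _; rewrite !mxE ?ord1 -?h0 /height ?mxE.
by move=> _ [y Sy <-]; rewrite !pE lerD2l lerN2; exact: hc.
Qed.

Lemma strict_aff_hull_vertices r S : 0 < r ->
  strictly_exposed (aff r @` S) `<=` aff r @` hull_vertices S.
Proof.
move=> r0 _ [[x Sx <-] [a ha]]; exists x => //.
apply: separated_hull_vertices => // T _ TS.
exists (row_mx a r%:M) => y /TS[Sy yx].
have := ha (aff r y) _ _; rewrite dotrBr !dotr_split row_mxKl /=.
have -> : height (row_mx a r%:M) = r.
  by rewrite /height row_mxKr mxE eqxx mulr1n.
suff : aff r y <> aff r x.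
  by move=> ne /(_ (ex_intro2 _ _ y Sy erefl) ne); lra.
by move=> /(aff_inj (lt0r_neq0 r0)) /yx.
Qed.

End affine_coordinates.

(** * Paraboloid hulls as lower convex hulls *)

Section paraboloid.
Context {R : realType} {n : nat}.
Local Notation E := ('rV[R]_n * R)%type.
Implicit Types (S : set E) (p x y w : E) (a v : 'rV[R]_n).

(** Adding [|v|^2 / 2] to the height turns the downward paraboloids into the
    lower half-spaces, the apex [w] giving the slope [w.1]. *)
Definition shear p : E := (p.1, p.2 + enorm p.1 ^+ 2 / 2).

Definition unshear p : E := (p.1, p.2 - enorm p.1 ^+ 2 / 2).

Lemma shearK : cancel shear unshear.
Proof. by case=> v h; rewrite /shear /unshear /= addrK. Qed.

Lemma unshearK : cancel unshear shear.
Proof. by case=> v h; rewrite /shear /unshear /= subrK. Qed.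

Lemma shear_inj : injective shear.
Proof. exact: can_inj shearK. Qed.

Lemma unshear_inj : injective unshear.
Proof. exact: can_inj unshearK. Qed.

Lemma continuous_enorm2 : continuous (fun p : E => enorm p.1 ^+ 2).
Proof.
rewrite (_ : (fun p : E => _) = fun p => dotr p.1 p.1); last first.
  by apply/funext => p; rewrite enormE.
by apply: continuous_dotr => p; exact: cvg_fst.
Qed.

Lemma continuous_shear : continuous shear.
Proof.
apply: pair_continuous; first by move=> p; exact: cvg_fst.
apply: continuousD_fun; first exact: coord_snd_continuous.
apply: continuousM_fun; first exact: continuous_enorm2.
exact: continuous_cst_fun.
Qed.

Lemma continuous_unshear : continuous unshear.
Proof.
apply: pair_continuous; first by move=> p; exact: cvg_fst.
apply: continuousD_fun; first exact: coord_snd_continuous.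
apply: continuousN_fun.
apply: continuousM_fun; first exact: continuous_enorm2.
exact: continuous_cst_fun.
Qed.

(** In sheared coordinates the grain with apex [w] is a lower half-space; this
    is the level of its boundary above [v]. *)
Definition grain_level w v : R := dotr w.1 v + (w.2 - enorm w.1 ^+ 2 / 2).

Lemma enormB v a : enorm (v - a) ^+ 2 = enorm v ^+ 2 - 2 * dotr a v + enorm a ^+ 2.
Proof. by rewrite !enormE dotrBl !dotrBr (dotrC v a); ring. Qed.

Lemma paraboloid_atE w p : paraboloid_at w p <->
  (shear p).2 <= grain_level w p.1.
Proof.
have e : p = w + (p - w) by rewrite addrC subrK.
split=> [[z hz <-]|h].
  move: hz; rewrite /paraboloid /grain_level /=.
  have -> : enorm z.1 ^+ 2 = enorm (w.1 + z.1 - w.1) ^+ 2 by rewrite addrC addKr.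
  by rewrite enormB; lra.
exists (p - w); last by rewrite addrC subrK.
by move: h; rewrite /paraboloid /grain_level /= enormB; lra.
Qed.

Lemma interior_paraboloid_atE w p : (paraboloid_at w)° p <->
  (shear p).2 < grain_level w p.1.
Proof.
split=> [|h].
  move/nbhs_ballP => [e /= e0 he].
  have : paraboloid_at w (p.1, p.2 + e / 2).
    apply: he; split => /=; first exact: ballxx.
    rewrite -ball_normE /ball_/= opprD addrA subrr add0r normrN gtr0_norm.
      by rewrite ltr_pdivrMr// ltr_pMr// ltr1n.
    by rewrite divr_gt0.
  by rewrite paraboloid_atE /=; lra.
have : open [set p : E | (shear p).2 < grain_level w p.1].
  apply: open_lt_fun.
    by move=> q; apply: (@continuous_comp _ _ _ shear snd);
      [exact: continuous_shear|exact: cvg_snd].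
  apply: continuousD_fun; last exact: continuous_cst_fun.
  by apply: continuous_dotr; [exact: cst_continuous|move=> q; exact: cvg_fst].
move=> o; have {}o := open_nbhs_nbhs (conj o h); rewrite /interior.
by apply: filterS o => q /ltW /paraboloid_atE.
Qed.

Lemma paraboloid_hullE S p : paraboloid_hull S p <-> exists a b,
  (forall y, S y -> dotr a y.1 + b <= (shear y).2) /\
  (shear p).2 <= dotr a p.1 + b.
Proof.
split=> [[w /= Sw /paraboloid_atE wp]|[a [b [ab abp]]]].
  exists w.1, (w.2 - enorm w.1 ^+ 2 / 2); split => // y Sy.
  rewrite leNgt; apply/negP => /interior_paraboloid_atE Wy.
  by have : (S `&` (paraboloid_at w)°) y by []; rewrite Sw.
exists (a, b + enorm a ^+ 2 / 2); last first.
  by apply/paraboloid_atE; rewrite /grain_level /= addrK.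
apply/seteqP; split=> // y [/ab + /interior_paraboloid_atE].
by rewrite /grain_level /= addrK => h1; rewrite ltNge h1.
Qed.

Lemma paraboloid_hull_interior S x : S x -> ~ (paraboloid_hull S)° x.
Proof.
move=> Sx /nbhs_ballP [e /= e0 he].
have : paraboloid_hull S (x.1, x.2 + e / 2).
  apply: he; split => /=; first exact: ballxx.
  rewrite -ball_normE /ball_/= opprD addrA subrr add0r normrN gtr0_norm.
    by rewrite ltr_pdivrMr// ltr_pMr// ltr1n.
  by rewrite divr_gt0.
by move=> /paraboloid_hullE[a [b [/(_ x Sx) /=]]]; lra.
Qed.

Lemma dotr_sgn a : dotr a (\row_i Num.sg (a 0 i)) = l1norm a.
Proof. by apply: eq_bigr => i _; rewrite mxE normrEsg mulrC. Qed.

Lemma norm_sgn_row a : `|\row_i Num.sg (a 0 i)| <= 1 :> R.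
Proof.
apply: normr_rV_le => // i; rewrite mxE normr_sg.
by case: eqVneq => _ //=; rewrite ?ler01.
Qed.

(** A point is in the closure of the hull exactly when it is nearly below some
    empty half-space; the factor [1 + l1norm a] is the amount by which moving
    the point by [e] changes its height above a hyperplane of slope [a]. *)
Lemma paraboloid_extE S x : paraboloid_ext S x <-> S x /\
  forall e : R, 0 < e -> exists a b,
    (forall y, S y -> dotr a y.1 + b <= (shear y).2) /\
    (shear x).2 <= dotr a x.1 + b + e * (1 + l1norm a).
Proof.
split=> [[Sx [cl _]]|[Sx h]]; last first.
  split => //; split; last exact: paraboloid_hull_interior.
  move=> U Ux.
  have : \forall p \near shear x, U (unshear p).
    by apply: (continuous_unshear (x := shear x)); rewrite shearK.
  move=> /nbhs_ballP [e /= e0 he].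
  have [a [b [ab abx]]] := h (e / 2) (divr_gt0 e0 (ltr0Sn _ 1)).
  pose q : E := (x.1 + (e / 2) *: \row_i Num.sg (a 0 i), (shear x).2 - e / 2).
  exists (unshear q); split; last first.
    apply: he; rewrite -ball_normE /ball_ /=.
    apply: le_lt_trans (_ : e / 2 < e); last by lra.
    apply: normr_pair_le => /=.
      rewrite opprD addrA subrr add0r normrN normrZ gtr0_norm ?divr_gt0//.
      by rewrite ler_piMr ?norm_sgn_row// divr_ge0// ltW.
    by rewrite opprB addrC subrK gtr0_norm ?divr_gt0.
  apply/paraboloid_hullE; exists a, b; split => //.
  by rewrite unshearK /= dotrDr dotrZr dotr_sgn; move: abx => /=; lra.
split => // e e0.
have : \forall p \near x, `|shear x - shear p| < e.
  have := @continuous_shear x (ball (shear x) e) (nbhsx_ballx _ _ e0).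
  by rewrite -ball_normE.
move=> /cl [p [/paraboloid_hullE[a [b [ab abp]]] pe]].
exists a, b; split => //.
have h2 := le_lt_trans (normr_snd _) pe; rewrite /= ltr_norml in h2.
have h1 := le_lt_trans (normr_fst _) pe; rewrite /= in h1.
have := @dotr_l1_ge _ _ a (x.1 - p.1) _ _ (lexx _) (ltW h1).
rewrite dotrBr; move: abp h2 => /=; nra.
Qed.

(** The half-space below the strictly supporting hyperplane through [x] is an
    empty grain with [x] on its boundary. *)
Lemma strict_shear_paraboloid_ext S :
  strictly_exposed (shear @` S) `<=` shear @` paraboloid_ext S.
Proof.
move=> _ [[x Sx <-] [a ha]]; exists x => //; apply/paraboloid_extE; split=> //.
move=> e e0; exists a, ((shear x).2 - dotr a x.1); split=> [y Sy|]; last first.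
  have := l1norm_ge0 a; rewrite [dotr a x.1 + _]addrC subrK lerDl => l0.
  by rewrite mulr_ge0 ?(ltW e0)// addr_ge0.
have [->|yx] := eqVneq y x; first by lra.
have := ha (shear y) (ex_intro2 _ _ y Sy erefl) _.
rewrite dotrBr => h; have /h : shear y <> shear x.
  by move=> /shear_inj /eqP; rewrite (negPf yx).
by move=> /=; lra.
Qed.

(** Empty half-spaces nearly reaching [x] give nearly supporting functionals,
    and these have a limit. *)
Lemma shear_paraboloid_ext_weak S :
  shear @` paraboloid_ext S `<=` weakly_exposed (shear @` S).
Proof.
move=> _ [x /paraboloid_extE[Sx h] <-]; apply: weakly_exposed_limit.
  by exists x.
move=> k; pose e := (n.+1%:R * k.+1%:R)^-1 : R.
have e0 : 0 < e by rewrite invr_gt0 mulr_gt0.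
have [a [b [ab abx]]] := h e e0.
pose c : E := (- a, 1).
have c1 : 1 <= `|c| by apply: le_trans (normr_snd _); rewrite normr1.
have c0 : 0 < `|c| by exact: lt_le_trans c1.
exists (`|c|^-1 *: c); split.
  by rewrite normrZ normfV normr_id mulVf// gt_eqF.
move=> _ [y Sy <-] _; rewrite !pairingZl -lerBlDl -mulrBr.
rewrite mulrC ler_pdivrMr//.
have lc : 1 + l1norm a <= n.+1%:R * `|c|.
  rewrite -natr1 mulrDl mul1r addrC lerD//.
  apply: le_trans (l1norm_norm _) _; rewrite ler_wpM2l//.
  by apply: le_trans (normr_fst _); rewrite normrN.
have : e * (1 + l1norm a) <= k.+1%:R^-1 * `|c|.
  apply: le_trans (_ : e * (n.+1%:R * `|c|) <= _); first by rewrite ler_pM2l.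
  by rewrite /e invfM mulrA (mulrAC _ _ n.+1%:R) mulVf ?pnatr_eq0// mul1r.
have := ab y Sy; move: abx; rewrite /pairing /c /= !dotrNl.
by move: (e * _) (_^-1 * _) => u w; lra.
Qed.

End paraboloid.

(** * Stability of exposed points under discretisation *)

Lemma near_finite_set (T : choiceType) (I : Type) (F : set_system I)
    (D : set T) (P : T -> I -> Prop) : Filter F -> finite_set D ->
  (forall x, D x -> \forall i \near F, P x i) ->
  \forall i \near F, forall x, D x -> P x i.
Proof.
move=> FF /finite_seqP[s ->]; elim: s => [|a s IH] h.
  by apply: nearW => i x.
have h1 : \forall i \near F, P a i by apply: h; rewrite /= inE eqxx.
have h2 : \forall i \near F, forall x, x \in s -> P x i.
  by apply: IH => x xs; apply: h; rewrite /= inE xs orbT.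
apply: filterS2 h1 h2 => i h1 h2 x /=.
by rewrite inE => /orP[/eqP->|/h2].
Qed.

Section cells.
Context {R : realType} {n : nat}.
Local Notation E := ('rV[R]_n * R)%type.
Implicit Types (S V : set E) (p x y : E) (q A : nat).

Definition icell q (i : nat) : set R :=
  [set t | i%:R <= q.+1%:R * t + q.+1%:R ^+ 3 < i.+1%:R].

Definition cell_index q : finType :=
  ({ffun 'I_n -> 'I_(2 * q.+1 ^ 3)} * 'I_(2 * q.+1 ^ 3))%type.

(** Cubes of side [1 / q.+1] that tile the window [- q.+1 ^ 2, q.+1 ^ 2). *)
Definition cell q (j : cell_index q) : set E :=
  [set p : E | (forall i, icell q (j.1 i) (p.1 0 i)) /\ icell q j.2 p.2].

Arguments cell q j _ : clear implicits.

Lemma icell_cover q (t : R) : `|t| < q.+1%:R ^+ 2 ->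
  exists i : 'I_(2 * q.+1 ^ 3), icell q i t.
Proof.
rewrite ltr_norml => /andP[t1 t2]; pose u := q.+1%:R * t + q.+1%:R ^+ 3 : R.
have Q0 : 0 < q.+1%:R :> R by [].
have u0 : 0 <= u by rewrite /u exprS -mulrDr mulr_ge0// -lerBlDr sub0r ltW.
have /andP[h1 h2] := truncn_itv u0.
have hi : (Num.truncn u < 2 * q.+1 ^ 3)%N.
  rewrite -(ltr_nat R); apply: le_lt_trans h1 _.
  rewrite natrM natrX mulr_natl mulr2n /u ltrD2r [ltRHS]exprS.
  by rewrite ltr_pM2l.
by exists (Ordinal hi); rewrite /icell /= h1 h2.
Qed.

Lemma cell_cover q p : `|p| < q.+1%:R ^+ 2 -> exists j, cell q j p.
Proof.
move=> pq; have h1 := le_lt_trans (normr_fst p) pq.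
have h2 := le_lt_trans (normr_snd p) pq.
have /choice[f hf] : forall i, exists k : 'I_(2 * q.+1 ^ 3), icell q k (p.1 0 i).
  by move=> i; apply: icell_cover; exact: le_lt_trans (normr_coord _ _) h1.
have [k hk] := icell_cover h2.
by exists (finfun f, k); split=> //= i; rewrite ffunE.
Qed.

Lemma icell_dist q i (s t : R) : icell q i s -> icell q i t ->
  `|s - t| <= q.+1%:R^-1.
Proof.
rewrite /icell /= -(natr1 i) => /andP[s1 s2] /andP[t1 t2].
have Q0 : 0 < q.+1%:R :> R by [].
rewrite -[_^-1]mul1r ler_pdivlMr// -{1}(gtr0_norm Q0) -normrM ler_norml.
by rewrite mulrC mulrBr; apply/andP; split; lra.
Qed.

Lemma cell_dist q j p p' : cell q j p -> cell q j p' -> `|p - p'| <= q.+1%:R^-1.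
Proof.
move=> [h1 h2] [h1' h2']; apply: normr_pair_le => /=.
  by apply: normr_rV_le => [|i]; rewrite ?mxE ?invr_ge0//; exact: icell_dist.
exact: icell_dist h2 h2'.
Qed.

Lemma icell_inj q (i i' : nat) (t : R) : icell q i t -> icell q i' t -> i = i'.
Proof.
rewrite /icell /= => /andP[a b] /andP[c d]; apply/eqP; rewrite eqn_leq.
have := le_lt_trans a d; have := le_lt_trans c b.
by rewrite !ltr_nat !ltnS => -> ->.
Qed.

Lemma cell_inj q j j' p : cell q j p -> cell q j' p -> j = j'.
Proof.
case: j j' => [f k] [f' k'] [/= h1 h2] [/= h1' h2']; congr pair.
  by apply/ffunP => i; apply/val_inj/(icell_inj (h1 i) (h1' i)).
exact/val_inj/(icell_inj h2 h2').
Qed.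

Definition code q S : {set cell_index q} :=
  [set j | `[< S `&` cell q j !=set0 >]].

Lemma in_code q S j : j \in code q S <-> exists2 p, S p & cell q j p.
Proof. by rewrite inE; split=> [/asboolP[p [? ?]]|[p ? ?]]; [exists p|apply/asboolP; exists p]. Qed.

(** The region below a cone of slope [A]: it contains every lower half-space
    with slope and level controlled by [A]. *)
Definition cone A : set E := [set p : E | p.2 <= A%:R * (1 + l1norm p.1)].

(** Where the code gives no information on the points below the cone. *)
Definition far A q : set E :=
  cone A `&` [set p : E | q.+1%:R < `|p.1| \/ p.2 < - q.+1%:R].

Definition no_double A q S := forall j p p', S p -> S p' ->
  cell q j p -> cell q j p' -> `|p| <= A%:R -> p' = p.

(** General position, as it holds almost surely for the limit process. The
    points in every orthant exclude vertical supporting hyperplanes. *)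
Definition nice S := [/\ locally_finite S,
  forall A, finite_set (S `&` cone A),
  forall (s : 'I_n -> bool) (B : nat), exists2 y, S y &
    (forall i, B%:R <= (-1) ^+ s i * y.1 0 i) /\ B%:R <= y.2 &
  weakly_exposed S `<=` strictly_exposed S].

Definition admissible A q (C : {set cell_index q}) S V :=
  [/\ locally_finite S, code q S = C, S `&` far A q = set0, no_double A q S &
      strictly_exposed S `<=` V /\ V `<=` weakly_exposed S].

Lemma l1norm_near (v w : 'rV[R]_n) (d : R) : `|v - w| <= d ->
  l1norm v <= l1norm w + n%:R * d.
Proof.
move=> vw; have -> : n%:R * d = \sum_(i < n) d.
  by rewrite sumr_const card_ord mulr_natl.
rewrite -big_split/=; apply: ler_sum => i _.
rewrite -lerBlDl; apply: le_trans (lerB_dist _ _) _.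
by apply: le_trans vw; have := normr_coord (v - w) i; rewrite !mxE.
Qed.

Lemma near_natS_gt (M : R) : \forall q \near \oo, M < q.+1%:R.
Proof.
near=> q; apply: le_lt_trans (_ : q%:R < _); last by rewrite ltr_nat.
by near: q; exact: nbhs_infty_ger.
Unshelve. all: by end_near. Qed.

Lemma near_natS_sqr_gt (M : R) : \forall q \near \oo, M < q.+1%:R ^+ 2.
Proof.
near=> q; apply: lt_le_trans (_ : q.+1%:R <= _).
  by near: q; exact: near_natS_gt.
by rewrite expr2 ler_peMl// ler1n.
Unshelve. all: by end_near. Qed.

Lemma near_inv_lt (M : R) : 0 < M -> \forall q \near \oo, q.+1%:R^-1 < M.
Proof. by move=> M0; exact: near_infty_natSinv_lt (PosNum M0). Qed.

(** Equal codes move each point of one set to some point of the other set in the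
    same cell, that is by at most [1 / q.+1]. *)
Lemma code_companion q S S' y : code q S = code q S' -> S y ->
  `|y| < q.+1%:R ^+ 2 ->
  exists2 y', S' y' & exists2 j, cell q j y & cell q j y'.
Proof.
move=> SS' Sy yq; have [j jy] := cell_cover yq.
have : j \in code q S by apply/in_code; exists y.
by rewrite SS' => /in_code[y' Sy' jy']; exists y' => //; exists j.
Qed.

Lemma not_weakly_exposed S x : S x -> ~ weakly_exposed S x ->
  exists k : nat, forall c : E, `|c| = 1 -> exists y,
    [/\ S y, `|y| <= k%:R & pairing c y + k.+1%:R^-1 < pairing c x].
Proof.
move=> Sx; apply: contra_notP => /forallNP h.
apply: weakly_exposed_limit => // k; have /existsNP[c /not_implyP[c1 hc]] := h k.
exists c; split=> // y Sy yk; rewrite leNgt; apply/negP => hy; apply: hc.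
by exists y.
Qed.

(** Finitely many points of [S0] defeat all normalised functionals with a uniform
    margin, by compactness; their companions in [S] still do when the mesh is
    smaller than the margin. *)
Lemma not_weak_stable S0 x : S0 x -> ~ weakly_exposed S0 x ->
  \forall q \near \oo, forall S x' j, code q S = code q S0 ->
    cell q j x -> cell q j x' -> ~ weakly_exposed S x'.
Proof.
move=> Sx /(not_weakly_exposed Sx)[k hk].
near=> q => S x' j SS0 jx jx' [Sx' [c' c'0 hc']].
have c'N : 0 < `|c'| by rewrite normr_gt0.
pose c := `|c'|^-1 *: c'.
have c1 : `|c| = 1 by rewrite normrZ normfV normr_id mulVf// gt_eqF.
have hc y : S y -> pairing c x' <= pairing c y.
  by move=> Sy; rewrite !pairingZl ler_wpM2l ?invr_ge0// hc'.
have [y [Sy yk yx]] := hk c c1.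
have [y' Sy' [i iy iy']] : exists2 y', S y' & exists2 j, cell q j y & cell q j y'.
  apply: code_companion Sy _ => //; apply: le_lt_trans yk _.
  by near: q; exact: near_natS_sqr_gt.
have Q : n.+1%:R * q.+1%:R^-1 + n.+1%:R * q.+1%:R^-1 < k.+1%:R^-1 :> R.
  rewrite -mulrDl mulrC -ltr_pdivlMr; last by rewrite addr_gt0.
  by near: q; apply: near_inv_lt; rewrite divr_gt0 ?addr_gt0.
have e1 : `|pairing c (y' - y)| <= n.+1%:R * q.+1%:R^-1.
  apply: le_trans (pairing_le _ _) _; rewrite c1 mulr1 ler_wpM2l//.
  exact: cell_dist iy' iy.
have e2 : `|pairing c (x - x')| <= n.+1%:R * q.+1%:R^-1.
  apply: le_trans (pairing_le _ _) _; rewrite c1 mulr1 ler_wpM2l//.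
  exact: cell_dist jx jx'.
have := hc _ Sy'; move: yx Q e1 e2; rewrite !ler_norml !pairingBr.
move: (n.+1%:R * _) (k.+1%:R^-1) => d g; clear SS0.
by move=> yx Q /andP[_ e1] /andP[_ e2] e3; lra.
Unshelve. all: by end_near. Qed.

Lemma strictly_exposed_gap S x a A : S x -> finite_set (S `&` cone A) ->
  (forall y, S y -> y <> x -> dotr a (y.1 - x.1) < y.2 - x.2) ->
  exists2 g : R, 0 < g & forall y, S y -> cone A y -> y <> x ->
    dotr a (y.1 - x.1) + g < y.2 - x.2.
Proof.
move=> Sx fS ha.
have : \forall k \near \oo, forall y, (S `&` cone A) y -> y <> x ->
    dotr a (y.1 - x.1) + k.+1%:R^-1 < y.2 - x.2.
  apply: near_finite_set => // y [Sy _].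
  have [->|/eqP yx] := eqVneq y x; first exact: nearW.
  near=> k => _; rewrite -ltrBrDl; near: k; apply: near_inv_lt.
  by rewrite subr_gt0; exact: ha.
move=> /filter_ex[k hk]; exists k.+1%:R^-1 => // y Sy Cy.
exact: hk.
Unshelve. all: by end_near. Qed.

(** Only the finitely many points of [S0] below the cone of slope [A] compete
    with [x]; the competitors are separated from [x] by a positive margin, which
    the displacement by a small mesh does not exhaust. *)
Lemma strict_stable S0 x (B : nat) : nice S0 -> strictly_exposed S0 x ->
  `|x| <= B%:R ->
  \forall A \near \oo, \forall q \near \oo, forall S V,
    admissible A (code q S0) S V ->
    exists2 x', V x' & exists2 j, cell q j x & cell q j x'.
Proof.
move=> [_ fS0 _ _] [Sx [a ha]] xB.
near=> A.
have hA : l1norm a * (B%:R + 1) + (B%:R + 1) <= A%:R.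
  by near: A; exact: nbhs_infty_ger.
have hA1 : l1norm a <= A%:R.
  apply: le_trans hA; rewrite mulrDr mulr1 -addrA addrC -addrA lerDl.
  by rewrite !addr_ge0// mulr_ge0// l1norm_ge0.
have hBA : B%:R + 1 <= A%:R :> R.
  by apply: le_trans hA; rewrite lerDr mulr_ge0 ?l1norm_ge0// addr_ge0.
pose A' := (A * n.+1 + 1)%N.
have [g g0 hg] := strictly_exposed_gap Sx (fS0 A') ha.
have l0 : 0 < l1norm a + 1 by rewrite ltr_wpDl// l1norm_ge0.
near=> q => S V [lfS SS0 farS ndS [SV VS]].
have Q0 : 0 < q.+1%:R :> R by [].
have Qi : q.+1%:R^-1 <= 1 :> R by rewrite invf_le1// ler1n.
have [x' Sx' [j jx jx']] : exists2 y', S y' & exists2 j, cell q j x & cell q j y'.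
  apply: code_companion Sx _ => //; apply: le_lt_trans xB _.
  by near: q; exact: near_natS_sqr_gt.
exists x'; last by exists j.
apply: SV; split => //; exists a => y' Sy' yx'.
have dx := cell_dist jx' jx.
have x'B : `|x'| <= B%:R + 1.
  rewrite -(subrK x x') addrC (le_trans (ler_normD _ _))// lerD//.
  exact: le_trans dx Qi.
have [Cy'|Cy'] := pselect (cone A y'); last first.
  move/negP: Cy'; rewrite -ltNge => Cy'.
  have h1 : dotr a y'.1 <= A%:R * l1norm y'.1.
    rewrite dotrC; apply: le_trans (ler_norm _) _; apply: le_trans (dotr_l1 _ _) _.
    rewrite mulrC ler_wpM2r ?l1norm_ge0//; apply: le_trans hA1.
    by apply: normr_rV_le => [|i]; rewrite ?l1norm_ge0// /l1norm (bigD1 i)//= lerDl sumr_ge0.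
  have h2 := dotr_l1_ge (lexx (l1norm a)) (le_trans (normr_fst x') x'B).
  have h3 := le_trans (ler_norm _) (le_trans (normr_snd x') x'B).
  by rewrite dotrBr; move: Cy' h1 h2 h3 hA; rewrite mulrDr mulr1; clear SS0; lra.
have y'q : `|y'.1| <= q.+1%:R /\ - q.+1%:R <= y'.2.
  split; rewrite leNgt; apply/negP => hy.
    have : (S `&` far A q) y' by split=> //; split=> //; left.
    by rewrite farS.
  have : (S `&` far A q) y' by split=> //; split=> //; right.
  by rewrite farS.
have ly' : l1norm y'.1 <= n%:R * q.+1%:R.
  by apply: le_trans (l1norm_norm _) _; rewrite ler_wpM2l//; case: y'q.
have QA : A%:R * n.+1%:R < q.+1%:R :> R by near: q; exact: near_natS_gt.
have Q1 : 1 < q.+1%:R :> R by near: q; exact: near_natS_gt.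
have y'w : `|y'| < q.+1%:R ^+ 2.
  rewrite prod_normE gt_max; apply/andP; split.
    by apply: le_lt_trans y'q.1 _; rewrite expr2 ltr_pMl.
  rewrite ltr_norml; apply/andP; split.
    by apply: lt_le_trans y'q.2; rewrite ltrN2 expr2 ltr_pMl.
  apply: le_lt_trans Cy' _.
  apply: le_lt_trans (_ : A%:R * n.+1%:R * q.+1%:R < _); last first.
    by rewrite expr2 ltr_pM2r.
  rewrite -mulrA ler_wpM2l// -(natr1 n) mulrDl mul1r addrC lerD// ltW//.
have [y Sy [i iy' iy]] := code_companion SS0 Sy' y'w.
clear SS0; have yx : y <> x.
  move=> yx; apply: yx'; rewrite yx in iy; have ij := cell_inj iy jx.
  rewrite ij in iy'; apply: ndS jx' iy' _ => //.
  exact: le_trans x'B hBA.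
have dy := cell_dist iy iy'; have dy' := cell_dist iy' iy.
have Cy : cone A' y.
  rewrite /cone /= /A' natrD natrM.
  have h1 := l1norm_near (le_trans (normr_fst (y' - y)) dy').
  have {}h1 : l1norm y'.1 <= l1norm y.1 + n%:R.
    by apply: le_trans h1 _; rewrite lerD2l ler_piMr.
  have h3 := le_trans (ler_norm _) (le_trans (normr_snd (y - y')) dy).
  have h4 := l1norm_ge0 y.1.
  have A0 : 0 <= A%:R :> R by [].
  have n0 : 0 <= n%:R :> R by [].
  have : A%:R * (1 + l1norm y'.1) <= A%:R * (1 + l1norm y.1 + n%:R) by rewrite ler_wpM2l// -addrA lerD2l.
  have {}h3 : y.2 <= y'.2 + 1.
    have h : y.2 - y'.2 <= q.+1%:R^-1 := h3.
    by move: (q.+1%:R^-1) Qi h => d Qi h; lra.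
  move: Cy' h3; rewrite /cone /= -(natr1 n).
  have := mulr_ge0 A0 (mulr_ge0 n0 h4).
  by have := mulr_ge0 A0 h4; lra.
have gap := hg y Sy Cy yx.
have e1 : `|dotr a (y'.1 - y.1)| <= l1norm a * q.+1%:R^-1.
  apply: le_trans (dotr_l1 _ _) _; rewrite ler_wpM2l ?l1norm_ge0//.
  exact: le_trans (normr_fst (y' - y)) dy'.
have e2 : `|dotr a (x'.1 - x.1)| <= l1norm a * q.+1%:R^-1.
  apply: le_trans (dotr_l1 _ _) _; rewrite ler_wpM2l ?l1norm_ge0//.
  exact: le_trans (normr_fst (x' - x)) dx.
have e3 := le_trans (normr_snd (y' - y)) dy'.
have e4 := le_trans (normr_snd (x' - x)) dx.
have Qg : (l1norm a + 1) * q.+1%:R^-1 + (l1norm a + 1) * q.+1%:R^-1 < g.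
  rewrite -mulrDl mulrC -ltr_pdivlMr; last by rewrite addr_gt0.
  by near: q; apply: near_inv_lt; apply: divr_gt0 => //; exact: addr_gt0.
move: gap e1 e2 e3 e4 Qg; rewrite !ler_norml !dotrBr mulrDl mul1r /=.
move: (q.+1%:R^-1) => d.
move=> gap /andP[? ?] /andP[? ?] /andP[? ?] /andP[? ?] Qg.
lra.
Unshelve. all: by end_near. Qed.

End cells.

Arguments cell {R n} q j _.

(** * Vague convergence of the exposed points *)

Section vague.
Context {R : realType} {E : topologicalType}.

(** Convergence of the integrals of test functions is convergence for the vague
    topology, an initial topology. *)
Lemma vague_continuous_cvg (G : vague R E -> R) (F : set_system (set E))
    (S : set E) : Filter F ->
  {within (locally_finite : set (vague R E)), continuous G} ->
  locally_finite S -> F locally_finite ->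
  (forall f : E -> R, test_function f ->
    \sum_(x \in W) f x @[W --> F] --> \sum_(x \in S) f x) ->
  G W @[W --> F] --> G S.
Proof.
move=> FF /subspace_continuousP cG lfS Flf h.
have FS : F --> (S : vague R E).
  move=> A [_ [[B oB <-] BS BA]].
  have : {ptws, (@integrate_tests R E @ F) --> (@integrate_tests R E S)}.
    apply/cvg_sup => -[f tf] A' [_ [[B' oB' <-] B'S B'A']].
    have hB : F [set W | B' (\sum_(x \in W) f x)].
      exact: h f tf B' (open_nbhs_nbhs (conj oB' B'S)).
    rewrite nbhs_simpl /=.
    by apply: filterS hB => W; exact: B'A'.
  move=> /(_ B (open_nbhs_nbhs (conj oB BS))) /=; rewrite nbhs_simpl /=.
  by apply: filterS => W; exact: BA.
have := cG S lfS => cGS; apply: cvg_trans cGS.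
move=> U /= hU; rewrite nbhs_simpl /=.
have : F [set W | locally_finite W -> U (G W)] by apply: FS; exact: hU.
by apply: filterS2 Flf => W /= lW; apply.
Qed.

End vague.

Lemma sum_on_seq {R : realType} (T : choiceType) (W : set T) (r : seq T)
    (f : T -> R) : uniq r -> [set` r] `<=` W ->
  (forall x, W x -> x \notin r -> f x = 0) ->
  \sum_(x \in W) f x = \sum_(x <- r) f x.
Proof.
move=> ur rW f0; rewrite (fsbigE r)// big_seq_cond [RHS]big_seq.
by apply: eq_bigl => x; case: (boolP (x \in r)) => // /rW /mem_set ->.
Qed.

Section stability.
Context {R : realType} {n : nat}.
Local Notation E := ('rV[R]_n * R)%type.
Implicit Types (S V W : set E) (p x y : E) (q A M : nat).

(** Radius, in affine coordinates, of a ball containing every point that the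
    rescaled coordinates send into the ball of radius [M]. *)
Definition properness_radius M : nat := (n.+2 * M.+1 ^ 2)%N.

(** Both bounds are needed: closeness on bounded sets, and the fact that no far
    away point is brought back into a bounded set. *)
Definition close_to_unshear q (psi : E -> E) := [/\ injective psi,
  forall p, `|p| <= q.+1%:R -> `|psi p - unshear p| <= q.+1%:R^-1 &
  forall M, (M <= q)%N ->
    forall p, `|psi p| <= M%:R -> `|p| <= (properness_radius M)%:R].

(** What the rescaled extreme points can be, given that the underlying point
    set has occupied cells [C], has nothing in the far region and no two nearby
    points in one cell. *)
Definition images A q (C : {set cell_index q}) : set (set E) :=
  [set W | exists S V psi, [/\ admissible A C S V, close_to_unshear q psi,
     locally_finite W & W = psi @` V]].

Lemma enorm2_le (v : 'rV[R]_n) : enorm v ^+ 2 <= n%:R * `|v| ^+ 2.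
Proof.
rewrite enormE; have -> : n%:R * `|v| ^+ 2 = \sum_(i < n) `|v| ^+ 2.
  by rewrite sumr_const card_ord mulr_natl.
apply: ler_sum => i _; rewrite -expr2 -real_normK ?num_real//.
by rewrite lerXn2r ?nnegrE// normr_coord.
Qed.

Lemma unshear_proper M p : `|unshear p| <= M%:R ->
  `|p| <= (properness_radius M)%:R.
Proof.
move=> pM; have h1 : `|p.1| <= M%:R by exact: le_trans (normr_fst (unshear p)) pM.
have h2 := le_trans (normr_snd (unshear p)) pM.
have M0 : 0 <= M%:R :> R by [].
have n0 : 0 <= n%:R :> R by [].
have h3 : `|p.1| ^+ 2 <= M%:R ^+ 2 by rewrite lerXn2r ?nnegrE.
have h4 := enorm2_le p.1.
have h5 : 0 <= enorm p.1 ^+ 2 by exact: sqr_ge0.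
have h6 : n%:R * `|p.1| ^+ 2 <= n%:R * M%:R ^+ 2 by rewrite ler_wpM2l.
rewrite /properness_radius natrM natrX -!natr1.
have nM := mulr_ge0 n0 M0; have nMM := mulr_ge0 nM M0.
have MM := mulr_ge0 M0 M0.
apply: normr_pair_le; first by apply: le_trans h1 _; nra.
move: h2; rewrite /= !ler_norml => /andP[h2 h2']; apply/andP; split; nra.
Qed.

Lemma images_le A A' q (C : {set cell_index q}) : (A <= A')%N ->
  images A' C `<=` images A C.
Proof.
move=> AA' W [S [V [psi [[lfS cS fS nS SV] cl lW WE]]]]; exists S, V, psi.
have AA'R : A%:R <= A'%:R :> R by rewrite ler_nat.
split; [|exact: cl|exact: lW|exact: WE]; split; [exact: lfS|exact: cS| | |exact: SV].
  apply/seteqP; split=> // p [Sp [Cp Fp]].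
  have : (S `&` far A' q) p; last by rewrite fS.
  split=> //; split=> //; rewrite /cone /=; apply: le_trans Cp _.
  by rewrite ler_wpM2r// addr_ge0// l1norm_ge0.
move=> j p p' Sp Sp' jp jp' pA; apply: nS jp jp' _ => //.
exact: le_trans pA AA'R.
Qed.

Lemma near_cell_continuous (f : E -> R) x (e : R) : continuous f -> 0 < e ->
  \forall q \near \oo, forall x', `|x' - x| <= q.+1%:R^-1 ->
    forall p, `|p - unshear x'| <= q.+1%:R^-1 ->
    `|f p - f (unshear x)| <= e.
Proof.
move=> cf e0.
have /nbhs_ballP[d /= d0 hd] : \forall p \near unshear x, `|f (unshear x) - f p| < e.
  have := cf (unshear x) (ball (f (unshear x)) e) (nbhsx_ballx _ _ e0).
  by rewrite -ball_normE.
have d20 : 0 < d / 2 by rewrite divr_gt0.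
have /nbhs_ballP[d' /= d'0 hd'] : \forall p \near x, `|unshear x - unshear p| < d / 2.
  have := @continuous_unshear _ _ x (ball (unshear x) (d / 2)) (nbhsx_ballx _ _ d20).
  by rewrite -ball_normE.
near=> q => x' x'x p px'; rewrite distrC ltW//; apply: hd.
rewrite -ball_normE /ball_ /= (splitr d).
rewrite -(subrK (unshear x') (unshear x)) -addrA.
apply: le_lt_trans (ler_normD _ _) _; apply: ltrD.
  apply: hd'; rewrite -ball_normE /ball_ /= distrC.
  apply: le_lt_trans x'x _; near: q; exact: near_inv_lt.
rewrite distrC; apply: le_lt_trans px' _; near: q; exact: near_inv_lt.
Unshelve. all: by end_near. Qed.

Lemma near_cells_separate (D : set E) : finite_set D ->
  \forall q \near \oo, forall x y j, D x -> D y ->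
    cell q j x -> cell q j y -> x = y.
Proof.
move=> fD.
have : \forall q \near \oo, forall x, D x -> forall y, D y -> x <> y ->
    q.+1%:R^-1 < `|x - y|.
  apply: near_finite_set => // x _; apply: near_finite_set => // y _.
  have [->|/eqP xy] := eqVneq x y; first by apply: nearW.
  near=> q => _; near: q; apply: near_inv_lt.
  by rewrite normr_gt0 subr_eq0; exact/eqP.
apply: filterS => q hq x y j Dx Dy jx jy; apply: contrapT => xy.
by have := hq x Dx y Dy xy; rewrite ltNge (cell_dist jx jy).
Unshelve. all: by end_near. Qed.

(** For a fine mesh, the points of [W] in the support of [f] correspond one to one
    to the exposed points of [S0], cell by cell, and move little; [f] is
    uniformly continuous and both sums have boundedly many terms. *)
Lemma images_integral S0 (f : E -> R) (e : R) : nice S0 -> test_function f ->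
  0 < e ->
  \forall A \near \oo, \forall q \near \oo, forall W,
    images A (code q S0) W ->
    `|\sum_(p \in W) f p - \sum_(p \in unshear @` strictly_exposed S0) f p| <= e.
Proof.
move=> nS0 [cf cK] e0; have [lf0 _ _ gen0] := nS0.
have [m hm] := compact_pair_bounded cK.
pose M := (Num.truncn m).+1.
have hM p : f p != 0 -> `|p| <= M%:R.
  move=> fp; apply: le_trans (hm p _) _; first by apply: subset_closure.
  by rewrite ltW// truncnS_gt.
pose B := properness_radius M.
pose D := strictly_exposed S0 `&` [set p : E | `|p| <= B.+1%:R].
have lf0B : finite_set (S0 `&` [set p : E | `|p| <= B.+1%:R]).
  by apply: lf0; exact: compact_pair_ball.
have fD : finite_set D by apply: sub_finite_set lf0B => x [[? _] ?].
have [r ur Dr] : exists2 r : seq E, uniq r & D = [set` r].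
  have /finite_seqP[r Dr] := fD; exists (undup r); first exact: undup_uniq.
  by rewrite Dr; apply/seteqP; split=> x /=; rewrite mem_undup.
pose e' := e / (size r).+1%:R.
have e'0 : 0 < e' by rewrite divr_gt0.
have st : \forall A \near \oo, forall x, D x -> \forall q \near \oo,
    forall S V, admissible A (code q S0) S V ->
    exists2 x', V x' & exists2 j, cell q j x & cell q j x'.
  by apply: near_finite_set => // x [sx xB]; exact: strict_stable sx xB.
near=> A.
have AB : (B.+2 <= A)%N by near: A; exact: nbhs_infty_ge.
have stA : forall x, D x -> \forall q \near \oo,
    forall S V, admissible A (code q S0) S V ->
    exists2 x', V x' & exists2 j, cell q j x & cell q j x'.
  by near: A.
have nw : \forall q \near \oo, forall x, (S0 `&` [set p : E | `|p| <= B.+1%:R]) x ->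
    ~ weakly_exposed S0 x ->
    forall S x' j, code q S = code q S0 ->
    cell q j x -> cell q j x' -> ~ weakly_exposed S x'.
  apply: near_finite_set => // x [Sx _].
  have [wx|wx] := pselect (weakly_exposed S0 x); first by apply: nearW => q /(_ wx).
  by have := not_weak_stable Sx wx; apply: filterS => q h _.
near=> q => W [S [V [psi [adm [ipsi cpsi ppsi] lfW WE]]]].
have qB : B.+2%:R <= q.+1%:R :> R.
  by rewrite ler_nat; apply: leqW; near: q; exact: nbhs_infty_ge.
have Q1 : 1 <= q.+1%:R :> R by rewrite ler1n.
have qB2 : B.+2%:R <= q.+1%:R ^+ 2 :> R.
  by apply: le_trans qB _; rewrite expr2 ler_peMl.
have Mq : (M <= q)%N by near: q; exact: nbhs_infty_ge.
have Qi : q.+1%:R^-1 <= 1 :> R by rewrite invf_le1.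
have sep : forall x y j, D x -> D y -> cell q j x -> cell q j y -> x = y.
  by near: q; exact: near_cells_separate.
have nwq : forall x, (S0 `&` [set p : E | `|p| <= B.+1%:R]) x ->
    ~ weakly_exposed S0 x ->
    forall S x' j, code q S = code q S0 ->
    cell q j x -> cell q j x' -> ~ weakly_exposed S x' by near: q.
have fq : forall x, D x -> forall x', `|x' - x| <= q.+1%:R^-1 ->
    forall p, `|p - unshear x'| <= q.+1%:R^-1 -> `|f p - f (unshear x)| <= e'.
  near: q; apply: near_finite_set => // x _; exact: near_cell_continuous.
have stq : forall x, D x -> forall S V, admissible A (code q S0) S V ->
    exists2 x', V x' & exists2 j, cell q j x & cell q j x'.
  by near: q; exact: near_finite_set.
have /choice[g hg] : forall x, exists x', D x ->
    V x' /\ exists2 j, cell q j x & cell q j x'.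
  move=> x; have [Dx|nD] := pselect (D x); last by exists x.
  by have [x' ? ?] := stq x Dx S V adm; exists x'.
have [lfS SS0 _ ndS [_ VS]] := adm.
have VSx x : V x -> S x by move=> /VS[].
have sW : \sum_(p \in W) f p = \sum_(x <- r) f (psi (g x)).
  rewrite -(big_map (psi \o g) xpredT f).
  have inr x : x \in r -> D x by rewrite Dr.
  apply: sum_on_seq.
  - rewrite map_inj_in_uniq// => x y /inr Dx /inr Dy /= /ipsi gxy.
    have [_ [j jx jgx]] := hg x Dx; have [_ [i iy igy]] := hg y Dy.
    rewrite gxy in jgx; rewrite (cell_inj jgx igy) in jx.
    exact: sep jx iy.
  - move=> p /mapP[x /inr Dx ->]; rewrite WE; exists (g x) => //.
    by have [] := hg x Dx.
  rewrite WE => _ [x' Vx' <-]; apply: contraNeq => fp.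
  have x'B : `|x'| <= B%:R by apply: ppsi Mq _ _; exact: hM.
  have [x Sx [j jx' jx]] : exists2 y', S0 y' & exists2 j, cell q j x' & cell q j y'.
    apply: code_companion SS0 (VSx _ Vx') _; apply: le_lt_trans x'B _.
    by apply: lt_le_trans qB2; rewrite ltr_nat.
  have xB : `|x| <= B.+1%:R.
    rewrite -(subrK x' x) -natr1 addrC (le_trans (ler_normD _ _))// lerD//.
    exact: le_trans (cell_dist jx jx') Qi.
  have Dx : D x.
    split=> //; apply: gen0; apply: contrapT => wx.
    exact: (nwq x (conj Sx xB) wx S x' j SS0 jx jx') (VS _ Vx').
  have [Vgx [i ix igx]] := hg x Dx.
  rewrite (cell_inj ix jx) in igx.
  suff <- : g x = x'.
    by apply: (map_f (psi \o g)); have := Dx; rewrite Dr.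
  apply: ndS jx' igx _; [exact: VSx|exact: VSx|].
  by apply: le_trans x'B _; rewrite ler_nat (leq_trans _ AB)// leqW.
have s0 : \sum_(p \in unshear @` strictly_exposed S0) f p = \sum_(x <- r) f (unshear x).
  rewrite -(big_map unshear xpredT f); apply: sum_on_seq.
  - by rewrite map_inj_uniq//; exact: unshear_inj.
  - move=> p /mapP[x xr ->]; exists x => //.
    have : D x by rewrite Dr.
    by case.
  move=> _ [x sx <-]; apply: contraNeq => fp; apply: map_f.
  suff : D x by rewrite Dr.
  split => //=; apply: le_trans (unshear_proper (hM _ fp)) _.
  by rewrite ler_nat.
rewrite sW s0 -sumrB; apply: le_trans (ler_norm_sum _ _ _) _.
apply: le_trans (_ : \sum_(x <- r) e' <= e); last first.
  rewrite big_const_seq count_predT iter_addr_0 -[_ *+ size r]mulr_natr /e' mulrAC.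
  by rewrite ler_pdivrMr// ler_wpM2l ?ler_nat// ltW.
rewrite !big_seq; apply: ler_sum => x xr.
have Dx : D x by rewrite Dr.
have [Vgx [j jx jgx]] := hg x Dx.
have gxx := cell_dist jgx jx.
apply: (fq x Dx (g x)) => //; apply: cpsi.
have [_ xB] := Dx; apply: le_trans qB; rewrite -natr1.
rewrite -(subrK x (g x)) addrC (le_trans (ler_normD _ _))// lerD//.
exact: le_trans gxx Qi.
Unshelve. all: by end_near. Qed.

End stability.

Arguments properness_radius n M : clear implicits.

(** * Expectations of bounded variables *)

Section bounded_expectation.
Context {R : realType} {d : measure_display} {Omega : measurableType d}.
Variable P : probability Omega R.
Implicit Types (f g : Omega -> R) (A B : set Omega).

Definition pr A : R := fine (P A).

Definition mean f : R := fine (\int[P]_w (f w)%:E)%E.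

Definition bounded_measurable f :=
  measurable_fun setT f /\ exists b : R, forall w, `|f w| <= b.

Lemma prE A : measurable A -> P A = (pr A)%:E.
Proof. by move=> mA; rewrite /pr fineK// fin_num_measure. Qed.

Lemma pr_ge0 A : 0 <= pr A.
Proof. by rewrite fine_ge0. Qed.

Lemma pr_le A B : measurable A -> measurable B -> A `<=` B -> pr A <= pr B.
Proof.
by move=> mA mB AB; apply: fine_le; rewrite ?fin_num_measure// le_measure ?inE.
Qed.

Lemma pr_le_bound A (e : R) : measurable A -> (P A <= e%:E)%E -> pr A <= e.
Proof. by move=> mA; rewrite prE// lee_fin. Qed.

Lemma prD A B : measurable A -> measurable B ->
  pr (A `\` B) = pr A - pr (A `&` B).
Proof.
move=> mA mB; apply: EFin_inj; rewrite EFinB -!prE//.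
- apply: measureD => //; rewrite ltey_eq fin_num_measure//.
- exact: measurableI.
- exact: measurableD.
Qed.

Lemma prT : pr setT = 1.
Proof. by rewrite /pr probability_setT. Qed.

Lemma pr0 : pr set0 = 0.
Proof. by rewrite /pr measure0. Qed.

Lemma prC A : measurable A -> pr (~` A) = 1 - pr A.
Proof. by move=> mA; rewrite -setTD prD// setTI prT. Qed.

Lemma pr_le1 A : measurable A -> pr A <= 1.
Proof. by move=> mA; rewrite -prT; exact: pr_le. Qed.

Lemma prU A B : measurable A -> measurable B -> pr (A `|` B) <= pr A + pr B.
Proof.
move=> mA mB; rewrite -lee_fin EFinD -!prE//; last exact: measurableU.
exact: measureU2.
Qed.

Lemma prU_disjoint A B : measurable A -> measurable B -> A `&` B = set0 ->
  pr (A `|` B) = pr A + pr B.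
Proof.
move=> mA mB AB; apply: EFin_inj; rewrite EFinD -!prE//; last exact: measurableU.
by rewrite measureU.
Qed.

Lemma measurable_exists_seq (I : eqType) (r : seq I) (F : I -> set Omega) :
  (forall i, measurable (F i)) -> measurable [set w | exists2 i, i \in r & F i w].
Proof.
move=> mF; elim: r => [|i r IH].
  by rewrite (_ : mkset _ = set0)//; apply/seteqP; split=> w // [].
rewrite (_ : mkset _ = F i `|` [set w | exists2 i, i \in r & F i w]).
  exact: measurableU.
apply/seteqP; split=> w.
  move=> [j]; rewrite inE => /orP[/eqP->|jr] Fj; first by left.
  by right; exists j.
move=> [Fi|[j jr Fj]]; first by exists i => //; rewrite inE eqxx.
by exists j => //; rewrite inE jr orbT.
Qed.

Lemma measurable_forall_seq (I : eqType) (r : seq I) (F : I -> set Omega) :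
  (forall i, measurable (F i)) ->
  measurable [set w | forall i, i \in r -> F i w].
Proof.
move=> mF; elim: r => [|i r IH].
  by rewrite (_ : mkset _ = setT)//; apply/seteqP; split.
rewrite (_ : mkset _ = F i `&` [set w | forall i, i \in r -> F i w]).
  exact: measurableI.
apply/seteqP; split=> w.
  by move=> h; split=> [|j jr]; apply: h; rewrite inE ?eqxx ?jr ?orbT.
by move=> [Fi h] j; rewrite inE => /orP[/eqP->//|]; exact: h.
Qed.

Lemma pr_exists_seq (I : eqType) (r : seq I) (F : I -> set Omega) :
  (forall i, measurable (F i)) ->
  pr [set w | exists2 i, i \in r & F i w] <= \sum_(i <- r) pr (F i).
Proof.
move=> mF; elim: r => [|i r IH].
  rewrite big_nil (_ : mkset _ = set0) ?pr0//.
  by apply/seteqP; split=> w // [].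
rewrite big_cons (_ : mkset _ = F i `|` [set w | exists2 i, i \in r & F i w]).
  apply: le_trans (prU _ _) _ => //; first exact: measurable_exists_seq.
  by rewrite lerD2l.
apply/seteqP; split=> w.
  move=> [j]; rewrite inE => /orP[/eqP->|jr] Fj; first by left.
  by right; exists j.
move=> [Fi|[j jr Fj]]; first by exists i => //; rewrite inE eqxx.
by exists j => //; rewrite inE jr orbT.
Qed.

Lemma bounded_measurable_integrable f : bounded_measurable f ->
  P.-integrable setT (fun w => (f w)%:E).
Proof.
move=> [mf [b fb]]; apply: (measurable_bounded_integrable (f := f)) => //.
  by rewrite -ge0_fin_numE// fin_num_measure.
exists b; split; first exact: num_real.
by move=> x bx w _ /=; apply: le_trans (fb w) _; exact: ltW.
Qed.

Lemma bounded_measurable_cst (c : R) : bounded_measurable (fun=> c).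
Proof. by split; [exact: measurable_cst|exists `|c|]. Qed.

Lemma bounded_measurable_indic A : measurable A -> bounded_measurable (\1_A).
Proof.
move=> mA; split; first exact: measurable_indic.
by exists 1 => w; rewrite indicE; case: (_ \in _); rewrite ?normr1 ?normr0.
Qed.

Lemma bounded_measurableD f g : bounded_measurable f -> bounded_measurable g ->
  bounded_measurable (fun w => f w + g w).
Proof.
move=> [mf [b fb]] [mg [c gc]]; split; first exact: measurable_funD.
by exists (b + c) => w; apply: le_trans (ler_normD _ _) _; exact: lerD.
Qed.

Lemma bounded_measurableZ (k : R) f : bounded_measurable f ->
  bounded_measurable (fun w => k * f w).
Proof.
move=> [mf [b fb]]; split; first by apply: measurable_funM => //; exact: measurable_cst.
by exists (`|k| * b) => w; rewrite normrM ler_wpM2l.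
Qed.

Lemma bounded_measurable_sum (I : Type) (r : seq I) (p : pred I)
    (F : I -> Omega -> R) : (forall i, bounded_measurable (F i)) ->
  bounded_measurable (fun w => \sum_(i <- r | p i) F i w).
Proof.
move=> bF; elim: r => [|i r IH].
  rewrite (_ : (fun w => _) = fun=> 0); first exact: bounded_measurable_cst.
  by apply/funext => w; rewrite big_nil.
rewrite (_ : (fun w => _) = if p i
    then fun w => F i w + \sum_(j <- r | p j) F j w
    else fun w => \sum_(j <- r | p j) F j w).
  by case: ifP => // _; exact: bounded_measurableD.
by apply/funext => w; rewrite big_cons; case: ifP.
Qed.

Lemma meanD f g : bounded_measurable f -> bounded_measurable g ->
  mean (fun w => f w + g w) = mean f + mean g.
Proof.
move=> /bounded_measurable_integrable fi /bounded_measurable_integrable gi.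
rewrite /mean; under eq_integral do rewrite EFinD.
by rewrite integralD// fineD//; exact: integrable_fin_num.
Qed.

Lemma meanZ (k : R) f : bounded_measurable f ->
  mean (fun w => k * f w) = k * mean f.
Proof.
move=> /bounded_measurable_integrable fi.
rewrite /mean; under eq_integral do rewrite EFinM.
by rewrite integralZl// fineM//; exact: integrable_fin_num.
Qed.

Lemma mean_cst (c : R) : mean (fun=> c) = c.
Proof.
rewrite /mean -[X in fine (integral _ _ X)]/(cst c%:E).
rewrite integral_cst//.
transitivity (fine (c%:E * 1%E)%E); last by rewrite mule1.
congr (fine (_ * _)%E); exact: probability_setT.
Qed.

Lemma mean_indic A : measurable A -> mean (\1_A) = pr A.
Proof. by move=> mA; rewrite /mean integral_indic// setIT. Qed.

Lemma mean_sum (I : Type) (r : seq I) (p : pred I) (F : I -> Omega -> R) :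
  (forall i, bounded_measurable (F i)) ->
  mean (fun w => \sum_(i <- r | p i) F i w) = \sum_(i <- r | p i) mean (F i).
Proof.
move=> bF; elim: r => [|i r IH].
  rewrite big_nil -[RHS]mean_cst; congr mean; apply/funext => w.
  by rewrite big_nil.
rewrite big_cons -IH; case: ifP => pi.
  rewrite -meanD//; last exact: bounded_measurable_sum.
  by congr mean; apply/funext => w; rewrite big_cons pi.
by congr mean; apply/funext => w; rewrite big_cons pi.
Qed.

Lemma mean_le f g : bounded_measurable f -> bounded_measurable g ->
  (forall w, f w <= g w) -> mean f <= mean g.
Proof.
move=> /bounded_measurable_integrable fi /bounded_measurable_integrable gi fg.
apply: fine_le; [exact: integrable_fin_num|exact: integrable_fin_num|].
by apply: le_integral => // w _; rewrite lee_fin.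
Qed.

Lemma mean_norm_le f g : bounded_measurable f -> bounded_measurable g ->
  (forall w, `|f w| <= g w) -> `|mean f| <= mean g.
Proof.
move=> bf bg fg; rewrite ler_norml; apply/andP; split; last first.
  by apply: mean_le => // w; exact: le_trans (ler_norm _) (fg w).
rewrite -mulN1r -meanZ//; apply: mean_le => //; first exact: bounded_measurableZ.
by move=> w; rewrite mulN1r lerNl; apply: le_trans (fg w); rewrite -normrN ler_norm.
Qed.

Lemma expectation_mean f : bounded_measurable f -> ('E_P[f])%E = (mean f)%:E.
Proof.
move=> /bounded_measurable_integrable fi.
by rewrite unlock /mean fineK//; exact: integrable_fin_num.
Qed.

(** A bounded variable that is nearly determined, off a small event, by a
    finite-valued code has nearly the mean of a function of the code. *)
Lemma mean_code (C : finType) (code : Omega -> C) (Y : Omega -> R) (y : C -> R)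
    (bad : pred C) (D : set Omega) (b e : R) :
  (forall c, measurable [set w | code w = c]) -> measurable_fun setT Y ->
  measurable D -> 0 <= e -> (forall w, `|Y w| <= b) -> (forall c, `|y c| <= b) ->
  (forall w, ~ D w -> ~~ bad (code w) -> `|Y w - y (code w)| <= e) ->
  `|mean Y - \sum_c y c * pr [set w | code w = c]| <=
    e + 2 * b * (pr D + \sum_(c | bad c) pr [set w | code w = c]).
Proof.
move=> mc mY mD e0 Yb yb h.
pose I c : Omega -> R := \1_[set w | code w = c].
have bI c : bounded_measurable (I c) by exact: bounded_measurable_indic.
have IE w c : I c w = (code w == c)%:R.
  rewrite /I indicE; congr (nat_of_bool _)%:R.
  by apply/idP/eqP => [/set_mem//|<-]; apply/mem_set.
have bY : bounded_measurable Y by split=> //; exists b.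
have sE (f : C -> R) (p : pred C) w :
    \sum_(c | p c) f c * I c w = if p (code w) then f (code w) else 0.
  case: ifP => pw.
    rewrite (bigD1 (code w))//= IE eqxx mulr1 big1 ?addr0// => c /andP[_ cw].
    by rewrite IE eq_sym (negPf cw) mulr0.
  rewrite big1// => c pc; rewrite IE; case: eqP => [cw|_]; last by rewrite mulr0.
  by rewrite cw pc in pw.
have -> : mean Y - \sum_c y c * pr [set w | code w = c] =
    mean (fun w => Y w + -1 * \sum_c y c * I c w).
  have bs : bounded_measurable (fun w => \sum_c y c * I c w).
    by apply: bounded_measurable_sum => c; exact: bounded_measurableZ.
  rewrite meanD//; last exact: bounded_measurableZ.
  rewrite meanZ// mean_sum; last by move=> c; exact: bounded_measurableZ.
  rewrite mulN1r; congr (_ - _); apply: eq_bigr => c _.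
  by rewrite meanZ// /I mean_indic.
have -> : e + 2 * b * (pr D + \sum_(c | bad c) pr [set w | code w = c]) =
    mean (fun w => e + 2 * b * (\1_D w + \sum_(c | bad c) 1 * I c w)).
  have bD : bounded_measurable (\1_D : Omega -> R) by exact: bounded_measurable_indic.
  have b1 c : bounded_measurable (fun w => 1 * I c w) by exact: bounded_measurableZ.
  have bs : bounded_measurable (fun w => \sum_(c | bad c) 1 * I c w).
    exact: bounded_measurable_sum.
  have bDs := bounded_measurableD bD bs.
  rewrite meanD//; [|exact: bounded_measurable_cst|exact: bounded_measurableZ].
  rewrite mean_cst meanZ// meanD// mean_indic// mean_sum//.
  congr (_ + _ * (_ + _)); apply: eq_bigr => c _.
  by rewrite meanZ// mul1r /I mean_indic.
apply: mean_norm_le.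
- apply: bounded_measurableD => //; apply: bounded_measurableZ.
  by apply: bounded_measurable_sum => c; exact: bounded_measurableZ.
- apply: bounded_measurableD; first exact: bounded_measurable_cst.
  apply: bounded_measurableZ; apply: bounded_measurableD.
    exact: bounded_measurable_indic.
  by apply: bounded_measurable_sum => c; exact: bounded_measurableZ.
move=> w; rewrite mulN1r (sE y xpredT) (sE (fun=> 1) bad).
have b0 : 0 <= b by exact: le_trans (normr_ge0 _) (Yb w).
have triv : `|Y w - y (code w)| <= 2 * b.
  by apply: le_trans (ler_normB _ _) _; rewrite mulr_natl mulr2n lerD.
case: (boolP (bad (code w))) => bw.
  apply: le_trans triv _; rewrite -[leLHS]add0r lerD// ler_peMr ?mulr_ge0//.
  by rewrite lerDr indicE.
have [Dw|nDw] := pselect (D w).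
  apply: le_trans triv _; rewrite indicE mem_set// addr0 mulr1 -[leLHS]add0r.
  by rewrite lerD2r.
by apply: le_trans (h w nDw bw) _; rewrite addr0 lerDl mulr_ge0 ?mulr_ge0.
Qed.

End bounded_expectation.

(** * From occupation probabilities to convergence in distribution *)

Lemma cvg_finite_sum {R : realType} {T J : Type} (F : set_system T)
    {FF : Filter F} (r : seq J) (p : pred J) (f : J -> T -> R) (l : J -> R) :
  (forall j, p j -> f j x @[x --> F] --> l j) ->
  \sum_(j <- r | p j) f j x @[x --> F] --> \sum_(j <- r | p j) l j.
Proof.
move=> h; apply: cvg_big => //.
by move=> x; apply: cvgD; [exact: cvg_fst|exact: cvg_snd].
Qed.

Section families.
Context {R : realType} {n : nat}.
Local Notation E := ('rV[R]_n * R)%type.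
Variable m : forall q, @cell_index n q -> R.

Definition misses {T : Type} (Z : T -> set E) q (J : {set @cell_index n q}) :
  set T := [set w | forall j, j \in J -> Z w `&` cell q j = set0].

(** Random locally finite sets that are, in the limit along [F], a Poisson
    process with the masses [m] as far as the occupied cells are concerned.
    The last two conditions are the uniform estimates that make finitely many
    cells sufficient. *)
Definition asymptotically_poisson {I : Type} (F : set_system I)
    {d : I -> measure_display} {Omega : forall i, measurableType (d i)}
    (P : forall i, probability (Omega i) R) (Z : forall i, Omega i -> set E) :=
  [/\ \forall i \near F, forall w, locally_finite (Z i w),
    forall q (J : {set cell_index q}),
      (\forall i \near F, measurable (misses (Z i) J)) /\
      pr (P i) (misses (Z i) J) @[i --> F] --> \prod_(j in J) expR (- m j),
    forall A (e : R), 0 < e -> \forall q \near \oo, \forall i \near F,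
      exists D, [/\ measurable D, (P i D <= e%:E)%E &
        forall w, ~ D w -> no_double A q (Z i w)] &
    forall A (e : R), 0 < e -> \forall q \near \oo, \forall i \near F,
      exists D, [/\ measurable D, (P i D <= e%:E)%E &
        forall w, ~ D w -> Z i w `&` far A q = set0]].

Definition code_mass q (C : {set @cell_index n q}) : R :=
  \prod_j (if j \in C then 1 - expR (- m j) else expR (- m j)).

Definition code_event {T : Type} (Z : T -> set E) q (C : {set @cell_index n q}) :
  set T := [set w | code q (Z w) = C].

Section one_family.
Context {I : Type} {F : set_system I} {FF : ProperFilter F}.
Context {d : I -> measure_display} {Omega : forall i, measurableType (d i)}.
Context {P : forall i, probability (Omega i) R}.
Context {Z : forall i, Omega i -> set E}.
Hypothesis aZ : asymptotically_poisson F P Z.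

Let hits_misses i q (H : seq (@cell_index n q)) (J : {set cell_index q}) :
    set (Omega i) :=
  [set w | (forall j, j \in H -> Z w `&` cell q j !=set0) /\ misses (@Z i) J w].

(** Induction on the cells to be hit: hitting [h] is the complement of missing
    [h], so that the probability is the difference of two of the same kind with
    one cell less to hit. *)
Let hits_missesP q (H : seq (@cell_index n q)) (J : {set cell_index q}) :
  uniq H -> (forall j, j \in H -> j \notin J) ->
  (\forall i \near F, measurable (@hits_misses i q H J)) /\
  pr (P i) (@hits_misses i q H J) @[i --> F] -->
    \prod_(j <- H) (1 - expR (- m j)) * \prod_(j in J) expR (- m j).
Proof.
have [_ hJ _ _] := aZ.
elim: H J => [J _ _|h H IH J /= /andP[hH uH] HJ].
  have e i : @hits_misses i q [::] J = misses (@Z i) J.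
    by apply/seteqP; split=> w; [case|move=> h; split].
  have [h1 h2] := hJ q J; rewrite big_nil mul1r; split.
    by apply: filterS h1 => i; rewrite e.
  by rewrite (_ : (fun i => _) = fun i => pr (P i) (misses (@Z i) J))//;
    apply/funext => i; rewrite e.
have hJ' : h \notin J by apply: HJ; rewrite inE eqxx.
have [m1 c1] := IH J uH (fun j jH => HJ j (mem_behead (s := h :: H) jH)).
have [|m2 c2] := IH (h |: J) uH.
  move=> j jH; rewrite !inE negb_or HJ ?inE ?jH ?orbT// andbT.
  by apply: contraNneq hH => <-.
have e i : @hits_misses i q (h :: H) J = @hits_misses i q H J `\` @hits_misses i q H (h |: J).
  apply/seteqP; split=> [w [hw mw]|w [[hw mw] nw]].
    split; first by split=> // j jH; apply: hw; rewrite inE jH orbT.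
    move=> [_ /(_ h)]; rewrite !inE eqxx => /(_ isT) Z0.
    by have [|x] := hw h; [rewrite inE eqxx|rewrite Z0].
  split=> // j; rewrite inE => /orP[/eqP->|]; last exact: hw.
  apply: contrapT => Z0; apply: nw; split=> // k; rewrite !inE => /orP[/eqP->|].
    by apply: contrapT => /eqP/set0P.
  exact: mw.
have i2 i : @hits_misses i q H J `&` @hits_misses i q H (h |: J) = @hits_misses i q H (h |: J).
  apply/seteqP; split=> w; first by case.
  by move=> [hw mw]; split=> //; split=> // j jJ; apply: mw; rewrite !inE jJ orbT.
split.
  by apply: filterS2 m1 m2 => i mi1 mi2; rewrite e; exact: measurableD.
rewrite big_cons.
have -> : (1 - expR (- m h)) * \prod_(j <- H) (1 - expR (- m j)) * \prod_(j in J) expR (- m j)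
   = \prod_(j <- H) (1 - expR (- m j)) * \prod_(j in J) expR (- m j)
   - \prod_(j <- H) (1 - expR (- m j)) * \prod_(j in h |: J) expR (- m j).
  by rewrite big_setU1//=; ring.
apply: cvg_trans (cvgB c1 c2); apply: near_eq_cvg.
by apply: filterS2 m1 m2 => i mi1 mi2; rewrite e /= prD// i2.
Qed.

Lemma code_mass_limit q (C : {set cell_index q}) :
  (\forall i \near F, measurable (code_event (@Z i) C)) /\
  pr (P i) (code_event (@Z i) C) @[i --> F] --> code_mass C.
Proof.
have e i : code_event (@Z i) C = @hits_misses i q (enum C) (~: C).
  apply/seteqP; split=> [w <-|w [hw mw]].
    split=> j; first by rewrite mem_enum => /in_code[p Zp jp]; exists p.
    rewrite finset.in_setC => jC; apply/seteqP; split=> // p [Zp jp].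
    by move/negP: jC; apply; apply/in_code; exists p.
  apply/setP => j; apply/idP/idP => [/in_code[p Zp jp]|jC].
    apply: contraT => jC; have := mw j; rewrite finset.in_setC jC => /(_ isT) Z0.
    by have : (Z w `&` cell q j) p by []; rewrite Z0.
  by have [|p [Zp jp]] := hw j; [rewrite mem_enum|apply/in_code; exists p].
have [|m1 c1] := @hits_missesP q (enum C) (~: C) (enum_uniq _).
  by move=> j; rewrite mem_enum inE negbK.
have -> : code_mass C = \prod_(j <- enum C) (1 - expR (- m j)) *
    \prod_(j in ~: C) expR (- m j).
  rewrite /code_mass (bigID (mem C)) /= big_enum; congr (_ * _).
    by apply: eq_bigr => j ->.
  by apply: eq_big => [j|j /negPf->]; rewrite ?inE.
split; first by apply: filterS m1 => i; rewrite e.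
by apply: cvg_trans c1; apply: near_eq_cvg; apply: nearW => i; rewrite e.
Qed.

End one_family.

Section functional.
Variables (G : set E -> R) (b : R).
Hypothesis b0 : 0 <= b.

Definition representative_values (e : R) A q (C : {set @cell_index n q}) : set R :=
  [set y | `|y| <= b /\ forall W, images A C W -> `|G W - y| <= e].

(** Value of the functional, up to [e], on every configuration with code [C]
    when there is one. *)
Definition code_value (e : R) A q (C : {set @cell_index n q}) : R :=
  xget 0 (representative_values e A C).

(** A code that does not determine the value of the functional up to [e]. *)
Definition bad_code (e : R) A q (C : {set @cell_index n q}) : bool :=
  `[< representative_values e A C = set0 >].

Lemma code_value_le e A q (C : {set cell_index q}) : `|code_value e A C| <= b.
Proof.
by rewrite /code_value; case: xgetP => [y _ []//|_]; rewrite normr0.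
Qed.

Lemma code_valueP e A q (C : {set cell_index q}) W : ~~ bad_code e A C ->
  images A C W -> `|G W - code_value e A C| <= e.
Proof.
move=> /asboolPn/eqP/set0P[y hy] CW; rewrite /code_value.
by have [_ h] := xgetPex 0 (ex_intro _ y hy); exact: h.
Qed.

(** Off the events of double points and far points, the functional is within [e]
    of the value attached to the code, unless the code is bad. *)
Lemma family_estimate {I : Type} (F : set_system I) {FF : ProperFilter F}
    {d : I -> measure_display} {Omega : forall i, measurableType (d i)}
    (P : forall i, probability (Omega i) R) (Z V : forall i, Omega i -> set E)
    (psi : I -> E -> E) :
  (forall W, locally_finite W -> `|G W| <= b) ->
  asymptotically_poisson F P Z ->
  (\forall i \near F, forall w, strictly_exposed (Z i w) `<=` V i w /\
     V i w `<=` weakly_exposed (Z i w)) ->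
  (forall q, \forall i \near F, close_to_unshear q (psi i)) ->
  (\forall i \near F, forall w, locally_finite (psi i @` V i w)) ->
  (\forall i \near F, measurable_fun setT (fun w => G (psi i @` V i w))) ->
  forall A (e : R), 0 < e -> \forall q \near \oo,
    \sum_(C : {set cell_index q} | bad_code e A C) @code_mass q C <= e ->
    \forall i \near F,
      `|mean (P i) (fun w => G (psi i @` V i w))
        - \sum_(C : {set cell_index q}) code_value e A C * code_mass C| <=
      e + 2 * b * (e + e + (e + e)) + e.
Proof.
move=> Gb aZ hV hpsi hlf hm A e e0; have [lfZ _ hnd hfar] := aZ.
near=> q => hbad.
have nd : \forall i \near F, exists D, [/\ measurable D, (P i D <= e%:E)%E &
  forall w, ~ D w -> no_double A q (Z i w)] by near: q; exact: hnd.
have fr : \forall i \near F, exists D, [/\ measurable D, (P i D <= e%:E)%E &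
  forall w, ~ D w -> Z i w `&` far A q = set0] by near: q; exact: hfar.
have hC (C : {set cell_index q}) :
    (\forall i \near F, measurable (code_event (Z i) C)) /\
    pr (P i) (code_event (Z i) C) @[i --> F] --> code_mass C.
  exact: code_mass_limit.
have mC : \forall i \near F, forall C : {set cell_index q},
    measurable (code_event (Z i) C).
  by apply: filter_forall => C; have [] := hC C.
have cb : \sum_(C : {set cell_index q} | bad_code e A C) pr (P i) (code_event (Z i) C) @[i --> F] -->
    \sum_(C : {set cell_index q} | bad_code e A C) @code_mass q C.
  apply: (@cvg_finite_sum R I _ F _ _ _
    (fun C i => pr (P i) (code_event (Z i) C)) (@code_mass q)) => C _.
  by case: (hC C).
have cv : \sum_(C : {set cell_index q}) code_value e A C * pr (P i) (code_event (Z i) C) @[i --> F]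
    --> \sum_(C : {set cell_index q}) code_value e A C * code_mass C.
  apply: (@cvg_finite_sum R I _ F _ _ _
    (fun C i => code_value e A C * pr (P i) (code_event (Z i) C))
    (fun C => code_value e A C * @code_mass q C)) => C _.
  by apply: cvgM; [exact: cvg_cst|case: (hC C)].
have nb : \forall i \near F,
    \sum_(C : {set cell_index q} | bad_code e A C) pr (P i) (code_event (Z i) C) <= e + e.
  move/cvgrPdist_le : cb => /(_ _ e0); apply: filterS => i.
  by rewrite ler_norml => /andP[h1 h2]; move: h1 h2 hbad; lra.
have nv : \forall i \near F,
  `|\sum_(C : {set cell_index q}) code_value e A C * pr (P i) (code_event (Z i) C)
    - \sum_(C : {set cell_index q}) code_value e A C * code_mass C| <= e.
  by move/cvgrPdist_le : cv => /(_ _ e0); apply: filterS => i; rewrite distrC.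
near=> i.
have [D1 [mD1 PD1 hD1]] : exists D, [/\ measurable D, (P i D <= e%:E)%E &
  forall w, ~ D w -> no_double A q (Z i w)] by near: i.
have [D2 [mD2 PD2 hD2]] : exists D, [/\ measurable D, (P i D <= e%:E)%E &
  forall w, ~ D w -> Z i w `&` far A q = set0] by near: i.
have lfi : forall w, locally_finite (psi i @` V i w) by near: i.
have lfZi : forall w, locally_finite (Z i w) by near: i.
have Vi : forall w, strictly_exposed (Z i w) `<=` V i w /\
     V i w `<=` weakly_exposed (Z i w) by near: i.
have cpsi : close_to_unshear q (psi i) by near: i; exact: hpsi.
have mCi : forall C : {set cell_index q}, measurable (code_event (Z i) C).
  by near: i.
have mY : measurable_fun setT (fun w => G (psi i @` V i w)) by near: i.
have est := @mean_code _ _ _ (P i) _ (fun w => code q (Z i w)) _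
  (@code_value e A q) (@bad_code e A q) (D1 `|` D2) b e mCi mY
  (measurableU _ _ mD1 mD2) (ltW e0) (fun w => Gb _ (lfi w))
  (@code_value_le e A q) _.
apply: le_trans (_ : e + 2 * b * (pr (P i) (D1 `|` D2) +
  \sum_(C : {set cell_index q} | bad_code e A C) pr (P i) (code_event (Z i) C)) + e <= _); last first.
  rewrite lerD2r lerD2l ler_wpM2l ?mulr_ge0// lerD//; last by near: i.
  by apply: le_trans (prU _ mD1 mD2) _; rewrite lerD// pr_le_bound.
have nvi : `|\sum_(C : {set cell_index q}) code_value e A C * pr (P i) (code_event (Z i) C)
    - \sum_(C : {set cell_index q}) code_value e A C * code_mass C| <= e.
  by near: i.
rewrite -[X in `|X|](subrKA (\sum_(C : {set cell_index q}) code_value e A C * pr (P i) (code_event (Z i) C))).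
apply: le_trans (ler_normD _ _) _; apply: lerD nvi.
apply: est => w /not_orP[nD1 nD2] gd; apply: code_valueP gd _.
exists (Z i w), (V i w), (psi i); split=> //.
by split=> //; [exact: hD2|exact: hD1].
Unshelve. all: by end_near. Qed.

End functional.

End families.

Section limit.
Context {R : realType} {n : nat}.
Local Notation E := ('rV[R]_n * R)%type.
Variable m : forall q, @cell_index n q -> R.
Variables (G : vague R E -> R) (b : R).
Hypothesis contG : {within (locally_finite : set (vague R E)), continuous G}.
Hypothesis Gb : forall W : set E, locally_finite W -> `|G W| <= b.

Lemma bad_code_le A A' q e (C : {set cell_index q}) : (A <= A')%N ->
  bad_code G b e A' C -> bad_code G b e A C.
Proof.
move=> AA' /asboolP bad; apply/asboolP/seteqP; split=> // y [yb hy].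
have : representative_values G b e A' C y; last by rewrite bad.
by split=> // W /(images_le AA'); exact: hy.
Qed.

Lemma nice_locally_finite (S : set E) : nice S ->
  locally_finite (unshear @` strictly_exposed S).
Proof.
move=> [lfS _ _ _] K cK; have [k hk] := compact_pair_bounded cK.
have : finite_set (unshear @` (S `&` [set p : E |
    `|p| <= (properness_radius n (Num.truncn k).+1)%:R])).
  by apply: finite_image; apply: lfS; exact: compact_pair_ball.
apply: sub_finite_set => _ [[x [Sx _] <-] Kx]; exists x => //; split=> //=.
apply: unshear_proper; apply: le_trans (hk _ Kx) _.
by rewrite ltW// truncnS_gt.
Qed.

(** The configurations admitted by the code of a nice set converge vaguely to the
    exposed points of that set, where the functional is continuous. *)
Lemma nice_not_bad (S : set E) e : nice S -> 0 < e ->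
  \forall A \near \oo, \forall q \near \oo, ~~ bad_code G b e A (code q S).
Proof.
move=> nS e0.
pose F : set_system (set E) := [set U | \forall A \near \oo,
  \forall q \near \oo, images A (code q S) `<=` U].
have FF : Filter F.
  constructor.
  - by apply: nearW => A; apply: nearW => q.
  - move=> U U' hU hU'; rewrite /F /=; near=> A.
    have h1 : \forall q \near \oo, images A (code q S) `<=` U by near: A.
    have h2 : \forall q \near \oo, images A (code q S) `<=` U' by near: A.
    by apply: filterS2 h1 h2 => q h1 h2 W hW; split; [exact: h1|exact: h2].
  - move=> U U' UU'; rewrite /F /=; apply: filterS => A; apply: filterS => q.
    by move=> hU W /hU /UU'.
have lfS := nice_locally_finite nS.
have cvgG : G W @[W --> F] --> G (unshear @` strictly_exposed S).
  apply: (vague_continuous_cvg FF contG lfS).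
    by apply: nearW => A; apply: nearW => q W [? [? [? []]]].
  move=> f tf; apply/cvgrPdist_le => d d0.
  have := images_integral nS tf d0; apply: filterS => A; apply: filterS => q.
  by move=> h W /h; rewrite distrC.
have : \forall A \near \oo, \forall q \near \oo, images A (code q S) `<=`
    [set W | `|G (unshear @` strictly_exposed S) - G W| <= e].
  by move/cvgrPdist_le : cvgG => /(_ _ e0).
apply: filterS => A; apply: filterS => q h.
apply/asboolPn/eqP/set0P; exists (G (unshear @` strictly_exposed S)).
by split=> [|W /h]; [exact: Gb|rewrite distrC].
Unshelve. all: by end_near. Qed.

Context {dL : measure_display} {OmegaL : measurableType dL}.
Context {PL : probability OmegaL R} {ZL : OmegaL -> set E}.
Hypothesis aZL : asymptotically_poisson m \oo (fun _ : nat => PL) (fun _ => ZL).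
Hypothesis niceZL : PL.-negligible [set w | ~ nice (ZL w)].

Lemma limit_code_event q (C : {set cell_index q}) :
  measurable (code_event ZL C) /\ pr PL (code_event ZL C) = code_mass m C.
Proof.
have [h1 h2] : (\forall i \near \oo, measurable (code_event ZL C)) /\
    pr PL (code_event ZL C) @[i --> \oo] --> code_mass m C.
  exact: (code_mass_limit (Z := fun _ : nat => ZL) aZL).
have [k ?] := filter_ex h1; split=> //.
by apply: (cvg_unique _ _ h2) => //; exact: cvg_cst.
Qed.

(** Almost every limit configuration has only good codes from some mesh on; by
    continuity of the probability the bad codes eventually have small mass. *)
Lemma bad_code_small (e : R) : 0 < e -> exists A, \forall q \near \oo,
  \sum_(C : {set cell_index q} | bad_code G b e A C) code_mass m C <= e.
Proof.
move=> e0.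
pose B A q := [set w | exists2 C, C \in [seq C <- enum {set @cell_index n q} |
   bad_code G b e A C] & code_event ZL C w].
have BE A q w : B A q w <-> bad_code G b e A (code q (ZL w)).
  split=> [[C]|h]; first by rewrite mem_filter => /andP[bC _] ->.
  by exists (code q (ZL w)) => //; rewrite mem_filter h mem_enum.
have mB A q : measurable (B A q).
  by apply: measurable_exists_seq => C; case: (limit_code_event C).
pose U k := \bigcap_(q in [set q | (k <= q)%N]) ~` B k q.
have mU k : measurable (U k).
  by apply: bigcap_measurable => [|q _]; [exists k => /=|exact: measurableC].
have ndU : nondecreasing_seq U.
  move=> k k' kk'; apply/subsetPset => w Uw q /= k'q /BE bad.
  apply: (Uw q); first exact: leq_trans kk' k'q.
  by apply/BE; exact: bad_code_le bad.
have [N [mN PN hN]] := niceZL.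
have cvgU : PL (U k) @[k --> \oo] --> PL (\bigcup_k U k).
  by apply: nondecreasing_cvg_mu => //; exact: bigcup_measurable.
have sub : ~` N `<=` \bigcup_k U k.
  move=> w Nw; have nw : nice (ZL w).
    by apply: contrapT => h; exact/Nw/hN.
  have [A0 _ hA0] := nice_not_bad nw e0.
  have [q0 _ hq0] := hA0 A0 (leqnn _).
  exists (maxn A0 q0) => // q /= kq /BE bad.
  have /negP := hq0 q (leq_trans (leq_maxr _ _) kq); apply.
  by apply: bad_code_le bad; exact: leq_maxl.
have PU : PL (\bigcup_k U k) = 1%E.
  apply/eqP; rewrite eq_le probability_le1//=; last exact: bigcup_measurable.
  have <- : PL (~` N) = 1%E by rewrite probability_setC// PN sube0.
  by apply: le_measure sub; rewrite inE; [exact: measurableC|exact: bigcup_measurable].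
rewrite PU in cvgU.
have : pr PL (U k) @[k --> \oo] --> (1 : R) by exact: fine_cvg cvgU.
move=> /cvgrPdist_le /(_ e e0) /filter_ex[k hk].
exists k; near=> q.
have kq : (k <= q)%N by near: q; exact: nbhs_infty_ge.
have -> : \sum_(C : {set cell_index q} | bad_code G b e k C) code_mass m C = pr PL (B k q).
  have hs (r : seq {set @cell_index n q}) : uniq r ->
      \sum_(C <- r) code_mass m C = pr PL [set w | exists2 C, C \in r & code_event ZL C w].
    elim: r => [_|C r IH /= /andP[Cr ur]].
      rewrite big_nil (_ : mkset _ = set0) ?pr0//.
      by apply/seteqP; split=> w // [].
    rewrite big_cons IH// -(limit_code_event C).2.
    rewrite -prU_disjoint; [|by case: (limit_code_event C)| |].
    - congr pr; apply/seteqP; split=> w.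
        move=> [Cw|[C' C'r C'w]]; first by exists C => //; rewrite inE eqxx.
        by exists C' => //; rewrite inE C'r orbT.
      move=> [C']; rewrite inE => /orP[/eqP->|C'r] C'w; first by left.
      by right; exists C'.
    - by apply: measurable_exists_seq => C'; case: (limit_code_event C').
    - apply/seteqP; split=> // w [Cw [C' C'r C'w]].
      by move: Cr; rewrite -Cw C'w C'r.
  transitivity (\sum_(C <- [seq C <- enum {set @cell_index n q} |
      bad_code G b e k C]) code_mass m C).
    by rewrite big_filter big_enum_cond.
  by apply: hs; rewrite filter_uniq// enum_uniq.
apply: le_trans (_ : pr PL (~` U k) <= e).
  apply: pr_le => //; first exact: measurableC.
  by move=> w Bw /(_ q kq); apply.
by rewrite prC//; apply: le_trans (ler_norm _) hk.
Unshelve. all: by end_near. Qed.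

(** Both means are within a small distance of the same finite sum over codes. *)
Theorem family_convergence {I : Type} (F : set_system I) {FF : ProperFilter F}
    {d : I -> measure_display} {Omega : forall i, measurableType (d i)}
    (P : forall i, probability (Omega i) R) (Z V : forall i, Omega i -> set E)
    (psi : I -> E -> E) (VL : OmegaL -> set E) :
  asymptotically_poisson m F P Z ->
  (\forall i \near F, forall w, strictly_exposed (Z i w) `<=` V i w /\
     V i w `<=` weakly_exposed (Z i w)) ->
  (forall q, \forall i \near F, close_to_unshear q (psi i)) ->
  (\forall i \near F, forall w, locally_finite (psi i @` V i w)) ->
  (\forall i \near F, measurable_fun setT (fun w => G (psi i @` V i w))) ->
  (forall w, strictly_exposed (ZL w) `<=` VL w /\
     VL w `<=` weakly_exposed (ZL w)) ->
  (forall w, locally_finite (unshear @` VL w)) ->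
  measurable_fun setT (fun w => G (unshear @` VL w)) ->
  mean (P i) (fun w => G (psi i @` V i w)) @[i --> F] -->
  mean PL (fun w => G (unshear @` VL w)).
Proof.
move=> aZ hV hpsi hlf hm hVL lfL mL.
have b0 : 0 <= b.
  apply: le_trans (normr_ge0 _) (@Gb set0 _) => K _.
  by rewrite set0I; exact: finite_set0.
apply/cvgrPdist_le => e e0.
pose e1 := e / 2 / (2 + 8 * b).
have b8 : 0 < 2 + 8 * b by rewrite ltr_pwDl// mulr_ge0.
have e10 : 0 < e1 by rewrite !divr_gt0.
have ee1 : e1 + 2 * b * (e1 + e1 + (e1 + e1)) + e1 = e / 2.
  by rewrite /e1; field; rewrite gt_eqF.
have [A hA] := bad_code_small e10.
have h1 := family_estimate b0 Gb aZ hV hpsi hlf hm A e10.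
have idc q : \forall i \near \oo, close_to_unshear q (unshear : E -> E).
  apply: nearW => _; split; first exact: unshear_inj.
    by move=> p _; rewrite subrr normr0 invr_ge0.
  by move=> M _ p; exact: unshear_proper.
have h2 := family_estimate (F := \oo) (V := fun _ : nat => VL)
  (psi := fun _ : nat => unshear) b0 Gb aZL (nearW _ (fun _ => hVL)) idc
  (nearW _ (fun _ => lfL)) (nearW _ (fun _ => mL)) A e10.
have [q [bq [{}h1 {}h2]]] :=
  filter_ex (filterI hA (filterI (h1 FF) (h2 _ _ _ _))).
have [k hk] := filter_ex (h2 bq).
apply: filterS (h1 bq) => i hi.
rewrite -(subrKA (\sum_(C : {set cell_index q}) code_value G b e1 A C * code_mass m C)).
apply: le_trans (ler_normD _ _) _; rewrite (splitr e) -ee1 lerD//.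
by rewrite distrC.
Qed.

End limit.

(** * Measurability of random locally finite sets *)

Section borel_sets.
Context {E : topologicalType}.
Implicit Types B C : set E.

Lemma borel_open B : open B -> borel B.
Proof. exact: sub_sigma_algebra. Qed.

Lemma borelC B : borel B -> borel (~` B).
Proof.
by have [_ h _] := smallest_sigma_algebra setT (@open E) => /h; rewrite setTD.
Qed.

Lemma borel_closed B : closed B -> borel B.
Proof. by rewrite -openC -{2}(setCK B) => /borel_open /borelC. Qed.

Lemma borel_bigcup (F : nat -> set E) : (forall k, borel (F k)) ->
  borel (\bigcup_k F k).
Proof. exact: sigma_algebra_bigcup. Qed.

Lemma borel0 : borel (set0 : set E).
Proof. by apply: borel_open; exact: open0. Qed.

Lemma borelU B C : borel B -> borel C -> borel (B `|` C).
Proof.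
move=> bB bC; rewrite -bigcup2E; apply: borel_bigcup => -[|[|k]] //=.
exact: borel0.
Qed.

Lemma borelI B C : borel B -> borel C -> borel (B `&` C).
Proof.
move=> bB bC; rewrite -(setCK (B `&` C)) setCI; apply: borelC.
by apply: borelU; exact: borelC.
Qed.

Lemma borel_forall (I : finType) (F : I -> set E) : (forall i, borel (F i)) ->
  borel [set x | forall i, F i x].
Proof.
move=> bF; suff h (r : seq I) : borel [set x | forall i, i \in r -> F i x].
  have := h (enum I); congr borel; apply/seteqP; split=> x hx i; last by move=> _.
  by apply: hx; rewrite mem_enum.
elim: r => [|i r IH].
  by rewrite (_ : mkset _ = setT); [apply: borel_open; exact: openT|apply/seteqP; split].
rewrite (_ : mkset _ = F i `&` [set x | forall i, i \in r -> F i x]).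
  exact: borelI.
apply/seteqP; split=> w.
  by move=> h; split=> [|j jr]; apply: h; rewrite inE ?eqxx ?jr ?orbT.
by move=> [Fi h] j; rewrite inE => /orP[/eqP->//|]; exact: h.
Qed.

Lemma borel_preimage (E' : topologicalType) (f : E -> E') (B : set E') :
  (forall U, open U -> borel (f @^-1` U)) -> borel B -> borel (f @^-1` B).
Proof.
move=> bf; apply: (@smallest_sub _ (sigma_algebra setT) _ [set B | borel (f @^-1` B)]).
  split => /=.
  - by rewrite preimage_set0; exact: borel0.
  - by move=> A bA; rewrite setTD preimage_setC; exact: borelC.
  - by move=> A bA; rewrite preimage_bigcup; exact: borel_bigcup.
by move=> U oU; exact: bf.
Qed.

Lemma borel_continuous (E' : topologicalType) (f : E -> E') (B : set E') :
  continuous f -> borel B -> borel (f @^-1` B).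
Proof.
move=> cf; apply: borel_preimage => U oU; apply: borel_open.
by apply: open_comp => // x _; exact: cf.
Qed.

End borel_sets.

(** Counting is a measure on the discrete sigma-algebra, for which every set is
    measurable. *)
Section counting_additivity.
Context {R : realType} {T : pointedType}.
Implicit Types X Y : set T.

Let D : measurableType _ := g_sigma_algebraType [set: set T].

Let mD (X : set D) : measurable X.
Proof. exact: sub_sigma_algebra. Qed.

Let nu : {measure set D -> \bar R} := (@counting D R).

Lemma counting_finite X : finite_set X -> (counting X : \bar R) \is a fin_num.
Proof. by rewrite /counting => fX; case: ifPn => // /asboolPn. Qed.

Lemma counting_setD X Y : finite_set X ->
  counting (X `\` Y) = (counting X - counting (X `&` Y) : \bar R)%E.
Proof.
move=> fX; have := @measureD _ D R nu X Y (mD X) (mD Y); apply.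
by rewrite ltey_eq counting_finite.
Qed.

Lemma counting_bigcup X (F : nat -> set T) : trivIset setT F ->
  (counting (X `&` \bigcup_k F k) =
    \sum_(0 <= k <oo | k \in [set: nat]) counting (X `&` F k) :> \bar R)%E.
Proof.
move=> tF; rewrite setI_bigcupr.
apply: (@measure_bigcup _ R D nu setT (fun k => X `&` F k)).
  by move=> k _; exact: mD.
exact: trivIset_setIl.
Qed.

Lemma counting_increasing (F : nat -> set T) : nondecreasing_seq F ->
  counting (F k) @[k --> \oo] --> (counting (\bigcup_k F k) : \bar R).
Proof. by move=> nF; apply: (@nondecreasing_cvg_mu _ D R nu F) => [k||]; [exact: mD|exact: mD|]. Qed.

Lemma counting_ge0 X : (0 <= counting X :> \bar R)%E.
Proof. exact: (measure_ge0 nu). Qed.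

End counting_additivity.

Section counting_values.
Context {R : realType} {T : choiceType}.
Implicit Types X : set T.

Lemma counting_seq (r : seq T) X : uniq r -> X = [set` r] ->
  counting X = (size r)%:R%:E :> \bar R.
Proof.
move=> ur ->; rewrite /counting asboolT; last by apply/finite_seqP; exists r.
congr (_%:R)%:E; apply/perm_size/uniq_perm; rewrite ?finmap.fset_uniq//.
by move=> x; rewrite in_fset_set ?mem_setE//; apply/finite_seqP; exists r.
Qed.

Lemma counting_finite_uniq X : (counting X : \bar R) \is a fin_num ->
  exists r : seq T, uniq r /\ X = [set` r].
Proof.
move=> h; have fX : finite_set X.
  by apply: contrapT => nX; move: h; rewrite /counting asboolF.
have [r Xr] := (finite_seqP _).1 fX; exists (undup r); split; first exact: undup_uniq.
by rewrite Xr; apply/seteqP; split=> x /=; rewrite mem_undup.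
Qed.

Lemma counting0P X : (counting X == 0 :> \bar R) <-> X = set0.
Proof.
split=> [/eqP h|->]; last by rewrite (@counting_seq [::])//; apply/seteqP; split.
have [|r [ur Xr]] := @counting_finite_uniq X; first by rewrite h.
have : ((size r)%:R%:E : \bar R) = 0 by rewrite -(counting_seq ur Xr).
move=> [] /eqP; rewrite (eqr_nat R _ 0) => /eqP/size0nil r0.
by rewrite Xr r0; apply/seteqP; split.
Qed.

Lemma counting1P X : (counting X == 1%:E :> \bar R) <-> exists x, X = [set x].
Proof.
split=> [/eqP h|[x ->]]; last first.
  rewrite (@counting_seq [:: x])//.
  by apply/seteqP; split=> y /=; rewrite inE => /eqP.
have [|r [ur Xr]] := @counting_finite_uniq X; first by rewrite h.
have : ((size r)%:R%:E : \bar R) = 1%:E by rewrite -(counting_seq ur Xr).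
move=> [] /eqP; rewrite (eqr_nat R _ 1) => /eqP.
case: r ur Xr => [|x [|]]// _ Xu _; exists x; rewrite Xu.
by apply/seteqP; split=> y /=; rewrite inE => /eqP.
Qed.

End counting_values.

Section random_sets.
Context {R : realType} {d : measure_display} {Omega : measurableType d}.

(** What the measurability of hulls uses: hitting events and events of hitting
    exactly once. Unlike counts, they are as accessible for the sample
    [{X_1, ..., X_m}] as for a Poisson process. *)
Definition random_set {E : topologicalType} (S : Omega -> set E) :=
  [/\ forall w, locally_finite (S w),
    forall B, borel B -> measurable [set w | S w `&` B !=set0] &
    forall B, borel B -> measurable [set w | exists x, S w `&` B = [set x]]].

Lemma point_process_random_set (E : topologicalType) (S : Omega -> set E) :
  point_process (R := R) S -> random_set S.
Proof.
move=> [lfS mS]; split=> // B bB.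
  rewrite (_ : mkset _ = ~` [set w | counting (S w `&` B) = 0 :> \bar R]).
    apply: measurableC; rewrite -[X in measurable X]setTI.
    exact: (mS B bB measurableT [set 0%E] (emeasurable_set1 _)).
  apply/seteqP; split=> w /=.
    by move=> /set0P/eqP h /eqP/counting0P.
  by move=> h; apply/set0P; apply: contra_not_neq h => ->; apply/eqP/counting0P.
rewrite (_ : mkset _ = [set w | counting (S w `&` B) = 1%:E :> \bar R]).
  rewrite -[X in measurable X]setTI.
  exact: (mS B bB measurableT [set 1%E] (emeasurable_set1 _)).
by apply/seteqP; split=> w /=; [move=> /(counting1P (R := R))/eqP|move=> /eqP/counting1P].
Qed.

End random_sets.

Section hits_to_counts.
Context {R : realType} {n : nat} {d : measure_display} {Omega : measurableType d}.
Local Notation E := ('rV[R]_n * R)%type.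
Variable S : Omega -> set E.
Hypothesis lfS : forall w, locally_finite (S w).
Hypothesis hitS : forall K, compact K -> measurable [set w | S w `&` K !=set0].

Let closed_icell (f : E -> R) q i k : continuous f ->
  closed [set p | (i%:R <= q.+1%:R * f p + q.+1%:R ^+ 3) /\
    (q.+1%:R * f p + q.+1%:R ^+ 3 <= i.+1%:R - k.+1%:R^-1)].
Proof.
move=> cf; have cg : continuous (fun p => q.+1%:R * f p + q.+1%:R ^+ 3).
  apply: continuousD_fun; last exact: continuous_cst_fun.
  by apply: continuousM_fun => //; exact: continuous_cst_fun.
by apply: closedI; apply: closed_le_fun => //; exact: continuous_cst_fun.
Qed.

Let icell_approx q (i : nat) (t : R) : icell q i t ->
  \forall k \near \oo, q.+1%:R * t + q.+1%:R ^+ 3 <= i.+1%:R - k.+1%:R^-1.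
Proof.
move=> /andP[_ h]; near=> k.
by rewrite lerBrDr -lerBrDl ltW//; near: k; apply: near_inv_lt; rewrite subr_gt0.
Unshelve. all: by end_near. Qed.

Let measurable_hit_cell K q (j : cell_index q) : compact K ->
  measurable [set w | S w `&` (K `&` cell q j) !=set0].
Proof.
move=> cK.
pose D (f : E -> R) (i : nat) k : set E := [set p |
  (i%:R <= q.+1%:R * f p + q.+1%:R ^+ 3) /\
  (q.+1%:R * f p + q.+1%:R ^+ 3 <= i.+1%:R - k.+1%:R^-1)].
pose C k := (\bigcap_(i in [set: 'I_n]) D (fun p => p.1 0 i) (j.1 i) k) `&`
  D snd j.2 k.
have cC k : closed (C k).
  apply: closedI; last by apply: closed_icell; exact: coord_snd_continuous.
  by apply: closed_bigI => i _; apply: closed_icell; exact: coord_fst_continuous.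
rewrite (_ : mkset _ = \bigcup_k [set w | S w `&` (K `&` C k) !=set0]).
  apply: bigcup_measurable => k _; apply: hitS; exact: compact_closedI.
apply/seteqP; split=> [w [p [Sp [Kp [h1 h2]]]]|w [k _ [p [Sp [Kp [h1 h2]]]]]].
  have : \forall k \near \oo, C k p.
    have hi : \forall k \near \oo, forall i, q.+1%:R * p.1 0 i + q.+1%:R ^+ 3 <=
        (j.1 i).+1%:R - k.+1%:R^-1.
      by apply: filter_forall => i; exact: icell_approx.
    apply: filterS2 hi (icell_approx h2) => k hi hk; split.
      by move=> i _; split=> //; have /andP[] := h1 i.
    by split=> //; have /andP[] := h2.
  by move=> /filter_ex[k Ck]; exists k => //; exists p.
have lt k' (x : R) : x <= k'%:R - k.+1%:R^-1 -> x < k'%:R.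
  by move=> /le_lt_trans; apply; rewrite ltrBlDr ltrDl invr_gt0.
exists p; split=> //; split=> //; split.
  by move=> i; have [a b] := h1 i I; rewrite /icell /= a lt.
by have [a b] := h2; rewrite /icell /= a lt.
Qed.

Let measurable_count_compact K : compact K ->
  measurable_fun setT (fun w => counting (S w `&` K) : \bar R).
Proof.
move=> cK; have [M hM] := compact_pair_bounded cK.
pose N q w : \bar R :=
  (\sum_(j : cell_index q) \1_[set w | S w `&` (K `&` cell q j) !=set0] w)%:E.
apply: (@emeasurable_fun_cvg _ _ _ _ N).
  move=> q; apply/measurable_EFinP; apply: measurable_sum => j.
  by apply: measurable_indic; exact: measurable_hit_cell.
move=> w _; have fX : finite_set (S w `&` K) by exact: lfS.
apply: cvg_near_cst; near=> q.
have sep : forall x y j, (S w `&` K) x -> (S w `&` K) y ->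
    cell q j x -> cell q j y -> x = y by near: q; exact: near_cells_separate.
have qM : M < q.+1%:R ^+ 2 by near: q; exact: near_natS_sqr_gt.
pose J := [seq j <- enum (cell_index q) | `[< S w `&` (K `&` cell q j) !=set0 >]].
have /choice[g hg] : forall j : cell_index q, exists p, j \in J ->
    S w p /\ K p /\ cell q j p.
  move=> j; have [jJ|_] := boolP (j \in J); last by exists (0, 0).
  by move: jJ; rewrite mem_filter => /andP[/asboolP[p [Sp [Kp jp]]] _]; exists p.
rewrite (@counting_seq R _ [seq g j | j <- J]).
- rewrite size_map size_filter /N; congr (_%:E).
  rewrite -sum1_count natr_sum big_enum_cond [RHS]big_mkcond; apply: eq_bigr => j _.
  by rewrite indicE; case: asboolP => [h|h]; [rewrite mem_set|rewrite memNset].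
- have uJ : uniq J by apply: filter_uniq; exact: enum_uniq.
  rewrite map_inj_in_uniq// => j j' jJ j'J e.
  have [_ [_ h]] := hg j jJ; have [_ [_ h']] := hg j' j'J.
  by apply: cell_inj h _; rewrite e.
apply/seteqP; split=> [p [Sp Kp]|p /= /mapP[j jJ ->]]; last first.
  by have [? [? _]] := hg j jJ.
have [j jp] := cell_cover (le_lt_trans (hM p Kp) qM).
have jJ : j \in J.
  by rewrite mem_filter mem_enum andbT; apply/asboolP; exists p.
have [Sg [Kg jg]] := hg j jJ.
by apply/mapP; exists j => //; apply: sep jp jg.
Unshelve. all: by end_near. Qed.

Let borelE_closed : (@borel E) = <<s @closed E >>.
Proof.
apply/seteqP; split; apply: smallest_sub; try exact: smallest_sigma_algebra.
  move=> U oU; rewrite -(setCK U) -setTD.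
  have [_ h _] := smallest_sigma_algebra setT (@closed E); apply: h.
  by apply: sub_sigma_algebra; exact: open_closedC.
by move=> C cC; exact: borel_closed.
Qed.

(** The count of a compact set is the limit of the number of cells that it is hit
    in, for finer and finer cells; a Dynkin argument then covers all Borel sets. *)
Theorem hits_point_process : point_process (R := R) S.
Proof.
split=> // B bB.
pose ballM (M : nat) : set E := [set p | `|p| <= M%:R].
pose good (B : set E) := forall M,
  measurable_fun setT (fun w => counting ((S w `&` ballM M) `&` B) : \bar R).
have fin w M : finite_set (S w `&` ballM M) by apply: lfS; exact: compact_pair_ball.
have {}bB : good B.
  have gT : good setT.
    move=> M; under eq_fun do rewrite setIT.
    by apply: measurable_count_compact; exact: compact_pair_ball.
  apply: (@dynkin_induction _ (g_sigma_algebraType (@open E)) (@closed E) good).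
  - exact: borelE_closed.
  - by move=> A C; exact: closedI.
  - exact: gT.
  - move=> C cC M; under eq_fun do rewrite -setIA.
    apply: measurable_count_compact; apply: compact_closedI => //.
    exact: compact_pair_ball.
  - move=> A _ gA M.
    rewrite (_ : (fun w => _) = fun w => (counting (S w `&` ballM M)
        - counting ((S w `&` ballM M) `&` A) : \bar R)%E).
      apply: emeasurable_funB; last exact: gA.
      by have := gT M; under eq_fun do rewrite setIT.
    by apply/funext => w; rewrite -setDE counting_setD.
  - move=> F _ tF gF M.
    rewrite (_ : (fun w => _) = fun w =>
        (\sum_(0 <= k <oo | k \in [set: nat]) counting ((S w `&` ballM M) `&` F k) : \bar R)%E).
      apply: (ge0_emeasurable_sum (P := fun k => k \in [set: nat])) => [k w _ _|k _].
        exact: counting_ge0.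
      exact: gF.
    by apply/funext => w; rewrite counting_bigcup.
  by rewrite -borelE_closed.
apply: (@emeasurable_fun_cvg _ _ _ _ (fun M w => counting ((S w `&` ballM M) `&` B))).
  exact: bB.
move=> w _; rewrite (_ : S w `&` B = \bigcup_M ((S w `&` ballM M) `&` B)).
  apply: counting_increasing => M M' MM'; apply/subsetPset => p [[Sp pM] Bp].
  by split=> //; split=> //; apply: le_trans pM _; rewrite ler_nat.
apply/seteqP; split=> [p [Sp Bp]|p [M _ [[]]]] //.
exists (Num.truncn `|p|).+1 => //; split=> //; split=> //.
by rewrite /ballM /= ltW// truncnS_gt.
Qed.

End hits_to_counts.

(** * Measurability of functionals, hulls and paraboloid hulls *)

Section functionals.
Context {R : realType} {n : nat} {d : measure_display} {Omega : measurableType d}.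
Local Notation E := ('rV[R]_n * R)%type.

Lemma borel_icell (f : E -> R) q (i : nat) : continuous f ->
  borel [set p | icell q i (f p)].
Proof.
move=> cf; have cg : continuous (fun p => q.+1%:R * f p + q.+1%:R ^+ 3).
  apply: continuousD_fun; last exact: continuous_cst_fun.
  by apply: continuousM_fun => //; exact: continuous_cst_fun.
have cc (c : R) : continuous (fun _ : E => c) by exact: continuous_cst_fun.
rewrite (_ : mkset _ = [set p | i%:R <= q.+1%:R * f p + q.+1%:R ^+ 3] `&`
    [set p | q.+1%:R * f p + q.+1%:R ^+ 3 < i.+1%:R]).
  apply: borelI; last first.
    by apply: borel_open; exact: (open_lt_fun cg (cc _)).
  by apply: borel_closed; exact: (closed_le_fun (cc _) cg).
by apply/seteqP; split=> p; [move=> /andP[]|move=> [a b]; apply/andP].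
Qed.

Lemma borel_cell q (j : @cell_index n q) : borel (cell q j : set E).
Proof.
apply: borelI; last by apply: borel_icell; exact: coord_snd_continuous.
by apply: borel_forall => i; apply: borel_icell; exact: coord_fst_continuous.
Qed.

Lemma measurable_code (S : Omega -> set E) q (C : {set @cell_index n q}) :
  random_set S -> measurable [set w | code q (S w) = C].
Proof.
move=> [_ hS _].
have mj (j : cell_index q) : measurable [set w | (j \in code q (S w)) = (j \in C)].
  have mh := hS _ (borel_cell j).
  case: (boolP (j \in C)) => jC.
    rewrite (_ : mkset _ = [set w | S w `&` cell q j !=set0])//.
    by apply/seteqP; split=> w /=; [move=> /in_code[p]; exists p|
      move=> [p [? ?]]; apply/in_code; exists p].
  rewrite (_ : mkset _ = ~` [set w | S w `&` cell q j !=set0]); first exact: measurableC.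
  apply/seteqP; split=> w /=.
    by move=> h [p [? ?]]; move/negP: h; apply; apply/in_code; exists p.
  by move=> h; apply/negP => /in_code[p ? ?]; apply: h; exists p.
rewrite (_ : mkset _ = [set w | forall j, j \in enum (cell_index q) ->
    (j \in code q (S w)) = (j \in C)]); first exact: measurable_forall_seq.
apply/seteqP; split=> [w <- //|w h]; apply/setP => j; apply: h.
by rewrite mem_enum.
Qed.

(** Replacing each occupied cell by one of its points gives a random set with
    finitely many values that converges vaguely as the mesh tends to zero. *)
Lemma measurable_functional (G : vague R E -> R) (S : Omega -> set E) :
  {within (locally_finite : set (vague R E)), continuous G} ->
  random_set S -> measurable_fun setT (fun w => G (S w)).
Proof.
move=> cG rS; have [lfS _ _] := rS.
pose center q (j : @cell_index n q) : E := xget 0 (cell q j).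
have centerP q (j : @cell_index n q) (p : E) : cell q j p -> cell q j (center q j).
  by move=> jp; rewrite /center; apply: xgetPex; exists p.
pose D q (C : {set @cell_index n q}) : set E := [set center q j | j in [set` C]].
apply: (@measurable_fun_cvg _ _ _ _ (fun q w => G (D q (code q (S w))))).
  move=> q; rewrite (_ : (fun w => _) = fun w => \sum_(C : {set cell_index q})
      G (D q C) * \1_[set w | code q (S w) = C] w).
    apply: measurable_sum => C; apply: measurable_funM; first exact: measurable_cst.
    by apply: measurable_indic; exact: measurable_code.
  apply/funext => w; rewrite (bigD1 (code q (S w)))//= indicE mem_set// mulr1.
  rewrite big1 ?addr0// => C CS; rewrite indicE memNset ?mulr0//=.
  by move=> e; rewrite e eqxx in CS.
move=> w _.
have fD q : finite_set (D q (code q (S w))) by exact: finite_image.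
apply: (vague_continuous_cvg (F := D q (code q (S w)) @[q --> \oo]) _ cG (lfS w)).
  by exists 0%N => // q _ K _; apply: sub_finite_set (fD q); exact: subIsetl.
move=> f [cf cK]; apply/cvgrPdist_le => e e0; rewrite near_map.
have [m hm] := compact_pair_bounded cK.
pose M := (Num.truncn m).+1.
have hM p : f p != 0 -> `|p| <= M%:R.
  move=> fp; apply: le_trans (hm p _) _; first by apply: subset_closure.
  by rewrite ltW// truncnS_gt.
pose X := S w `&` [set p : E | `|p| <= M.+1%:R].
have fX : finite_set X by apply: lfS; exact: compact_pair_ball.
have [r ur Xr] : exists2 r : seq E, uniq r & X = [set` r].
  have /finite_seqP[r Xr] := fX; exists (undup r); first exact: undup_uniq.
  by rewrite Xr; apply/seteqP; split=> x /=; rewrite mem_undup.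
have inr x : x \in r -> X x by rewrite Xr.
pose e' := e / (size r).+1%:R.
have e'0 : 0 < e' by rewrite divr_gt0.
near=> q.
have Qi : q.+1%:R^-1 <= 1 :> R by rewrite invf_le1// ler1n.
have qM : M.+1%:R < q.+1%:R ^+ 2 :> R by near: q; exact: near_natS_sqr_gt.
have sep : forall x y j, X x -> X y -> cell q j x -> cell q j y -> x = y.
  by near: q; exact: near_cells_separate.
have fq : forall x, X x -> forall x', `|x' - x| <= q.+1%:R^-1 -> `|f x - f x'| <= e'.
  near: q; apply: near_finite_set => // x _.
  have /nbhs_ballP[c /= c0 hc] : \forall p \near x, `|f x - f p| < e'.
    have := cf x (ball (f x) e') (nbhsx_ballx _ _ e'0).
    by rewrite -ball_normE.
  near=> q => x' x'x; apply/ltW/hc; rewrite -ball_normE /ball_/= distrC.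
  by apply: le_lt_trans x'x _; near: q; exact: near_inv_lt.
have /choice[g hg] : forall x, exists j : cell_index q, X x -> cell q j x.
  move=> x; have [Xx|nX] := pselect (X x); last first.
    by have [j _] := @cell_cover R n q 0 ltac:(by rewrite normr0 exprn_gt0); exists j.
  have [j jx] := @cell_cover R n q x (le_lt_trans Xx.2 qM); by exists j.
have -> : \sum_(p \in S w) f p = \sum_(x <- r) f x.
  apply: sum_on_seq => //; first by move=> x /inr[].
  move=> x Sx; apply: contraNeq => fx; have : X x; last by rewrite Xr.
  by split=> //=; apply: le_trans (hM _ fx) _; rewrite ler_nat.
have -> : \sum_(p \in D q (code q (S w))) f p = \sum_(x <- r) f (center q (g x)).
  rewrite -(big_map (fun x => center q (g x)) xpredT f); apply: sum_on_seq.
  - rewrite map_inj_in_uniq// => x y /inr Xx /inr Xy e1.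
    have h1 := centerP q (g x) x (hg x Xx); have h2 := centerP q (g y) y (hg y Xy).
    rewrite e1 in h1; have gg := cell_inj h1 h2.
    by apply: (sep x y (g x)) => //; [exact: hg|rewrite gg; exact: hg].
  - move=> p /mapP[x /inr Xx ->]; exists (g x) => //=.
    by apply/in_code; exists x; [case: Xx|exact: hg].
  move=> _ [j /= /in_code[p Sp jp] <-]; apply: contraNeq => fj.
  have jc := centerP q j p jp.
  have Xp : X p.
    split=> //=; rewrite -natr1 -(subrK (center q j) p) addrC.
    apply: le_trans (ler_normD _ _) _; apply: lerD; first exact: hM.
    exact: le_trans (cell_dist jp jc) Qi.
  apply/mapP; exists p; first by have := Xp; rewrite Xr.
  by rewrite (cell_inj (hg p Xp) jp).
rewrite -sumrB; apply: le_trans (ler_norm_sum _ _ _) _.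
apply: le_trans (_ : \sum_(x <- r) e' <= e); last first.
  rewrite big_const_seq count_predT iter_addr_0 -[_ *+ size r]mulr_natl /e' mulrCA.
  by apply: ler_piMr; [exact: ltW|rewrite ler_pdivrMr// mul1r ler_nat].
rewrite !big_seq; apply: ler_sum => x /inr Xx; apply: fq => //.
by apply: cell_dist (hg x Xx); apply: centerP; exact: hg.
Unshelve. all: by end_near. Qed.

End functionals.

(** The pigeonhole principle over a finite set, for a decreasing sequence of
    properties: this exchanges the quantifiers on the witness and on the size of
    the ball that is tested. *)
Lemma antitone_choice (T : choiceType) (D : set T) (P : nat -> T -> Prop) :
  finite_set D -> (forall k l x, (k <= l)%N -> P l x -> P k x) ->
  (forall k, exists2 x, D x & P k x) -> exists2 x, D x & forall k, P k x.
Proof.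
move=> fD aP h; apply: contrapT => /forall2NP hn.
have : \forall k \near \oo, forall x, D x -> ~ P k x.
  apply: near_finite_set => // x Dx.
  have [//|/existsNP[k0 nk0]] := hn x.
  by exists k0 => // k /= k0k /(aP _ _ _ k0k).
by move=> /filter_ex[k hk]; have [x /hk] := h k.
Qed.

Lemma rational_dense {R : realType} {m : nat} (c : 'rV[R]_m) (U : set 'rV[R]_m) :
  nbhs c U -> exists c' : 'rV[rat]_m, U (map_mx ratr c').
Proof.
move=> /nbhs_ballP[e /= e0 he].
have /choice[f hf] : forall i, exists r : rat, `|c 0 i - ratr r| < e.
  move=> i; have [|r] := @rat_in_itvoo R (c 0 i - e) (c 0 i + e).
    by rewrite ltrD2l gtrN.
  rewrite in_itv /= => /andP[h1 h2]; exists r; rewrite ltr_norml; apply/andP.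
  by split; lra.
exists (\row_i f i); apply: he; split=> // i j; rewrite ord1 !mxE.
by rewrite -ball_normE; exact: hf.
Qed.

Section hull_measurability.
Context {R : realType} {m : nat} {d : measure_display} {Omega : measurableType d}.
Variable S : Omega -> set 'rV[R]_m.
Hypothesis rS : random_set S.

Let ballM (N : nat) : set 'rV[R]_m := [set y | `|y| <= N%:R].
Let half (c : 'rV[R]_m) (t : R) : set 'rV[R]_m := [set y | t < dotr c y].

Let borel_half c t : borel (half c t).
Proof.
apply: borel_open; apply: open_lt_fun; first exact: continuous_cst_fun.
by apply: continuous_dotr; [exact: cst_continuous|move=> x; exact: cvg_id].
Qed.

Let closed_ballM N : closed (ballM N).
Proof.
by apply: closed_le_fun; [exact: norm_continuous|exact: continuous_cst_fun].
Qed.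

(** The separating functional and level can be taken rational. *)
Lemma measurable_hit_hull_vertices K : compact K ->
  measurable [set w | hull_vertices (S w) `&` K !=set0].
Proof.
move=> cK; have [lfS hS oS] := rS.
have [M hM] := compact_rV_bounded cK.
pose N0 := (Num.truncn M).+1.
have KN N x : (N0 <= N)%N -> K x -> `|x| <= N%:R.
  move=> N0N /hM /le_trans; apply; apply: le_trans (ltW (truncnS_gt _)) _.
  by rewrite ler_nat.
have bK : borel K.
  by apply: borel_closed; apply: compact_closed => //; exact: norm_hausdorff.
pose A N (ct : 'rV[rat]_m * rat) : set Omega :=
  [set w | exists x, S w `&` (ballM (N0 + N) `&` half (map_mx ratr ct.1) (ratr ct.2)) = [set x]]
  `&` [set w | S w `&` (K `&` half (map_mx ratr ct.1) (ratr ct.2)) !=set0].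
rewrite (_ : mkset _ = \bigcap_N \bigcup_ct A N ct).
  apply: bigcap_measurable => [|N _]; first by exists 0%N.
  apply: countable_bigcupT_measurable => [|ct]; first exact: countableP.
  apply: measurableI; first by apply: oS; apply: borelI => //; exact: borel_closed.
  by apply: hS; exact: borelI.
apply/seteqP; split=> [w [x [Vx Kx]] N _|w hw].
  have fT : finite_set ((S w `&` ballM (N0 + N)) `\` [set x]).
    by apply: finite_setD; apply: lfS; exact: compact_rV_ball.
  have Sx := hull_vertices_sub Vx.
  have [|||c hc] := hull_vertices_separated Vx (T := (S w `&` ballM (N0 + N)) `\` [set x]).
  - exact: fT.
  - by move=> y [[]].
  - by case=> _; apply.
  have [c' hc'] : exists c' : 'rV[rat]_m, forall y,
      ((S w `&` ballM (N0 + N)) `\` [set x]) y ->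
      dotr (map_mx ratr c') y < dotr (map_mx ratr c') x.
    have [|c' ?] := @rational_dense R m c [set c' | forall y,
      ((S w `&` ballM (N0 + N)) `\` [set x]) y -> dotr c' y < dotr c' x]; last by exists c'.
    apply: (@near_finite_set _ _ (nbhs c) _ (fun y c' => dotr c' y < dotr c' x) _ fT).
    move=> y Ty.
    have : open [set c' : 'rV[R]_m | dotr c' y < dotr c' x].
      have h (z : 'rV[R]_m) : continuous (fun c' => dotr c' z).
        apply: continuous_dotr; first by move=> u; exact: cvg_id.
        exact: cst_continuous.
      exact: open_lt_fun.
    by move=> o; apply: open_nbhs_nbhs; split=> //; exact: hc.
  pose c1 : 'rV[R]_m := map_mx ratr c'.
  have [t ht] : exists t : rat, ratr t < dotr c1 x /\ forall y,
      ((S w `&` ballM (N0 + N)) `\` [set x]) y -> dotr c1 y < ratr t.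
    have : \forall k \near \oo, forall y, ((S w `&` ballM (N0 + N)) `\` [set x]) y ->
        dotr c1 y < dotr c1 x - k.+1%:R^-1.
      apply: near_finite_set => // y Ty; near=> k.
      rewrite ltrBrDr -ltrBrDl; near: k; apply: near_inv_lt.
      by rewrite subr_gt0; exact: hc'.
    move=> /filter_ex[k hk].
    have [|t] := @rat_in_itvoo R (dotr c1 x - k.+1%:R^-1) (dotr c1 x).
      by rewrite gtrBl invr_gt0.
    rewrite in_itv /= => /andP[t1 t2]; exists t; split=> // y Ty.
    by apply: lt_trans t1; exact: hk.
  have [tx ty] := ht.
  exists (c', t) => //; split; last by exists x.
  exists x; apply/seteqP; split=> [y [Sy [Ny hy]]|_ ->]; last first.
    by split=> //; split=> //; apply: KN => //; exact: leq_addr.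
  apply: contrapT => yx; have := ty y (conj (conj Sy Ny) yx).
  by move=> h; have := lt_trans h hy; rewrite ltxx.
pose P N x := exists c, forall y, S w y -> `|y| <= N%:R -> y <> x ->
  dotr c y < dotr c x.
have [] := @antitone_choice 'rV[R]_m (S w `&` K) P.
- exact: lfS.
- move=> k l x kl [c hc]; exists c => y Sy yk; apply: hc => //.
  by apply: le_trans yk _; rewrite ler_nat.
- move=> N; have [[c t] _ [[x Hx] [z [Sz [Kz hz]]]]] := hw N I.
  exists z => //; exists (map_mx ratr c) => y Sy yN yz.
  have : [set x] z.
    by rewrite -Hx; split=> //; split=> //; apply: KN => //; exact: leq_addr.
  move=> /= zx; rewrite ltNge; apply/negP => hy; apply: yz.
  have : [set x] y.
    rewrite -Hx; split=> //; split; last exact: lt_le_trans hz hy.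
    by apply: le_trans yN _; rewrite ler_nat leq_addl.
  by move=> /= ->.
move=> x [Sx Kx] hP; exists x; split=> //.
apply: separated_hull_vertices => // T fT TS.
have [k hk] : exists k : nat, forall y, T y -> `|y| <= k%:R.
  have : \forall k \near \oo, forall y, T y -> `|y| <= k%:R.
    by apply: near_finite_set => // y _; exact: nbhs_infty_ger.
  by move=> /filter_ex.
have [c hc] := hP k; exists c => y Ty; have [Sy yx] := TS y Ty.
by apply: hc => //; exact: hk.
Unshelve. all: by end_near. Qed.

End hull_measurability.

Section paraboloid_measurability.
Context {R : realType} {n : nat} {d : measure_display} {Omega : measurableType d}.
Local Notation E := ('rV[R]_n * R)%type.
Variable S : Omega -> set E.
Hypothesis rS : random_set S.

Let ballM (N : nat) : set E := [set y | `|y| <= N%:R].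

(** Points strictly below the hyperplane with slope [c.1] and level [c.2],
    after raising the level by [e] times [1 + l1norm c.1]. *)
Let below (c : E) (e : R) : set E :=
  [set y | (shear y).2 < dotr c.1 y.1 + c.2 + e * (1 + l1norm c.1)].

Let open_below c e : open (below c e).
Proof.
apply: open_lt_fun.
  by move=> q; apply: (@continuous_comp _ _ _ shear snd);
    [exact: continuous_shear|exact: cvg_snd].
apply: continuousD_fun; last exact: continuous_cst_fun.
apply: continuousD_fun; last exact: continuous_cst_fun.
by apply: continuous_dotr; [exact: cst_continuous|move=> q; exact: cvg_fst].
Qed.

Let continuous_l1norm : continuous (fun c : E => l1norm c.1).
Proof.
by apply: continuous_sum => i; apply: continuous_norm_fun; exact: coord_fst_continuous.
Qed.

Let continuous_level (y : E) (e : R) :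
  continuous (fun c : E => dotr c.1 y.1 + c.2 + e * (1 + l1norm c.1)).
Proof.
apply: continuousD_fun.
  apply: continuousD_fun; last exact: coord_snd_continuous.
  by apply: continuous_dotr; [move=> c; exact: cvg_fst|exact: cst_continuous].
apply: continuousM_fun; first exact: continuous_cst_fun.
by apply: continuousD_fun; [exact: continuous_cst_fun|exact: continuous_l1norm].
Qed.

Let rational_dense_pair (c : E) (U : set E) : nbhs c U ->
  exists c' : 'rV[rat]_n * rat, U (map_mx ratr c'.1, ratr c'.2).
Proof.
move=> [[U1 U2] /= [n1 n2] sU].
have [a ha] := rational_dense n1.
have /nbhs_ballP[e /= e0 he] := n2.
have [|r] := @rat_in_itvoo R (c.2 - e) (c.2 + e); first by rewrite ltrD2l gtrN.
rewrite in_itv /= => /andP[h1 h2]; exists (a, r); apply: sU; split=> //=.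
by apply: he; rewrite -ball_normE /ball_ /= ltr_norml; apply/andP; split; lra.
Qed.

(** The supporting hyperplanes can be taken rational after raising the level by a
    small amount, with slope and level bounded uniformly in the size of the ball
    in which the points are tested; a cluster point of these hyperplanes
    supports the whole set. *)
Lemma measurable_hit_paraboloid_ext K : compact K ->
  measurable [set w | paraboloid_ext (S w) `&` K !=set0].
Proof.
move=> cK; have [lfS hS _] := rS.
have bK : borel K.
  by apply: borel_closed; apply: compact_closed => //; exact: norm_hausdorff.
have bB c e : borel (below c e) by exact: borel_open.
have bM N : borel (ballM N).
  apply: borel_closed; apply: closed_le_fun; last exact: continuous_cst_fun.
  exact: norm_continuous.
pose rc (c : 'rV[rat]_n * rat) : E := (map_mx ratr c.1, ratr c.2).
pose A (k M N : nat) c : set Omega := if `|rc c| <= M%:R then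
  (~` [set w | S w `&` (ballM N `&` below (rc c) 0) !=set0]) `&`
  [set w | S w `&` (K `&` below (rc c) k.+1%:R^-1) !=set0] else set0.
have mA k M N c : measurable (A k M N c).
  rewrite /A; case: ifP => // _; apply: measurableI.
    by apply: measurableC; apply: hS; exact: borelI.
  by apply: hS; exact: borelI.
rewrite (_ : mkset _ = \bigcap_k \bigcup_M \bigcap_N \bigcup_c A k M N c).
  apply: bigcap_measurable => [|k _]; first by exists 0%N.
  apply: bigcup_measurable => M _.
  apply: bigcap_measurable => [|N _]; first by exists 0%N.
  by apply: countable_bigcupT_measurable => //; exact: countableP.
pose Q w (k : nat) x := exists a b,
  (forall y, S w y -> dotr a y.1 + b <= (shear y).2) /\
  (shear x).2 <= dotr a x.1 + b + k.+1%:R^-1 * (1 + l1norm a).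
apply/seteqP; split=> [w [x [/paraboloid_extE[Sx hx] Kx]] k _|w hw].
  pose e : R := k.+1%:R^-1 / 4.
  have k0 : 0 < k.+1%:R^-1 :> R by [].
  have e0 : 0 < e by rewrite divr_gt0.
  have [a [b [ab abx]]] := hx e e0.
  pose c : E := (a, b - e).
  exists (Num.truncn `|c|).+1 => // N _.
  have fT : finite_set (S w `&` ballM N) by apply: lfS; exact: compact_pair_ball.
  have near1 : \forall c' \near c, forall y, (S w `&` ballM N) y ->
      dotr c'.1 y.1 + c'.2 + 0 * (1 + l1norm c'.1) < (shear y).2.
    apply: (@near_finite_set _ _ (nbhs c) _ (fun y (c' : E) =>
      dotr c'.1 y.1 + c'.2 + 0 * (1 + l1norm c'.1) < (shear y).2) _ fT).
    move=> y [Sy _]; apply: open_nbhs_nbhs; split.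
      by apply: open_lt_fun; [exact: continuous_level|exact: continuous_cst_fun].
    have := ab y Sy; rewrite /c /= mul0r addr0; move: e0.
    by move: (dotr a _) (y.2 + _) (e) => u v e'; lra.
  have near2 : \forall c' \near c,
      (shear x).2 < dotr c'.1 x.1 + c'.2 + k.+1%:R^-1 * (1 + l1norm c'.1).
    apply: open_nbhs_nbhs; split.
      by apply: open_lt_fun; [exact: continuous_cst_fun|exact: continuous_level].
    have := l1norm_ge0 a; move: abx; rewrite /c /= /e.
    move: (k.+1%:R^-1) k0 (l1norm a) => u u0 l; move: (dotr a _) (_ + _ / 2) => p s.
    nra.
  have near3 : \forall c' \near c, `|c'| < (Num.truncn `|c|).+1%:R.
    apply: open_nbhs_nbhs; split; last exact: truncnS_gt.
    by apply: open_lt_fun; [exact: norm_continuous|exact: continuous_cst_fun].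
  have [c' [h1 [h2 h3]]] := rational_dense_pair (filterI near1 (filterI near2 near3)).
  exists c' => //; rewrite /A ltW//; split; last by exists x.
  move=> [y [Sy [yN hy]]]; have := h1 y (conj Sy yN); rewrite /below /= in hy.
  by move=> h; have := lt_trans h hy; rewrite ltxx.
have [] := @antitone_choice E (S w `&` K) (Q w).
- exact: lfS.
- move=> k l x kl [a [b [h1 h2]]]; exists a, b; split=> //.
  apply: le_trans h2 _; rewrite lerD2l ler_wpM2r ?addr_ge0 ?l1norm_ge0//.
  by rewrite lef_pV2 ?posrE// ler_nat.
- move=> k; have [M _ hM] := hw k I.
  pose Q' N x := exists2 c : E, `|c| <= M%:R & (forall y, S w y -> `|y| <= N%:R ->
    dotr c.1 y.1 + c.2 <= (shear y).2) /\
    (shear x).2 <= dotr c.1 x.1 + c.2 + k.+1%:R^-1 * (1 + l1norm c.1).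
  have [] := @antitone_choice E (S w `&` K) Q'.
  + exact: lfS.
  + move=> N N' x NN' [c cM [h1 h2]]; exists c => //; split=> // y Sy yN.
    by apply: h1 => //; apply: le_trans yN _; rewrite ler_nat.
  + move=> N; have [c _] := hM N I; rewrite /A; case: ifP => // cM.
    move=> [h1 [x [Sx [Kx hx]]]]; exists x => //; exists (rc c) => //.
    split; last exact: ltW.
    move=> y Sy yN; rewrite leNgt; apply/negP => hy; apply: h1; exists y.
    by split=> //; split=> //; rewrite /below /= mul0r addr0.
  move=> x [Sx Kx] hx; exists x => //.
  have /choice[u hu] : forall N, exists c : E, `|c| <= M%:R /\ (forall y, S w y -> `|y| <= N%:R ->
    dotr c.1 y.1 + c.2 <= (shear y).2) /\
    (shear x).2 <= dotr c.1 x.1 + c.2 + k.+1%:R^-1 * (1 + l1norm c.1).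
    by move=> N; have [c ? ?] := hx N; exists c.
  have [] := compact_sequence_cluster _ u (@compact_pair_ball R n M%:R).
    by move=> N; have [] := hu N.
  move=> c _ cl; exists c.1, c.2; split=> [y Sy|].
    have : [set c : E | dotr c.1 y.1 + c.2 + 0 * (1 + l1norm c.1) <= (shear y).2] c.
      apply: cl.
        by apply: closed_le_fun; [exact: continuous_level|exact: continuous_cst_fun].
      near=> N => /=; have [_ [h _]] := hu N; rewrite mul0r addr0; apply: h => //.
      by near: N; exact: nbhs_infty_ger.
    by rewrite /= mul0r addr0.
  have : [set c : E | (shear x).2 <= dotr c.1 x.1 + c.2 + k.+1%:R^-1 * (1 + l1norm c.1)] c.
    apply: cl.
      by apply: closed_le_fun; [exact: continuous_cst_fun|exact: continuous_level].
    by apply: nearW => N; have [_ []] := hu N.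
  by [].
move=> x [Sx Kx] hQ; exists x; split=> //; apply/paraboloid_extE; split=> // e e0.
have [k hk] := filter_ex (near_inv_lt e0).
have [a [b [h1 h2]]] := hQ k; exists a, b; split=> //.
apply: le_trans h2 _; rewrite lerD2l ler_wpM2r ?addr_ge0 ?l1norm_ge0//.
exact: ltW.
Unshelve. all: by end_near. Qed.

End paraboloid_measurability.

(** * Iterated integrals *)

Section iterated_integrals.
Context {R : realType}.
Local Notation mu := (@lebesgue_measure R).

(** The integral of a nonnegative function, measurable or not, is a supremum over
    the simple functions below it. *)
Lemma ge0_integral_le {d} {T : measurableType d} (nu : {measure set T -> \bar R})
    (f g : T -> \bar R) : (forall x, (0 <= f x)%E) -> (forall x, (f x <= g x)%E) ->
  (\int[nu]_x f x <= \int[nu]_x g x)%E.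
Proof.
move=> f0 fg; have g0 x : (0 <= g x)%E by exact: le_trans (fg x).
rewrite !ge0_integralTE//; apply: le_ereal_sup => _ [h hf <-].
by exists h => // x; exact: le_trans (hf x) (fg x).
Qed.

Lemma integral_rV_ge0 n (f : 'rV[R]_n -> \bar R) : (forall x, (0 <= f x)%E) ->
  (0 <= integral_rV f)%E.
Proof.
elim: n f => [f f0 /=|n IH f f0]; first exact: f0.
by apply: integral_ge0 => x _; exact: IH.
Qed.

Lemma integral_rV_le n (f g : 'rV[R]_n -> \bar R) : (forall x, (0 <= f x)%E) ->
  (forall x, (f x <= g x)%E) -> (integral_rV f <= integral_rV g)%E.
Proof.
elim: n f g => [f g f0 fg /=|n IH f g f0 fg]; first exact: fg.
apply: ge0_integral_le => x; first exact: integral_rV_ge0.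
exact: IH.
Qed.

Lemma eq_integral_rV n (f g : 'rV[R]_n -> \bar R) : (forall x, f x = g x) ->
  integral_rV f = integral_rV g.
Proof. by move=> /funext ->. Qed.

Lemma row_mx_last m (x z : R) (v : 'rV[R]_m) :
  row_mx (x%:M : 'rV[R]_1) (row_mx v (z%:M : 'rV[R]_1)) =
  row_mx (row_mx (x%:M : 'rV[R]_1) v) (z%:M : 'rV[R]_1) :> 'rV[R]_(m.+1 + 1).
Proof.
by rewrite (@row_mxA _ 1 1 m 1 x%:M v z%:M); exact: castmx_id.
Qed.

(** The iterated integral peels off the first coordinate, whereas the height is
    the last one. *)
Lemma integral_rV_last n (f : 'rV[R]_(n + 1) -> \bar R) :
  integral_rV f = integral_rV (fun v : 'rV[R]_n =>
    \int[mu]_z f (row_mx v (z%:M : 'rV[R]_1)))%E.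
Proof.
elim: n f => [f|n IH f].
  rewrite /integral_rV; apply: eq_integral => z _; congr f.
  apply/rowP => i; rewrite [LHS](@mxE _ 1 (1 + 0)) [RHS](@mxE _ 1 (0 + 1)).
  case: splitP => [a _|[]//]; case: splitP => [[]//|b _].
  by rewrite (ord1 a) (ord1 b).
transitivity (\int[mu]_x integral_rV (fun v : 'rV[R]_(n + 1) =>
  f (row_mx (x%:M : 'rV[R]_1) v)))%E; first by [].
apply: eq_integral => x _; rewrite IH; apply: eq_integral_rV => v.
by apply: eq_integral => z _; rewrite row_mx_last.
Qed.

(** The case of Tonelli's theorem to which all intensities below reduce. *)
Lemma integral_rV_prod n (g : 'I_n -> R -> R) (c : R) : 0 <= c ->
  (forall i, measurable_fun setT (g i)) -> (forall i t, 0 <= g i t) ->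
  (forall i, (\int[mu]_t (g i t)%:E < +oo)%E) ->
  integral_rV (fun v : 'rV[R]_n => (c * \prod_i g i (v 0 i))%:E) =
  (c * \prod_i fine (\int[mu]_t (g i t)%:E))%:E.
Proof.
elim: n g c => [g c c0 _ _ _|n IH g c c0 mg g0 gi]; first by rewrite /= !big_ord0.
transitivity (\int[mu]_t ((c * \prod_(i < n)
    fine (\int[mu]_s (g (lift ord0 i) s)%:E))%:E * (g ord0 t)%:E))%E.
  apply: eq_integral => x _; rewrite -EFinM.
  rewrite (_ : _ * _ * _ = (c * g ord0 x) * \prod_(i < n) fine (\int[mu]_s (g (lift ord0 i) s)%:E)); last by ring.
  rewrite -IH//; last by rewrite mulr_ge0.
  apply: eq_integral_rV => v; rewrite big_ord_recl mulrA; congr (_%:E).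
  have e0 : row_mx (x%:M : 'rV[R]_1) v 0 ord0 = x.
    have -> : ord0 = lshift n (ord0 : 'I_1) by apply/val_inj.
    by rewrite (@row_mxEl _ 1 1 n) mxE eqxx mulr1n.
  rewrite e0; congr (_ * _); apply: eq_bigr => i _; congr (g _ _).
  have -> : lift ord0 i = rshift 1 i by apply/val_inj.
  by rewrite (@row_mxEr _ 1 1 n).
have p0 : 0 <= \prod_(i < n) fine (\int[mu]_s (g (lift ord0 i) s)%:E)%E.
  by apply: prodr_ge0 => i _; apply: fine_ge0; apply: integral_ge0 => t _; rewrite lee_fin.
rewrite ge0_integralZl//.
- rewrite big_ord_recl -(@fineK _ (\int[mu]_t (g ord0 t)%:E)%E) ?ge0_fin_numE//.
    by rewrite -EFinM; congr (_%:E); rewrite /=; ring.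
  by apply: integral_ge0 => t _; rewrite lee_fin.
- by apply/measurable_EFinP; exact: mg.
- by move=> t _; rewrite lee_fin.
- by rewrite lee_fin mulr_ge0.
Qed.

End iterated_integrals.

(** * One-dimensional integrals *)

Section one_dimensional.
Context {R : realType}.
Local Notation mu := (@lebesgue_measure R).

Lemma measurable_continuous (f : R -> R) : continuous f -> measurable_fun setT f.
Proof. exact: continuous_measurable_fun. Qed.

Lemma integral_restrict_indic (D : set R) (f : R -> R) :
  (\int[mu]_(x in D) (f x)%:E = \int[mu]_x (f x * \1_D x)%:E)%E.
Proof.
rewrite integral_mkcond; apply: eq_integral => x _.
rewrite /patch indicE; case: ifP => _; first by rewrite mulr1.
by rewrite mulr0.
Qed.

Lemma integral_exp_affine (al be a b : R) : al != 0 -> a < b ->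
  (\int[mu]_(x in `[a, b]) (expR (al * x + be))%:E =
    ((expR (al * b + be) - expR (al * a + be)) / al)%:E)%E.
Proof.
move=> al0 ab; pose F x := expR (al * x + be) / al.
have dF (x : R) : is_derive x (1 : R) F (expR (al * x + be)).
  have -> : F = (fun x => al^-1 *: expR (al * x + be)).
    by apply/funext => y; rewrite /F mulrC.
  apply: is_derive_eq; rewrite /GRing.scale /= !mulr1 addr0.
  by rewrite mulrCA mulVf// mulr1.
rewrite (@continuous_FTC2 _ _ F)//.
- by rewrite -EFinB /F -mulrBl.
- apply: continuous_subspaceT => x.
  apply: continuous_comp; last exact: continuous_expR.
  by apply: cvgD; [apply: cvgM; [exact: cvg_cst|exact: cvg_id]|exact: cvg_cst].
- have cF x : {for x, continuous F}.
    apply: differentiable_continuous; apply/derivable1_diffP.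
    exact: (@ex_derive _ _ _ _ _ _ _ (dF x)).
  split.
  + by move=> x _; exact: (@ex_derive _ _ _ _ _ _ _ (dF x)).
  + exact: cvg_at_right_filter (cF a).
  + exact: cvg_at_left_filter (cF b).
- by move=> x _; rewrite derive1E (@derive_val _ _ _ _ _ _ _ (dF x)).
Qed.

Lemma integral_exp_lower (al be a : R) : al < 0 ->
  (\int[mu]_(x in `[a, +oo[) (expR (al * x + be))%:E =
    (- (expR (al * a + be) / al))%:E)%E.
Proof.
move=> al0; pose F x := expR (al * x + be) / al.
have aln : al != 0 by rewrite lt_eqF.
have dF (x : R) : is_derive x (1 : R) F (expR (al * x + be)).
  have -> : F = (fun x => al^-1 *: expR (al * x + be)).
    by apply/funext => y; rewrite /F mulrC.
  apply: is_derive_eq; rewrite /GRing.scale /= !mulr1 addr0.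
  by rewrite mulrCA mulVf// mulr1.
rewrite (@ge0_continuous_FTC2y _ _ F a 0)//.
- by rewrite sub0e -EFinN.
- apply: continuous_subspaceT => x.
  have cl : continuous (fun y : R => al * y + be).
    apply: continuousD_fun; last exact: continuous_cst_fun.
    by apply: continuousM_fun; [exact: continuous_cst_fun|move=> y; exact: cvg_id].
  by apply: (continuous_comp (cl x)); exact: continuous_expR.
- have h1 : expR (al * x + be) @[x --> +oo] --> (0 : R).
    have h : expR (- x) @[x --> +oo] --> (0 : R) by exact: cvgr_expR.
    move=> U /h [M [Mr hM]]; exists ((M + be) / - al); split; first exact: num_real.
    move=> x hx /=; rewrite -[al * x + be]opprK; apply: hM.
    by move: hx; rewrite ltr_pdivrMr ?oppr_gt0//; lra.
  have h2 : cst al^-1 (x : R) @[x --> +oo] --> al^-1 by exact: cvg_cst.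
  by have h3 := cvgM h1 h2; rewrite mul0r in h3; exact: h3.
- apply: cvg_at_right_filter; apply: differentiable_continuous.
  apply/derivable1_diffP; exact: (@ex_derive _ _ _ _ _ _ _ (dF a)).
- by move=> x _; rewrite derive1E (@derive_val _ _ _ _ _ _ _ (dF x)).
Qed.

Lemma integral_exp_upper (a : R) :
  (\int[mu]_(x in `]-oo, a]) (expR x)%:E = (expR a)%:E)%E.
Proof.
have := @ge0_integration_by_substitutionNy R expR (- a).
rewrite opprK => ->.
- transitivity (\int[mu]_(x in `[(- a)%R, +oo[) (expR (-1 * x + 0))%:E)%E.
    by apply: eq_integral => x _ /=; rewrite addr0 mulN1r.
  by rewrite integral_exp_lower ?ltrN10// addr0 mulN1r opprK invrN1 mulrN1 opprK.
- by apply: continuous_subspaceT => x; exact: continuous_expR.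
- by move=> x _; exact: expR_ge0.
Qed.

(** The Gaussian weight dominates every exponential. *)
Lemma integral_gauss_exp (B : R) :
  (\int[mu]_t (expR (B * `|t| - t ^+ 2 / 2))%:E < +oo)%E.
Proof.
pose s : R := Num.sqrt 2; have s2 : s ^+ 2 = 2 by rewrite sqr_sqrtr.
have s0 : s != 0 by rewrite sqrtr_eq0 -ltNge.
have p0 : 0 < normal_peak s by exact: normal_peak_gt0.
pose K := expR (B ^+ 2) / normal_peak s.
have K0 : 0 <= K by rewrite divr_ge0// ?expR_ge0// ltW.
apply: (@le_lt_trans _ _ (\int[mu]_t (K%:E * (normal_pdf 0 s t)%:E))%E).
  apply: ge0_integral_le => t; first by rewrite lee_fin expR_ge0.
  rewrite -EFinM lee_fin normal_pdfE// /K mulrA divfK ?gt_eqF//.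
  rewrite /normal_fun subr0 s2 -expRD ler_expR.
  have : 0 <= (`|t| / 2 - B) ^+ 2 by exact: sqr_ge0.
  by rewrite -(real_normK (num_real t)); lra.
rewrite ge0_integralZl//.
- by rewrite integral_normal_pdf mule1 ltry.
- by apply/measurable_EFinP; exact: measurable_normal_pdf.
- by move=> t _; rewrite lee_fin normal_pdf_ge0.
Qed.

End one_dimensional.

(** * Intensities of boxes and of subgraphs *)

Section intensities.
Context {R : realType}.
Local Notation mu := (@lebesgue_measure R).

Lemma eq_indic (T U : Type) (A : set T) (B : set U) x y : (A x <-> B y) ->
  \1_A x = \1_B y :> R.
Proof.
by move=> h; rewrite !indicE; congr ((nat_of_bool _)%:R); apply/idP/idP; rewrite !inE => /h.
Qed.

Lemma measurable_exp_affine (D : set R) (k al be : R) : measurable D ->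
  measurable_fun D (fun x : R => (k * expR (al * x + be))%:E).
Proof.
move=> mD; apply/measurable_EFinP; apply: measurable_funTS.
apply: measurable_funM; first exact: measurable_cst.
apply: measurable_continuous => x.
have cl : continuous (fun y : R => al * y + be).
  apply: continuousD_fun; last exact: continuous_cst_fun.
  by apply: continuousM_fun; [exact: continuous_cst_fun|move=> y; exact: cvg_id].
by apply: (continuous_comp (cl x)); exact: continuous_expR.
Qed.

Lemma integral_exp_closed (k al be a b : R) : 0 <= k -> al != 0 -> a < b ->
  (\int[mu]_(x in `[a, b]) (k * expR (al * x + be))%:E =
    (k * ((expR (al * b + be) - expR (al * a + be)) / al))%:E)%E.
Proof.
move=> k0 al0 ab; rewrite EFinM -integral_exp_affine// -ge0_integralZl//.
- apply/measurable_EFinP; have := @measurable_exp_affine `[a, b] 1 al be.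
  move=> /(_ (measurable_itv _)) /measurable_EFinP.
  by apply: eq_measurable_fun => x _; rewrite mul1r.
Qed.

Lemma integral_exp_left (k al be a b : R) : 0 <= k -> al != 0 -> a < b ->
  (\int[mu]_x (k * expR (al * x + be) * \1_(`]a, b]) x)%:E =
    (k * ((expR (al * b + be) - expR (al * a + be)) / al))%:E)%E.
Proof.
move=> k0 al0 ab; rewrite -integral_restrict_indic -integral_exp_closed//.
by apply: integral_itv_obnd_cbnd; exact: measurable_exp_affine.
Qed.

Lemma integral_exp_right (a b : R) : a < b ->
  (\int[mu]_x (expR x * \1_(`[a, b[) x)%:E = (expR b - expR a)%:E)%E.
Proof.
move=> ab; rewrite -integral_restrict_indic.
transitivity (\int[mu]_(x in `[a, b[) (1 * expR (1 * x + 0))%:E)%E.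
  by apply: eq_integral => x _ /=; rewrite !mul1r addr0.
rewrite integral_itv_bndo_bndc; last exact: measurable_exp_affine.
by rewrite integral_exp_closed// !mul1r !addr0 divr1.
Qed.

Lemma integral_exp_ray (k al be a : R) : 0 <= k -> al < 0 ->
  (\int[mu]_x (k * expR (al * x + be) * \1_(`[a, +oo[) x)%:E =
    (k * - (expR (al * a + be) / al))%:E)%E.
Proof.
move=> k0 al0; rewrite -integral_restrict_indic EFinM -integral_exp_lower//.
rewrite -ge0_integralZl//.
apply/measurable_EFinP; have := @measurable_exp_affine `[a, +oo[ 1 al be.
  move=> /(_ (measurable_itv _)) /measurable_EFinP.
  by apply: eq_measurable_fun => x _; rewrite mul1r.
Qed.

Definition gauss_weight (a b t : R) : R := expR (- (t ^+ 2 / 2)) * \1_(`[a, b[) t.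

Definition gauss_mass (a b : R) : R := fine (\int[mu]_t (gauss_weight a b t)%:E)%E.

Definition exp_weight (B t : R) : R := expR (B * `|t| - t ^+ 2 / 2).

Definition exp_mass (B : R) : R := fine (\int[mu]_t (exp_weight B t)%:E)%E.

Lemma gauss_weight_ge0 a b t : 0 <= gauss_weight a b t.
Proof. by rewrite mulr_ge0 ?expR_ge0// indicE. Qed.

Lemma continuous_gauss : continuous (fun t : R => expR (- (t ^+ 2 / 2))).
Proof.
move=> t; have cl : continuous (fun y : R => - (y ^+ 2 / 2)).
  apply: continuousN_fun; apply: continuousM_fun; last exact: continuous_cst_fun.
  by apply: continuousM_fun => y; exact: cvg_id.
by apply: (continuous_comp (cl t)); exact: continuous_expR.
Qed.

Lemma measurable_gauss_weight a b : measurable_fun setT (gauss_weight a b).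
Proof.
apply: measurable_funM; first exact: measurable_continuous continuous_gauss.
exact: measurable_indic.
Qed.

Lemma measurable_exp_weight B : measurable_fun setT (exp_weight B).
Proof.
apply: measurable_continuous => t.
have cl : continuous (fun y : R => B * `|y| - y ^+ 2 / 2).
  apply: continuousD_fun.
    apply: continuousM_fun; first exact: continuous_cst_fun.
    by apply: continuous_norm_fun => y; exact: cvg_id.
  apply: continuousN_fun; apply: continuousM_fun; last exact: continuous_cst_fun.
  by apply: continuousM_fun => y; exact: cvg_id.
by apply: (continuous_comp (cl t)); exact: continuous_expR.
Qed.

Lemma integral_itv_cst (k a b : R) : 0 <= k -> a <= b ->
  (\int[mu]_t (k * \1_(`[a, b[) t)%:E = (k * (b - a))%:E)%E.
Proof.
move=> k0 ab; rewrite -integral_restrict_indic.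
transitivity (\int[mu]_(x in `[a, b[) (cst k%:E x))%E; first exact: eq_integral.
rewrite integral_cst//= lebesgue_measure_itv /= lte_fin EFinM.
case: ltP => [_|ba]; first by rewrite EFinB.
by rewrite (@le_anti _ _ a b) ?ab// subrr.
Qed.

Lemma gauss_weight_fin a b : a <= b -> (\int[mu]_t (gauss_weight a b t)%:E < +oo)%E.
Proof.
move=> ab; apply: (@le_lt_trans _ _ (\int[mu]_t (1 * \1_(`[a, b[) t)%:E)%E).
  apply: ge0_integral_le => t; rewrite lee_fin ?gauss_weight_ge0//.
  rewrite ler_wpM2r ?indicE// -[leRHS]expR0 ler_expR oppr_le0.
  by rewrite divr_ge0 ?sqr_ge0.
by rewrite integral_itv_cst// ltry.
Qed.

Lemma gauss_massE a b : a <= b ->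
  (\int[mu]_t (gauss_weight a b t)%:E = (gauss_mass a b)%:E)%E.
Proof.
move=> ab; rewrite fineK// ge0_fin_numE ?gauss_weight_fin//.
by apply: integral_ge0 => t _; rewrite lee_fin gauss_weight_ge0.
Qed.

Lemma gauss_mass_le a b : a <= b -> gauss_mass a b <= b - a.
Proof.
move=> ab; rewrite -lee_fin -gauss_massE//.
rewrite -[b - a]mul1r -integral_itv_cst//.
apply: ge0_integral_le => t; rewrite lee_fin ?gauss_weight_ge0//.
rewrite ler_wpM2r ?indicE// -[leRHS]expR0 ler_expR oppr_le0.
by rewrite divr_ge0 ?sqr_ge0.
Qed.

Lemma gauss_mass_gt0 a b : a < b -> 0 < gauss_mass a b.
Proof.
move=> ab; pose k := expR (- ((`|a| + `|b|) ^+ 2 / 2)).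
have k0 : 0 < k * (b - a) by rewrite mulr_gt0 ?expR_gt0 ?subr_gt0.
apply: (lt_le_trans k0).
rewrite -lee_fin -(gauss_massE (ltW ab)) -(integral_itv_cst (expR_ge0 _) (ltW ab)).
apply: ge0_integral_le => t; rewrite lee_fin indicE; first by rewrite mulr_ge0 ?expR_ge0.
rewrite /gauss_weight indicE; case: (boolP (t \in _)) => [|_]; last by rewrite !mulr0.
rewrite inE /= in_itv /= => /andP[at_ tb]; rewrite !mulr1 ler_expR lerN2.
rewrite ler_pM2r// -[leLHS](real_normK (num_real t)) lerXn2r ?nnegrE ?addr_ge0//.
have h1 := ler_norm b; have := ler_norm (- a); rewrite normrN => h2.
have h3 := normr_ge0 a; have h4 := normr_ge0 b.
by rewrite ler_norml; apply/andP; split; lra.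
Qed.

End intensities.

Section boxes.
Context {R : realType} {n : nat}.
Local Notation mu := (@lebesgue_measure R).
Local Notation E := ('rV[R]_n * R)%type.
Implicit Types (a b : 'I_n -> R) (l u : R).

Definition box a b l u : set E :=
  [set p : E | (forall i, a i <= p.1 0 i < b i) /\ l <= p.2 < u].

Definition subgraph (B D : R) : set E :=
  [set p : E | p.2 <= B * l1norm p.1 + D].

Lemma prod_gauss_weight a b (v : 'rV[R]_n) :
  \prod_i gauss_weight (a i) (b i) (v 0 i) =
  expR (- (dotr v v / 2)) * \1_[set v : 'rV[R]_n | forall i, a i <= v 0 i < b i] v.
Proof.
rewrite big_split /= -expR_sum /dotr mulr_suml -sumrN.
congr (expR _ * _); rewrite indicE.
have [h|h] := pselect (forall i, a i <= v 0 i < b i).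
  rewrite mem_set// big1// => i _; rewrite indicE mem_set//= in_itv /=.
  exact: h.
rewrite memNset//; have /existsNP[i hi] := h.
by rewrite (bigD1 i)//= indicE memNset ?mul0r//= in_itv.
Qed.

Lemma prod_exp_weight B (v : 'rV[R]_n) :
  \prod_i exp_weight B (v 0 i) = expR (B * l1norm v - dotr v v / 2).
Proof.
rewrite -expR_sum /dotr /l1norm mulr_suml mulr_sumr -sumrB.
by congr expR; apply: eq_bigr => i _.
Qed.

(** Shearing absorbs the Gaussian weight: the height integral of a sheared box
    over the point [v] of the base carries the factor [exp (- |v|^2 / 2)]. *)
Lemma limit_intensity_box a b l u : (forall i, a i <= b i) -> l < u ->
  limit_intensity (shear @^-1` box a b l u) =
  ((expR u - expR l) * \prod_i gauss_mass (a i) (b i))%:E.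
Proof.
move=> ab lu; rewrite /limit_intensity.
rewrite -(@integral_rV_prod _ _ (fun i => gauss_weight (a i) (b i))).
- apply: eq_integral_rV => v; rewrite prod_gauss_weight.
  set s := dotr v v / 2.
  have s1 h : (shear (v, h)).2 = h + s by rewrite /shear /= enormE.
  rewrite indicE; have [hv|hv] := pselect (forall i, a i <= v 0 i < b i).
    rewrite mem_set// mulr1.
    transitivity (\int[mu]_h (expR h * \1_(`[(l - s)%R, (u - s)%R[) h)%:E)%E.
      apply: eq_integral => h _; congr (_ * _)%:E; apply: eq_indic => /=.
      by rewrite in_itv /= lerBlDr ltrBrDr -s1; split=> [[]|].
    by rewrite integral_exp_right ?ltrD2r// !expRB mulrBl -!expRN.
  rewrite memNset// !mulr0; apply: integral0_eq => h _.
  by rewrite indicE memNset ?mulr0// => -[].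
- by rewrite subr_ge0 ler_expR ltW.
- by move=> i; exact: measurable_gauss_weight.
- by move=> i t; exact: gauss_weight_ge0.
- by move=> i; exact: gauss_weight_fin.
Qed.

End boxes.

Section subgraph_intensity.
Context {R : realType} {n : nat}.
Local Notation mu := (@lebesgue_measure R).
Local Notation E := ('rV[R]_n * R)%type.

Lemma integral_prod_exp (B c : R) : 0 <= c ->
  integral_rV (fun v : 'rV[R]_n => (c * expR (B * l1norm v - dotr v v / 2))%:E) =
  (c * exp_mass B ^+ n)%:E.
Proof.
move=> c0.
have -> : exp_mass B ^+ n = \prod_(i < n) exp_mass B by rewrite prodr_const card_ord.
rewrite -(@integral_rV_prod _ n (fun=> exp_weight B))//.
- by apply: eq_integral_rV => v; rewrite prod_exp_weight.
- by move=> _; exact: measurable_exp_weight.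
- by move=> _ t; exact: expR_ge0.
- by move=> _; exact: integral_gauss_exp.
Qed.

Lemma limit_intensity_subgraph B D :
  limit_intensity (shear @^-1` @subgraph R n B D) = (expR D * exp_mass B ^+ n)%:E.
Proof.
rewrite /limit_intensity -integral_prod_exp ?expR_ge0//; apply: eq_integral_rV => v.
set s := dotr v v / 2.
transitivity (\int[mu]_(h in `]-oo, (B * l1norm v + D - s)%R]) (expR h)%:E)%E.
  rewrite integral_restrict_indic; apply: eq_integral => h _; congr (_ * _)%:E.
  apply: eq_indic; rewrite /subgraph /= in_itv /= enormE -/s.
  by rewrite lerBrDr.
by rewrite integral_exp_upper -expRD; congr (expR _)%:E; ring.
Qed.

End subgraph_intensity.

Section gaussian_intensity.
Context {R : realType} {n : nat}.
Local Notation mu := (@lebesgue_measure R).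
Local Notation E := ('rV[R]_n * R)%type.
Variable r : R.
Hypothesis r0 : 0 < r.

(** The Gaussian density at distance [r] from the origin, per unit of the
    rescaled height. *)
Definition radial_density : R :=
  (2 * pi) `^ (- ((n + 1)%:R / 2)) * expR (- (r ^+ 2 / 2)) / r.

Local Notation rho := radial_density.

Let coef_ge0 lam : 0 <= lam -> 0 <= lam * r * radial_density.
Proof.
move=> lam0; apply: mulr_ge0; first exact: mulr_ge0 (ltW r0).
by rewrite divr_ge0 ?(ltW r0)// mulr_ge0 ?powR_ge0 ?expR_ge0.
Qed.

Lemma radial_density_gt0 : 0 < rho.
Proof.
by rewrite divr_gt0// mulr_gt0 ?expR_gt0// powR_gt0// mulr_gt0// pi_gt0.
Qed.

Lemma aff_row_mx (v : 'rV[R]_n) z :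
  aff r (row_mx v (z%:M : 'rV[R]_1)) = (v, r * (r - z)).
Proof. by rewrite /aff /height row_mxKl row_mxKr mxE eqxx mulr1n. Qed.

(** Linearising the exponent at the radius [r] leaves the error [(z - r)^2 / 2]. *)
Lemma std_normal_row_mx (v : 'rV[R]_n) z :
  std_normal (row_mx v (z%:M : 'rV[R]_1)) =
  (r * rho) * expR (- (dotr v v / 2)) * expR (- r * z + r ^+ 2) *
  expR (- ((r - z) ^+ 2 / 2)).
Proof.
rewrite /std_normal enormE dotr_split row_mxKl /height row_mxKr mxE eqxx mulr1n.
rewrite /radial_density mulrCA divff ?gt_eqF// mulr1 -!mulrA; congr (_ * _).
by rewrite -!expRD; congr expR; field.
Qed.

Lemma gauss_intensity_last (lam : R) (B : set E) :
  gauss_intensity lam (aff r @^-1` B) = integral_rV (fun v : 'rV[R]_n =>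
    \int[mu]_z (lam * std_normal (row_mx v (z%:M : 'rV[R]_1)) *
      \1_B (v, (r * (r - z))%R))%:E)%E.
Proof.
rewrite /gauss_intensity integral_rV_last; apply: eq_integral_rV => v.
apply: eq_integral => z _; congr (_ * _)%:E; apply: eq_indic.
by rewrite /preimage /= aff_row_mx.
Qed.

Lemma std_normal_ge0 (d : nat) (x : 'rV[R]_d) : 0 <= std_normal x.
Proof. by rewrite mulr_ge0 ?powR_ge0 ?expR_ge0. Qed.

Let itv_height l u z : (l <= r * (r - z) < u) = (r - u / r < z <= r - l / r).
Proof.
rewrite ltrBlDr -ltrBlDl ltr_pdivlMr// [_ * r]mulrC andbC; congr andb.
by rewrite lerBrDr -lerBrDl ler_pdivrMr// [_ * r]mulrC.
Qed.

Let indic_box (a b : 'I_n -> R) l u v z :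
  \1_(box a b l u) (v, r * (r - z)) =
  \1_[set v : 'rV[R]_n | forall i, a i <= v 0 i < b i] v *
  \1_(`](r - u / r)%R, (r - l / r)%R]) z :> R.
Proof.
have [hv|hv] := pselect (forall i, a i <= v 0 i < b i).
  rewrite [X in _ = X * _]indicE mem_set// mul1r; apply: eq_indic.
  by rewrite /box /= in_itv /= itv_height; split=> [[]|].
rewrite [LHS]indicE [X in _ = X * _]indicE memNset; last by case.
by rewrite memNset// mul0r.
Qed.

Let integral_slab (k l u : R) : 0 <= k -> l < u ->
  (\int[mu]_z (k * expR (- r * z + r ^+ 2) *
     \1_(`](r - u / r)%R, (r - l / r)%R]) z)%:E = (k * ((expR u - expR l) / r))%:E)%E.
Proof.
move=> k0 lu; have rn : r != 0 by rewrite gt_eqF.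
rewrite integral_exp_left ?oppr_eq0//; last by rewrite ltrD2l ltrN2 ltr_pM2r ?invr_gt0.
have e x : - r * (r - x / r) + r ^+ 2 = x.
  by rewrite mulrBr !mulNr mulrCA divff// mulr1; ring.
by rewrite !e invrN mulrN -mulNr opprB.
Qed.

(** The error term of the linearised exponent is at most [1]. *)
Lemma gauss_intensity_box_le lam (a b : 'I_n -> R) l u : 0 <= lam ->
  (forall i, a i <= b i) -> l < u ->
  (gauss_intensity lam (aff r @^-1` box a b l u) <=
    (lam * rho * ((expR u - expR l) * \prod_i gauss_mass (a i) (b i)))%:E)%E.
Proof.
move=> lam0 ab lu.
have := std_normal_row_mx; have := coef_ge0 lam0; have := radial_density_gt0.
move: radial_density => K K0 cK sn.
rewrite gauss_intensity_last [in leRHS]mulrA.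
rewrite -(@integral_rV_prod _ _ (fun i => gauss_weight (a i) (b i))); first last.
- by move=> i; exact: gauss_weight_fin.
- by move=> i t; exact: gauss_weight_ge0.
- by move=> i; exact: measurable_gauss_weight.
- by apply: mulr_ge0; [exact: mulr_ge0 (ltW K0)|rewrite subr_ge0 ler_expR ltW].
apply: integral_rV_le => v.
  apply: integral_ge0 => z _; rewrite lee_fin mulr_ge0 ?indicE//.
  by rewrite mulr_ge0 ?std_normal_ge0.
rewrite prod_gauss_weight; set s := dotr v v / 2.
pose k := lam * r * K * expR (- s) * \1_[set v : 'rV[R]_n | forall i, a i <= v 0 i < b i] v.
have k0 : 0 <= k.
  by rewrite /k mulr_ge0 ?indicE// mulr_ge0 ?expR_ge0 ?cK.
have -> : lam * K * (expR u - expR l) * (expR (- s) *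
    \1_[set v : 'rV[R]_n | forall i, a i <= v 0 i < b i] v) = k * ((expR u - expR l) / r).
  rewrite /k; set i1 := \1_ _ _; field; exact: lt0r_neq0.
rewrite -integral_slab//; apply: ge0_integral_le => z.
  by rewrite lee_fin mulr_ge0 ?indicE// mulr_ge0 ?std_normal_ge0.
rewrite lee_fin sn.
rewrite indic_box.
rewrite /k !mulrA ler_wpM2r//.
set e1 := expR (- s); set e2 := expR (- r * z + _); set e3 := expR (- ((r - z) ^+ 2 / 2)).
set i1 := \1_[set v : 'rV[R]_n | _] v; have i10 : 0 <= i1 by rewrite /i1 indicE.
have -> : lam * r * K * e1 * e2 * e3 * i1 = lam * r * K * e1 * i1 * e2 * e3 by ring.
rewrite ler_piMr//; first last.
  by rewrite -[leRHS]expR0 ler_expR oppr_le0 divr_ge0 ?sqr_ge0.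
by rewrite mulr_ge0 ?expR_ge0// mulr_ge0// mulr_ge0 ?expR_ge0// cK.
Qed.

(** In the box the distance to the sphere of radius [r] is at most [C / r], which
    bounds the error term of the linearised exponent from below. *)
Lemma gauss_intensity_box_ge lam (a b : 'I_n -> R) l u C : 0 <= lam ->
  (forall i, a i <= b i) -> l < u -> `|l| <= C -> `|u| <= C ->
  ((lam * rho * expR (- (C ^+ 2 / (2 * r ^+ 2))) *
    ((expR u - expR l) * \prod_i gauss_mass (a i) (b i)))%:E <=
  gauss_intensity lam (aff r @^-1` box a b l u))%E.
Proof.
move=> lam0 ab lu lC uC.
have := std_normal_row_mx; have := coef_ge0 lam0; have := radial_density_gt0.
move: radial_density => K K0 cK sn.
set eC := expR _.
have c0 : 0 <= lam * K * eC * (expR u - expR l).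
  apply: mulr_ge0; last by rewrite subr_ge0 ler_expR ltW.
  by apply: mulr_ge0; [exact: mulr_ge0 (ltW K0)|exact: expR_ge0].
rewrite gauss_intensity_last [in leLHS]mulrA.
rewrite -(@integral_rV_prod _ _ (fun i => gauss_weight (a i) (b i))); first last.
- by move=> i; exact: gauss_weight_fin.
- by move=> i t; exact: gauss_weight_ge0.
- by move=> i; exact: measurable_gauss_weight.
- exact: c0.
apply: integral_rV_le => v.
  by rewrite lee_fin mulr_ge0// prodr_ge0// => i _; exact: gauss_weight_ge0.
rewrite prod_gauss_weight; set s := dotr v v / 2.
set i1 := \1_[set v : 'rV[R]_n | forall i, a i <= v 0 i < b i] v.
have i10 : 0 <= i1 by rewrite /i1 indicE.
pose k := lam * r * K * eC * expR (- s) * i1.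
have k0 : 0 <= k.
  by rewrite /k mulr_ge0// mulr_ge0 ?expR_ge0// mulr_ge0 ?expR_ge0 ?cK.
have -> : lam * K * eC * (expR u - expR l) * (expR (- s) * i1) =
    k * ((expR u - expR l) / r).
  by rewrite /k; field; exact: lt0r_neq0.
rewrite -integral_slab//; apply: ge0_integral_le => z.
  by rewrite lee_fin mulr_ge0 ?indicE// mulr_ge0 ?expR_ge0.
rewrite lee_fin sn.
rewrite indic_box -/i1.
rewrite !mulrA; have [hz|hz] := boolP (z \in `](r - u / r)%R, (r - l / r)%R]); last first.
  by rewrite indicE memNset ?mulr0//=; exact/negP.
rewrite ler_wpM2r ?indicE//.
set e1 := expR (- s); set e2 := expR (- r * z + _); set e3 := expR (- ((r - z) ^+ 2 / 2)).
have -> : lam * r * K * e1 * e2 * e3 * i1 = lam * r * K * e1 * i1 * e2 * e3 by ring.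
have -> : k * e2 = lam * r * K * e1 * i1 * e2 * eC by rewrite /k /e1; ring.
rewrite ler_wpM2l//.
  by rewrite mulr_ge0 ?expR_ge0// mulr_ge0// mulr_ge0 ?expR_ge0// cK.
rewrite ler_expR lerN2 invfM mulrA [_ / 2]mulrC [C ^+ 2 / 2]mulrC -mulrA ler_pM2l//.
rewrite ler_pdivlMr ?exprn_gt0// -exprMn -[leLHS](real_normK (num_real _)).
rewrite lerXn2r ?nnegrE ?(le_trans (normr_ge0 _) lC)//.
move: hz; rewrite in_itv /= -itv_height => /andP[h1 h2].
move: lC uC; rewrite mulrC !ler_norml => /andP[l1 l2] /andP[u1 u2].
by apply/andP; split; lra.
Qed.

Lemma gauss_intensity_subgraph_le lam B D : 0 <= lam ->
  (gauss_intensity lam (aff r @^-1` @subgraph R n B D) <=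
    (lam * rho * (expR D * exp_mass B ^+ n))%:E)%E.
Proof.
move=> lam0.
have := std_normal_row_mx; have := coef_ge0 lam0; have := radial_density_gt0.
move: radial_density => K K0 cK sn.
rewrite gauss_intensity_last [in leRHS]mulrA -integral_prod_exp; last first.
  by rewrite mulr_ge0 ?expR_ge0//; exact: mulr_ge0 (ltW K0).
apply: integral_rV_le => v.
  apply: integral_ge0 => z _; rewrite lee_fin mulr_ge0 ?indicE//.
  by rewrite mulr_ge0 ?std_normal_ge0.
set s := dotr v v / 2; set U := B * l1norm v.
pose k := lam * r * K * expR (- s).
have k0 : 0 <= k by rewrite /k mulr_ge0 ?expR_ge0 ?cK.
have -> : (lam * K * expR D * expR (U - s))%:E =
  (\int[mu]_z (k * expR (- r * z + r ^+ 2) * \1_(`[(r - (U + D) / r)%R, +oo[) z)%:E)%E.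
  rewrite integral_exp_ray ?oppr_lt0//; congr (_%:E).
  have -> : - r * (r - (U + D) / r) + r ^+ 2 = U + D.
    by field; exact: lt0r_neq0.
  by rewrite /k !expRD; field; exact: lt0r_neq0.
apply: ge0_integral_le => z.
  by rewrite lee_fin mulr_ge0 ?indicE// mulr_ge0 ?std_normal_ge0.
rewrite lee_fin sn.
have -> : \1_(subgraph B D) (v, r * (r - z)) = \1_(`[(r - (U + D) / r)%R, +oo[) z :> R.
  apply: eq_indic; rewrite /subgraph /= in_itv /= andbT -/U.
  by rewrite lerBlDr -lerBlDl ler_pdivlMr// [_ * r]mulrC.
rewrite ler_wpM2r ?indicE// /k !mulrA.
rewrite ler_piMr//; first last.
  by rewrite -[leRHS]expR0 ler_expR oppr_le0 divr_ge0 ?sqr_ge0.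
by rewrite mulr_ge0 ?expR_ge0// mulr_ge0 ?expR_ge0// cK.
Qed.

End gaussian_intensity.

(** * Masses of the cells *)

Section cell_masses.
Context {R : realType} {n : nat}.
Local Notation E := ('rV[R]_n * R)%type.

Definition grid q (k : nat) : R := (k%:R - q.+1%:R ^+ 3) / q.+1%:R.

Lemma grid_lt q k : grid q k < grid q k.+1.
Proof. by rewrite ltr_pM2r ?invr_gt0// ltrD2r ltr_nat. Qed.

Lemma gridS q k : grid q k.+1 = grid q k + q.+1%:R^-1.
Proof. by rewrite /grid -(natr1 k) addrAC mulrDl mul1r. Qed.

Lemma icellE q k t : icell q k t <-> grid q k <= t < grid q k.+1.
Proof.
rewrite /icell /= /grid ler_pdivrMr// ltr_pdivlMr// [t * _]mulrC.
by rewrite lerBlDr ltrBrDr.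
Qed.

Lemma cell_box q (j : cell_index q) :
  cell q j = box (fun i => grid q (j.1 i)) (fun i => grid q (j.1 i).+1)
    (grid q j.2) (grid q j.2.+1) :> set E.
Proof.
apply/seteqP; split=> p [h1 h2]; split; try exact/icellE.
- by move=> i; apply/icellE; exact: h1.
- by move=> i; apply/icellE; exact: h1.
Qed.

(** The limit intensity of the unsheared cell. *)
Definition cell_mass q (j : @cell_index n q) : R :=
  (expR (grid q j.2.+1) - expR (grid q j.2)) *
  \prod_i gauss_mass (grid q (j.1 i)) (grid q (j.1 i).+1).

Lemma cell_mass_gt0 q (j : cell_index q) : 0 < cell_mass j.
Proof.
rewrite mulr_gt0//; first by rewrite subr_gt0 ltr_expR grid_lt.
by apply: prodr_gt0 => i _; apply: gauss_mass_gt0; exact: grid_lt.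
Qed.

Lemma limit_intensity_cell q (j : cell_index q) :
  limit_intensity (shear @^-1` (cell q j : set E)) = (cell_mass j)%:E.
Proof.
by rewrite cell_box limit_intensity_box ?grid_lt// => i; rewrite ltW ?grid_lt.
Qed.

Definition near_index A q : {set 'I_(2 * q.+1 ^ 3)} :=
  [set k : 'I_(2 * q.+1 ^ 3) | (q.+1 ^ 3 - A * q.+1 <= k < q.+1 ^ 3 + A * q.+1 + 1)%N].

Lemma card_near_index A q : (#|near_index A q| <= 2 * A * q.+1 + 1)%N.
Proof.
rewrite cardE -(size_map val).
apply: (@leq_trans (size (iota (q.+1 ^ 3 - A * q.+1)
  (q.+1 ^ 3 + A * q.+1 + 1 - (q.+1 ^ 3 - A * q.+1))))).
  apply: uniq_leq_size; first by rewrite map_inj_uniq ?enum_uniq//; exact: val_inj.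
  move=> _ /mapP[k + ->]; rewrite mem_enum inE => /andP[h1 h2].
  by rewrite mem_iota h1 subnKC// (leq_trans h1)// ltnW.
rewrite size_iota; lia.
Qed.

Lemma near_indexP A q (k : 'I_(2 * q.+1 ^ 3)) (t : R) : icell q k t ->
  `|t| <= A%:R -> k \in near_index A q.
Proof.
rewrite /icell /= ler_norml => /andP[h1 h2] /andP[h3 h4]; rewrite inE.
have Q0 : 0 < q.+1%:R :> R by [].
have h5 : - (A%:R * q.+1%:R) <= q.+1%:R * t <= A%:R * q.+1%:R.
  by rewrite -mulNr ![_ * q.+1%:R]mulrC !ler_pM2l// h3.
case/andP: h5 => h5 h6; apply/andP; split.
  rewrite leq_subLR -ltnS -(ltr_nat R) -addnS !(natrD, natrM, natrX).
  by apply: le_lt_trans (_ : _ <= A%:R * q.+1%:R + (q.+1%:R * t + q.+1%:R ^+ 3)) _; lra.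
by rewrite addn1 ltnS -(ler_nat R) !(natrD, natrM, natrX); lra.
Qed.

Definition near_columns A q : {set {ffun 'I_n -> 'I_(2 * q.+1 ^ 3)}} :=
  [set f : {ffun 'I_n -> 'I_(2 * q.+1 ^ 3)} | [forall i, f i \in near_index A q]].

Lemma card_near_columns A q : (#|near_columns A q| <= (2 * A * q.+1 + 1) ^ n)%N.
Proof.
apply: leq_trans (_ : #|near_index A q| ^ n <= _)%N; last first.
  by case: (n) => // n'; rewrite leq_exp2r ?card_near_index.
have h := @card_ffun_on 'I_n _ (mem (near_index A q)).
rewrite card_ord in h; rewrite -h; apply: subset_leq_card.
by apply/fintype.subsetP => f; rewrite inE => /forallP hf; apply/ffun_onP.
Qed.

Definition near_cells A q : {set @cell_index n q} :=
  finset.setX (near_columns A q) (near_index A q).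

Lemma near_cellsP A q (j : cell_index q) (p : E) : cell q j p -> `|p| <= A%:R ->
  j \in near_cells A q.
Proof.
move=> [h1 h2] pA; rewrite !inE; apply/andP; split.
  apply/forallP => i; apply: near_indexP (h1 i) _.
  exact: le_trans (normr_coord _ _) (le_trans (normr_fst _) pA).
by have := near_indexP h2 (le_trans (normr_snd p) pA); rewrite inE.
Qed.

Lemma cell_mass_le A q (j : @cell_index n q) : j.2 \in near_index A q ->
  cell_mass j <= expR (A%:R + 1) / q.+1%:R ^+ n.+1.
Proof.
rewrite inE => /andP[_ jA]; rewrite exprS invfM mulrA.
have g0 i : 0 <= gauss_mass (grid q (j.1 i)) (grid q (j.1 i).+1).
  by rewrite ltW// gauss_mass_gt0// grid_lt.
apply: ler_pM; first by rewrite subr_ge0 ler_expR ltW// grid_lt.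
- by apply: prodr_ge0 => i _; exact: g0.
- have := expR_ge1Dx (- q.+1%:R^-1 : R).
  have hS : grid q j.2 = grid q j.2.+1 - q.+1%:R^-1 by rewrite gridS addrK.
  rewrite hS expRD => h.
  have hA : grid q j.2.+1 <= A%:R + 1.
    rewrite ler_pdivrMr// lerBlDr.
    have : (j.2.+1%:R : R) <= (q.+1 ^ 3 + A * q.+1 + 1)%:R by rewrite ler_nat.
    rewrite !(natrD, natrM, natrX) => h1; apply: le_trans h1 _.
    have : 1 <= q.+1%:R :> R by rewrite ler1n.
    rewrite mulrDl mul1r; move: (q.+1%:R ^+ 3 : R) (A%:R * q.+1%:R : R) (q.+1%:R : R) => x y z.
    by lra.
  have e0 := expR_ge0 (grid q j.2.+1).
  apply: (@le_trans _ _ (expR (grid q j.2.+1) * q.+1%:R^-1)).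
    rewrite -{1}[expR (grid _ _)]mulr1 -mulrBr ler_wpM2l//; move: h.
    by generalize (expR (- q.+1%:R^-1) : R) (q.+1%:R^-1 : R) => x y; lra.
  by rewrite ler_pM2r ?invr_gt0// ler_expR.
have -> : (q.+1%:R ^+ n)^-1 = \prod_(i < n) (q.+1%:R^-1 : R).
  by rewrite prodr_const card_ord exprVn.
apply: ler_prod => i _.
rewrite g0; apply: le_trans (gauss_mass_le (ltW (grid_lt _ _))) _.
by rewrite gridS addrAC subrr add0r.
Qed.

(** There are of order [q ^ n.+1] cells near the origin, each of mass of order
    [q ^- n.+1]. *)
Lemma near_cell_mass_sqr A (e : R) : 0 < e -> \forall q \near \oo,
  \sum_(j in near_cells A q) cell_mass j ^+ 2 <= e.
Proof.
move=> e0; pose c : R := expR (A%:R + 1); pose D : R := (2 * A + 1)%:R ^+ n.+1 * c ^+ 2.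
have D0 : 0 <= D by rewrite /D /c mulr_ge0 ?exprn_ge0 ?expR_ge0.
have h : \forall q \near \oo, q.+1%:R^-1 < e / (D + 1).
  by apply: near_inv_lt; rewrite divr_gt0// ltr_wpDl.
apply: filterS h => q hq; set Q : R := q.+1%:R in hq *.
have Q1 : 1 <= Q by rewrite /Q ler1n.
have Q0 : 0 < Q by exact: lt_le_trans Q1.
apply: (@le_trans _ _ (\sum_(j in near_cells A q) (c / Q ^+ n.+1) ^+ 2)).
  apply: ler_sum => -[f k]; rewrite finset.in_setX => /andP[_ jA].
  by rewrite lerXn2r ?nnegrE ?cell_mass_le ?ltW ?cell_mass_gt0//
    divr_gt0 ?expR_gt0 ?exprn_gt0.
rewrite sumr_const -mulr_natr.
have hc : (#|near_cells A q|%:R : R) <= (2 * A + 1)%:R ^+ n.+1 * Q ^+ n.+1.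
  rewrite -exprMn -natrM -natrX ler_nat cardsX.
  rewrite [X in (_ <= X)%N]expnSr; apply: leq_mul.
    apply: leq_trans (card_near_columns A q) _; case: (n) => // n'.
    by rewrite leq_exp2r// mulnDl mul1n leq_add2l.
  apply: leq_trans (card_near_index A q) _.
  by rewrite mulnDl mul1n leq_add2l.
have Qn0 : 0 < Q ^+ n.+1 by rewrite exprn_gt0.
apply: (@le_trans _ _ ((c / Q ^+ n.+1) ^+ 2 * ((2 * A + 1)%:R ^+ n.+1 * Q ^+ n.+1))).
  by rewrite ler_wpM2l// sqr_ge0.
have -> : (c / Q ^+ n.+1) ^+ 2 * ((2 * A + 1)%:R ^+ n.+1 * Q ^+ n.+1) = D / Q ^+ n.+1.
  by rewrite /D; field; rewrite gt_eqF.
apply: (@le_trans _ _ (D / Q)).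
  by rewrite ler_wpM2l// lef_pV2 ?posrE// exprS ler_peMr ?(ltW Q0)// exprn_ege1.
move: hq; rewrite ltr_pdivlMr ?ltr_wpDl// => hq.
by move: (Q^-1) hq (invr_gt0 Q) => y hq; rewrite Q0 => y0; nra.
Qed.

End cell_masses.

(** * Families that are asymptotically Poisson *)

Section poisson_counts.
Context {R : realType} {n : nat} {X : topologicalType}.
Local Notation E := ('rV[R]_n * R)%type.
Context {d : measure_display} {Omega : measurableType d} {P : probability Omega R}.
Context {nu : set X -> \bar R} {xi : Omega -> set X}.
Hypothesis poissonP : poisson_process P nu xi.
Variable f : X -> E.
Hypothesis f_continuous : continuous f.

Let mass B : R := fine (nu (f @^-1` B)).

Lemma image_misses (S : set X) (B : set E) :
  (f @` S) `&` B = set0 <-> S `&` f @^-1` B = set0.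
Proof.
split=> h; apply/seteqP; split=> //.
  move=> x [Sx Bx]; have : ((f @` S) `&` B) (f x) by split=> //; exists x.
  by rewrite h.
move=> _ [[x Sx <-] Bx]; have : (S `&` f @^-1` B) x by [].
by rewrite h.
Qed.

Let measurable_count B (k : nat) : borel B ->
  measurable [set w | counting (xi w `&` f @^-1` B) = k%:R%:E :> \bar R].
Proof.
have [[_ mxi] _ _] := poissonP => bB.
rewrite -[X in measurable X]setTI.
by have /(_ measurableT [set k%:R%:E] (emeasurable_set1 _)) :=
  mxi _ (borel_continuous f_continuous bB).
Qed.

Let pr_count B (k : nat) : borel B ->
  (0 <= nu (f @^-1` B))%E -> (nu (f @^-1` B) < +oo)%E ->
  pr P [set w | counting (xi w `&` f @^-1` B) = k%:R%:E :> \bar R] =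
  mass B ^+ k / k`!%:R * expR (- mass B).
Proof.
have [_ cP _] := poissonP => bB nu0 nuy.
rewrite /pr cP//; last exact: borel_continuous.
rewrite /poisson_prob; case: ltP => [m0|m0].
  rewrite esum_set1 ?lee_fin ?poisson_pmf_ge0//= /poisson_pmf m0.
  by rewrite mulrAC.
have -> : mass B = 0 by apply/eqP; rewrite eq_le m0 fine_ge0.
rewrite diracE oppr0 expR0 mulr1 expr0n.
case: k => [|k]; first by rewrite mem_set//= divr1.
by rewrite memNset//= mul0r.
Qed.

Let misses_count w B : f @` xi w `&` B = set0 <->
  counting (xi w `&` f @^-1` B) = 0%:R%:E :> \bar R.
Proof.
rewrite image_misses; split=> h; first by apply/eqP/counting0P.
by apply/(@counting0P R); apply/eqP.
Qed.

Lemma measurable_poisson_misses B : borel B ->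
  measurable [set w | f @` xi w `&` B = set0].
Proof.
move=> bB; rewrite (_ : mkset _ = [set w | counting (xi w `&` f @^-1` B) = 0%:R%:E :> \bar R]).
  exact: measurable_count.
by apply/seteqP; split=> w /= h; apply/misses_count.
Qed.

Lemma pr_poisson_misses B : borel B ->
  (0 <= nu (f @^-1` B))%E -> (nu (f @^-1` B) < +oo)%E ->
  pr P [set w | f @` xi w `&` B = set0] = expR (- mass B).
Proof.
move=> bB nu0 nuy.
rewrite (_ : mkset _ = [set w | counting (xi w `&` f @^-1` B) = 0%:R%:E :> \bar R]).
  by rewrite pr_count// expr0 fact0 divr1 mul1r.
by apply/seteqP; split=> w /= h; apply/misses_count.
Qed.

(** Independence of the counts in disjoint cells. *)
Lemma pr_poisson_misses_all (J : finType) (A : {set J}) (B : J -> set E) :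
  (forall j, borel (B j)) -> (forall j j' p, B j p -> B j' p -> j = j') ->
  (forall j, (0 <= nu (f @^-1` B j))%E) -> (forall j, (nu (f @^-1` B j) < +oo)%E) ->
  measurable [set w | forall j, j \in A -> f @` xi w `&` B j = set0] /\
  pr P [set w | forall j, j \in A -> f @` xi w `&` B j = set0] =
  \prod_(j in A) expR (- mass (B j)).
Proof.
have [_ _ indep] := poissonP => bB dB nu0 nuy; split.
  rewrite (_ : mkset _ = [set w | forall j, j \in enum A -> f @` xi w `&` B j = set0]).
    by apply: measurable_forall_seq => j; exact: measurable_poisson_misses.
  by apply/seteqP; split=> w h j jA; apply: h; rewrite mem_enum in jA *.
pose a (i : 'I_#|A|) := enum_val i.
have := indep #|A| (fun i => f @^-1` B (a i)) (fun=> 0%N)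
  (fun i => borel_continuous f_continuous (bB (a i))).
have tI : trivIset setT (fun i => f @^-1` B (a i)).
  move=> i i' _ _ [x [Bx Bx']]; apply: enum_val_inj; exact: dB Bx Bx'.
move=> /(_ tI); rewrite /pr; set L := \bigcap_i _.
have -> : [set w | forall j, j \in A -> f @` xi w `&` B j = set0] = L.
  apply/seteqP; split=> w h.
    by move=> i _; apply/misses_count; apply: h; exact: enum_valP.
  by move=> j jA; apply/misses_count; have := h (enum_rank_in jA j) I; rewrite /a enum_rankK_in.
move=> ->; rewrite (eq_bigr (fun i => (expR (- mass (B (a i))))%:E)); last first.
  move=> i _; rewrite -(pr_poisson_misses (bB _) (nu0 _) (nuy _)) -prE.
    by congr (P _); apply/seteqP; split=> w /misses_count.
  exact: measurable_poisson_misses.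
by rewrite prodEFin /= [RHS]big_enum_val.
Qed.

(** Two points have probability [1 - (1 + m) * exp (- m) <= m ^ 2]. *)
Lemma pr_poisson_double B (M : R) : borel B ->
  (0 <= nu (f @^-1` B))%E -> (nu (f @^-1` B) <= M%:E)%E ->
  exists D, [/\ measurable D, (P D <= (M ^+ 2)%:E)%E &
    forall w, ~ D w -> forall p p', (f @` xi w) p -> (f @` xi w) p' ->
      B p -> B p' -> p' = p].
Proof.
move=> bB nu0 nuM; have nuy : (nu (f @^-1` B) < +oo)%E by exact: le_lt_trans nuM (ltry _).
have mM : mass B <= M by rewrite -lee_fin fineK// ge0_fin_numE.
have m0 : 0 <= mass B by exact: fine_ge0.
pose C k := [set w | counting (xi w `&` f @^-1` B) = k%:R%:E :> \bar R].
have mC k : measurable (C k) by exact: measurable_count.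
exists (~` (C 0%N `|` C 1%N)); split.
- by apply: measurableC; exact: measurableU.
- have mU : measurable (C 0%N `|` C 1%N) by exact: measurableU.
  rewrite prE; last exact: measurableC.
  rewrite lee_fin prC// prU_disjoint//; last first.
    apply/seteqP; split=> // w [h1 h2]; have := h1; rewrite /C /= in h2.
    by rewrite /C /= h2 => /eqP; rewrite eqe oner_eq0.
  rewrite !pr_count// expr0 expr1 !divr1 mul1r.
  have := expR_ge1Dx (- mass B); have := expR_gt0 (- mass B).
  by move: (expR _) => x x0 hx; nra.
- move=> w /contrapT hw _ _ [x Sx <-] [x' Sx' <-] Bx Bx'; congr f.
  case: hw => [/misses_count h0|]; first by have : (f @` xi w `&` B) (f x); [split=> //; exists x|rewrite h0].
  move=> /eqP/counting1P[z hz].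
  have : [set z] x by rewrite -hz.
  have : [set z] x' by rewrite -hz.
  by move=> -> ->.
Qed.

Lemma pr_poisson_hit B (M : R) : borel B ->
  (0 <= nu (f @^-1` B))%E -> (nu (f @^-1` B) <= M%:E)%E ->
  exists D, [/\ measurable D, (P D <= M%:E)%E &
    forall w, ~ D w -> f @` xi w `&` B = set0].
Proof.
move=> bB nu0 nuM; have nuy : (nu (f @^-1` B) < +oo)%E by exact: le_lt_trans nuM (ltry _).
have mM : mass B <= M by rewrite -lee_fin fineK// ge0_fin_numE.
have mB := measurable_poisson_misses bB.
exists (~` [set w | f @` xi w `&` B = set0]); split.
- exact: measurableC.
- rewrite prE; last exact: measurableC.
  rewrite lee_fin prC// pr_poisson_misses//.
  by have := expR_ge1Dx (- mass B); move: (expR _) => x; lra.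
- by move=> w /contrapT.
Qed.

End poisson_counts.

Section assembly.
Context {R : realType} {n : nat}.
Local Notation E := ('rV[R]_n * R)%type.

Lemma norm_l1 (v : 'rV[R]_n) : `|v| <= l1norm v.
Proof.
apply: normr_rV_le => [|i]; first exact: l1norm_ge0.
by rewrite /l1norm (bigD1 i)//= lerDl sumr_ge0.
Qed.

(** If [q.+1 < |v|] the slope is raised by one unit, which lowers the level by
    [q.+1]; otherwise the point itself is below the level [- q.+1]. *)
Lemma far_subgraph A q :
  far A q `<=` @subgraph R n (A%:R + 1) (A%:R - q.+1%:R).
Proof.
move=> [v h] [/= hc [hv|hh]].
  have := lt_le_trans hv (norm_l1 v); move: hc; rewrite /cone /subgraph /=.
  by move: (l1norm v) (q.+1%:R : R) => x y; lra.
rewrite /subgraph /= /setT; have := l1norm_ge0 v; have : 0 <= A%:R :> R by [].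
by move: hh; move: (l1norm v) (q.+1%:R : R) (A%:R : R) => x y z; nra.
Qed.

Lemma closed_subgraph (B D : R) : closed (@subgraph R n B D).
Proof.
apply: closed_le_fun; first exact: coord_snd_continuous.
apply: continuousD_fun; last exact: continuous_cst_fun.
apply: continuousM_fun; first exact: continuous_cst_fun.
apply: continuous_sum => i; apply: continuous_norm_fun; exact: coord_fst_continuous.
Qed.

Lemma borel_subgraph (B D : R) : borel (@subgraph R n B D).
Proof. by apply: borel_closed; exact: closed_subgraph. Qed.

Lemma near_expRN (k e : R) : 0 <= k -> 0 < e ->
  \forall q \near \oo, k * expR (- q.+1%:R) <= e.
Proof.
move=> k0 e0; near=> q.
have h : k / e < q.+1%:R.
  by apply: lt_trans (_ : _ < q%:R) _; [near: q; exact: nbhs_infty_gtr|rewrite ltr_nat].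
rewrite expRN ler_pdivrMr ?expR_gt0//.
have h1 := expR_ge1Dx (q.+1%:R : R).
move: h; rewrite ltr_pdivrMr// => h.
apply: ltW; apply: lt_le_trans h _; rewrite [leLHS]mulrC ler_pM2l//.
by apply: le_trans h1; rewrite lerDr.
Unshelve. all: by end_near. Qed.

(** It suffices to control single cells and subgraphs by their limit
    intensities up to a factor that tends to [1]: the expected number of cells
    that contain two points is a sum of squares of small masses, and the
    subgraphs take care of the far region. *)
Lemma asymptotically_poissonI {I : Type} (F : set_system I) {FF : ProperFilter F}
    {d : I -> measure_display} {Omega : forall i, measurableType (d i)}
    (P : forall i, probability (Omega i) R) (Z : forall i, Omega i -> set E)
    (c : I -> R) :
  c i @[i --> F] --> (1 : R) ->
  (\forall i \near F, forall w, locally_finite (Z i w)) ->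
  (forall q (J : {set cell_index q}),
      (\forall i \near F, measurable (misses (Z i) J)) /\
      pr (P i) (misses (Z i) J) @[i --> F] --> \prod_(j in J) expR (- cell_mass j)) ->
  (\forall i \near F, forall q (j : cell_index q), exists D,
    [/\ measurable D, (P i D <= ((c i * cell_mass j) ^+ 2)%:E)%E &
    forall w, ~ D w -> forall p p', Z i w p -> Z i w p' ->
      cell q j p -> cell q j p' -> p' = p]) ->
  (\forall i \near F, forall B D, exists D',
    [/\ measurable D', (P i D' <= (c i * (expR D * exp_mass B ^+ n))%:E)%E &
    forall w, ~ D' w -> Z i w `&` subgraph B D = set0]) ->
  asymptotically_poisson (@cell_mass R n) F P Z.
Proof.
move=> c1 hlf hmiss hdouble hfar.
have c2 : \forall i \near F, `|c i| < 2.
  by apply: (cvgr_norm_lt _ c1); rewrite normr1 ltr1n.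
split=> // A e e0.
  have e4 : 0 < e / 4 by rewrite divr_gt0.
  apply: filterS (near_cell_mass_sqr A e4) => q hq.
  apply: filterS2 c2 hdouble => i ci /(_ q) /choice[D hD].
  exists [set w | exists2 j, j \in enum (near_cells A q) & D j w]; split.
  - by apply: measurable_exists_seq => j; have [] := hD j.
  - rewrite prE; last by apply: measurable_exists_seq => j; have [] := hD j.
    have mD j : measurable (D j) by have [] := hD j.
    rewrite lee_fin; apply: le_trans (pr_exists_seq (P i) (enum (near_cells A q)) mD) _.
    rewrite big_enum /=; apply: (@le_trans _ _ (4 * (e / 4))); last by lra.
    have hs : 4 * \sum_(j in @near_cells n A q) cell_mass j ^+ 2 <= 4 * (e / 4).
      rewrite ler_pM2l//; exact: hq.
    apply: le_trans hs; rewrite mulr_sumr; apply: ler_sum => j _; have [_ PD _] := hD j.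
    apply: le_trans (pr_le_bound (mD j) PD) _; rewrite exprMn ler_wpM2r ?sqr_ge0//.
    by rewrite -[leLHS](real_normK (num_real _)); move: (`|c i|) (normr_ge0 (c i)) ci => x; nra.
  - move=> w nD j p p' Zp Zp' jp jp' pA; have [_ _ h] := hD j.
    apply: (h w) => // Dw; apply: nD; exists j => //.
    by rewrite mem_enum; exact: near_cellsP jp pA.
pose k : R := 2 * (expR A%:R * exp_mass (A%:R + 1) ^+ n).
have k0 : 0 <= k.
  rewrite !mulr_ge0 ?expR_ge0 ?exprn_ge0// fine_ge0// integral_ge0// => t _.
  by rewrite lee_fin expR_ge0.
apply: filterS (near_expRN k0 e0) => q hq.
apply: filterS2 c2 hfar => i ci /(_ (A%:R + 1) (A%:R - q.+1%:R)) [D [mD PD hD]].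
exists D; split=> //.
  apply: le_trans PD _; rewrite lee_fin; apply: le_trans hq.
  rewrite /k expRD; move: (expR A%:R) (expR (- _)) (expR_ge0 A%:R : 0 <= _ :> R) (expR_ge0 (- q.+1%:R) : 0 <= _ :> R).
  move=> x y x0 y0.
  have z0 : 0 <= exp_mass (A%:R + 1) ^+ n :> R.
    by rewrite exprn_ge0// fine_ge0// integral_ge0// => t _; rewrite lee_fin expR_ge0.
  move: (_ ^+ n) z0 => z z0.
  have -> : 2 * (x * z) * y = 2 * (x * y * z) by ring.
  by apply: ler_wpM2r; [rewrite !mulr_ge0|exact: le_trans (ler_norm _) (ltW ci)].
move=> w /hD h; apply/seteqP; split=> // p [Zp /far_subgraph fp].
have : (Z i w `&` subgraph (A%:R + 1) (A%:R - q.+1%:R)) p by [].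
by rewrite h.
Qed.

End assembly.

(** * The scaling radius *)

Section radius.
Context {R : realType} {n : nat}.

Local Notation radius := (@scaling_radius R (n + 1)).

Let D : R := 2 * (2 * pi) ^+ (n + 1).

Let D0 : 0 < D.
Proof. by rewrite mulr_gt0// exprn_gt0// mulr_gt0// pi_gt0. Qed.

Lemma ln_le_sqrt (y : R) : 0 < y -> ln y <= 2 * Num.sqrt y.
Proof.
move=> y0; have s0 : 0 < Num.sqrt y by rewrite sqrtr_gt0.
have -> : ln y = 2 * ln (Num.sqrt y).
  by rewrite mulr_natl -lnXn// sqr_sqrtr// ltW.
rewrite ler_pM2l//.
rewrite -ler_expR lnK ?posrE//.
by apply: le_trans (expR_ge1Dx _); rewrite lerDr.
Qed.

(** The logarithm of [D * ln lam] is negligible with respect to [ln lam]. *)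
Lemma near_log (e : R) : 0 < e -> \forall lam \near +oo,
  [/\ 0 < lam, 0 < ln lam, 0 <= ln (D * ln lam) & ln (D * ln lam) <= e * ln lam].
Proof.
move=> e0; near=> lam.
pose M : R := D^-1 + 4 * D / e ^+ 2.
have M0 : 0 < M by rewrite addr_gt0 ?invr_gt0// divr_gt0 ?exprn_gt0// mulr_gt0.
have lM : expR M <= lam by near: lam; exact: nbhs_pinfty_ge.
have lam0 : 0 < lam by exact: lt_le_trans (expR_gt0 _) lM.
have xM : M <= ln lam by rewrite -ler_expR lnK ?posrE.
have x0 := lt_le_trans M0 xM.
have Dx0 : 0 < D * ln lam by rewrite mulr_gt0.
split=> //.
  rewrite ln_ge0// -ler_pdivrMl// mulr1; apply: le_trans xM.
  by rewrite lerDl ltW// divr_gt0 ?exprn_gt0// mulr_gt0.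
apply: le_trans (ln_le_sqrt Dx0) _.
rewrite -(@ler_pXn2r _ 2) ?nnegrE ?mulr_ge0 ?sqrtr_ge0 ?(ltW e0) ?(ltW x0)//.
rewrite !exprMn (sqr_sqrtr (ltW Dx0)).
have h : 4 * D <= e ^+ 2 * ln lam.
  rewrite [leRHS]mulrC -ler_pdivrMr ?exprn_gt0//; apply: le_trans xM.
  by rewrite lerDr invr_ge0 ltW.
move: h x0; move: (ln lam) (e ^+ 2) => x y h x0; nra.
Unshelve. all: by end_near. Qed.

(** The intensity per unit of rescaled height at the scaling radius; its square
    is [2 * ln lam / radius lam ^+ 2]. *)
Definition intensity_factor (lam : R) : R := lam * @radial_density R n (radius lam).

Lemma near_radius (e : R) : 0 < e -> e <= 1 -> \forall lam \near +oo,
  [/\ 0 < lam, 0 < radius lam, ln lam <= radius lam ^+ 2,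
    1 <= intensity_factor lam & intensity_factor lam <= 1 + e].
Proof.
move=> e0 e1; apply: filterS (near_log e0) => lam [lam0 x0 l0 le].
set x := ln lam in x0 l0 le *; set L := ln (D * x) in l0 le.
have r2 : radius lam ^+ 2 = 2 * x - L.
  by rewrite /scaling_radius -/D -/x -/L sqr_sqrtr//; nra.
have r20 : 0 < 2 * x - L by nra.
have r0 : 0 < radius lam.
  by rewrite sqrtr_gt0; move: r20; rewrite -r2.
have c0 : 0 < intensity_factor lam.
  by rewrite mulr_gt0// radial_density_gt0.
have c2 : intensity_factor lam ^+ 2 = 2 * x / (2 * x - L).
  rewrite /intensity_factor /radial_density !exprMn exprVn -r2.
  rewrite -expRM_natl -[((2 * pi) `^ _) ^+ 2]powR_mulrn ?powR_ge0// -powRrM.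
  have -> : (2 : nat)%:R * - (radius lam ^+ 2 / 2) = L - x - x.
    by rewrite r2; field.
  have eL : expR L = D * x by rewrite lnK// posrE mulr_gt0.
  have ex : expR x = lam by rewrite lnK// posrE.
  rewrite !expRB eL ex.
  have -> : - ((n + 1)%:R / 2) * 2%:R = - (n + 1)%:R :> R by field.
  rewrite powR_invn ?mulr_ge0 ?pi_ge0// /D.
  have p0 : (2 * pi : R) ^+ (n + 1) != 0 by rewrite expf_neq0// mulf_neq0// gt_eqF ?pi_gt0.
  by field; rewrite p0 !gt_eqF.
have h1 : 1 <= intensity_factor lam.
  rewrite -(@ler_pXn2r _ 2)// ?nnegrE ?(ltW c0)// c2 expr1n ler_pdivlMr//.
  by lra.
split=> //; first by rewrite r2; nra.
apply: (@le_trans _ _ (intensity_factor lam ^+ 2)).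
  by rewrite expr2 ler_peMr ?(ltW c0).
rewrite c2 ler_pdivrMr//; nra.
Qed.

Lemma intensity_factor_cvg : intensity_factor lam @[lam --> +oo] --> (1 : R).
Proof.
apply/cvgrPdist_le => e e0; pose e' := Num.min e 1.
have e'0 : 0 < e' by rewrite lt_min e0 ltr01.
have e'1 : e' <= 1 by rewrite ge_min lexx orbT.
apply: filterS (near_radius e'0 e'1) => lam [_ _ _ h1 h2].
have e'e : e' <= e by rewrite ge_min lexx.
by rewrite distrC ger0_norm ?subr_ge0//; lra.
Qed.

Lemma radius_cvg : radius lam @[lam --> +oo] --> +oo.
Proof.
apply/cvgryPge => M; near=> lam.
have [] : [/\ 0 < lam, 0 < radius lam, ln lam <= radius lam ^+ 2,
    1 <= intensity_factor lam & intensity_factor lam <= 1 + 1].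
  by near: lam; exact: near_radius.
move=> lam0 r0 h _ _; have [M0|M0] := leP M 0; first exact: le_trans M0 (ltW r0).
have lM : expR (M ^+ 2) <= lam by near: lam; exact: nbhs_pinfty_ge.
rewrite -(@ler_pXn2r _ 2) ?nnegrE ?(ltW M0) ?(ltW r0)//; apply: le_trans h.
by rewrite -ler_expR lnK ?posrE.
Unshelve. all: by end_near. Qed.

Lemma intensity_factor_lower_cvg (C : R) :
  intensity_factor lam * expR (- (C ^+ 2 / (2 * radius lam ^+ 2))) @[lam --> +oo] --> (1 : R).
Proof.
rewrite -[X in _ --> X]mulr1; apply: cvgM; first exact: intensity_factor_cvg.
suff h : - (C ^+ 2 / (2 * radius lam ^+ 2)) @[lam --> +oo] --> (0 : R).
  by rewrite -[X in _ --> X]expR0; apply: continuous_cvg h; exact: continuous_expR.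
apply/cvgrPdist_le => e e0.
have hr (M : R) : \forall lam \near +oo, M <= radius lam.
  by move: M; apply/cvgryPge; exact: radius_cvg.
near=> lam.
have r1 : 1 <= radius lam by near: lam.
have rC : C ^+ 2 / e <= radius lam by near: lam.
have r0 : 0 < radius lam by exact: lt_le_trans r1.
rewrite sub0r opprK ger0_norm; last by rewrite divr_ge0 ?sqr_ge0// mulr_ge0// sqr_ge0.
rewrite ler_pdivrMr ?mulr_gt0 ?exprn_gt0//.
move: rC; rewrite ler_pdivrMr// => rC; apply: le_trans rC _.
rewrite mulrC ler_pM2l// expr2; nra.
Unshelve. all: by end_near. Qed.

End radius.

Section image_processes.
Context {R : realType} {n : nat}.
Local Notation E := ('rV[R]_n * R)%type.

Lemma locally_finite_image (T U : topologicalType) (f : T -> U) (g : U -> T) S :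
  cancel f g -> continuous g -> locally_finite S -> locally_finite (f @` S).
Proof.
move=> fK cg lfS K cK.
have cgK : compact (g @` K) by apply: continuous_compact => //; exact: continuous_subspaceT.
apply: sub_finite_set (finite_image f (lfS _ cgK)) => _ [[x Sx <-] Kx].
by exists x => //; split=> //; exists (f x).
Qed.

Lemma continuous_aff (r : R) : continuous (@aff R n r).
Proof.
apply: pair_continuous.
  apply: rV_continuous => i x; rewrite (_ : (fun x => _) = fun x : 'rV[R]_(n + 1) => x 0 (lshift 1 i)).
    exact: coord_continuous.
  by apply/funext => y; rewrite mxE.
apply: continuousM_fun; first exact: continuous_cst_fun.
apply: continuousD_fun; first exact: continuous_cst_fun.
apply: continuousN_fun.
have -> : @height R n = fun x : 'rV[R]_(n + 1) => x 0 (rshift n 0).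
  by apply/funext => y; rewrite /height mxE.
exact: coord_continuous.
Qed.

Lemma continuous_unaff (r : R) : continuous (@unaff R n r).
Proof.
apply: rV_continuous => i; case: (splitP i) => k ik.
  rewrite (_ : (fun p => _) = fun p : E => p.1 0 k); first exact: coord_fst_continuous.
  apply/funext => p; rewrite /unaff; have -> : i = lshift 1 k by exact/val_inj.
  by rewrite row_mxEl.
rewrite (_ : (fun p => _) = fun p : E => r + - (p.2 * r^-1)).
  apply: continuousD_fun; first exact: continuous_cst_fun.
  apply: continuousN_fun; apply: continuousM_fun; last exact: continuous_cst_fun.
  exact: coord_snd_continuous.
apply/funext => p; rewrite /unaff; have -> : i = rshift n k by exact/val_inj.
by rewrite row_mxEr (ord1 k) mxE eqxx mulr1n.
Qed.

Lemma gauss_intensity_ge0 lam (B : set 'rV[R]_(n + 1)) : 0 <= lam ->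
  (0 <= gauss_intensity lam B)%E.
Proof.
move=> l0; apply: integral_rV_ge0 => x.
by rewrite lee_fin mulr_ge0 ?indicE// mulr_ge0 ?std_normal_ge0.
Qed.

Lemma limit_intensity_ge0 (B : set E) : (0 <= limit_intensity B)%E.
Proof.
apply: integral_rV_ge0 => v; apply: integral_ge0 => h _.
by rewrite lee_fin mulr_ge0 ?expR_ge0 ?indicE.
Qed.

Lemma gauss_intensity_cell_le lam r q (j : cell_index q) : 0 <= lam -> 0 < r ->
  (gauss_intensity lam (aff r @^-1` (cell q j : set E)) <=
    (lam * @radial_density R n r * cell_mass j)%:E)%E.
Proof.
move=> l0 r0; rewrite cell_box; apply: gauss_intensity_box_le => //.
  by move=> i; exact: ltW (grid_lt _ _).
exact: grid_lt.
Qed.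

Lemma gauss_intensity_cell_ge lam r q (j : cell_index q) : 0 <= lam -> 0 < r ->
  ((lam * @radial_density R n r *
    expR (- ((`|grid q j.2 : R| + `|grid q j.2.+1|) ^+ 2 / (2 * r ^+ 2))) *
    cell_mass j)%:E <= gauss_intensity lam (aff r @^-1` (cell q j : set E)))%E.
Proof.
move=> l0 r0; rewrite cell_box; apply: gauss_intensity_box_ge => //.
- by move=> i; exact: ltW (grid_lt _ _).
- exact: grid_lt.
- by rewrite lerDl.
- by rewrite lerDr.
Qed.

Definition gauss_cell lam q (j : @cell_index n q) : R :=
  fine (gauss_intensity lam (aff (scaling_radius (n + 1) lam) @^-1` (cell q j : set E))).

Lemma prod_expR_sum (J : finType) (A : {set J}) (F : J -> R) :
  \prod_(j in A) expR (- F j) = expR (- \sum_(j in A) F j).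
Proof. by rewrite -sumrN expR_sum. Qed.

(** The intensity of a cell is squeezed between multiples of its limit by
    factors that tend to [1]. *)
Lemma poisson_family {d : R -> measure_display}
    {Omega : forall lam, measurableType (d lam)}
    (P : forall lam, probability (Omega lam) R)
    (xi : forall lam, Omega lam -> set 'rV[R]_(n + 1)) :
  (\forall lam \near +oo, poisson_process (P lam) (gauss_intensity lam) (xi lam)) ->
  asymptotically_poisson (@cell_mass R n) (pinfty_nbhs R) P
    (fun lam w => aff (scaling_radius (n + 1) lam) @` xi lam w).
Proof.
move=> hxi; have hr := @near_radius R n _ ltr01 (lexx _).
apply: (asymptotically_poissonI (c := @intensity_factor R n)).
- exact: intensity_factor_cvg.
- apply: filterS2 hxi hr => lam [[lfxi _] _ _] [_ r0 _ _ _] w.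
  apply: (locally_finite_image (g := @unaff R n (scaling_radius (n + 1) lam))) => //.
    by apply: affK; rewrite gt_eqF.
  exact: continuous_unaff.
- move=> q J.
  have h : \forall lam \near +oo,
      measurable (misses (fun w => aff (scaling_radius (n + 1) lam) @` xi lam w) J) /\
      pr (P lam) (misses (fun w => aff (scaling_radius (n + 1) lam) @` xi lam w) J) =
      \prod_(j in J) expR (- gauss_cell lam j).
    apply: filterS2 hxi hr => lam xiP [l0 r0 _ _ _].
    have [||||mJ eJ] := pr_poisson_misses_all xiP (@continuous_aff (scaling_radius (n + 1) lam))
      J (B := fun j => cell q j).
    + by move=> j; exact: borel_cell.
    + by move=> j j' p; exact: cell_inj.
    + by move=> j; exact: gauss_intensity_ge0 (ltW l0).
    + move=> j; apply: le_lt_trans (gauss_intensity_cell_le _ (ltW l0) r0) _.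
      exact: ltry.
    + by split; [exact: mJ|exact: eJ].
  split; first by apply: filterS h => lam [].
  apply: cvg_trans (_ : \prod_(j in J) expR (- gauss_cell lam j) @[lam --> +oo] --> _).
    by apply: near_eq_cvg; apply: filterS h => lam [_ ->].
  rewrite prod_expR_sum; under eq_cvg do rewrite prod_expR_sum.
  apply: continuous_cvg; first exact: continuous_expR.
  apply: cvgN; apply: cvg_finite_sum => j _.
  pose C : R := `|grid q j.2 : R| + `|grid q j.2.+1|.
  apply: (@squeeze_cvgr _ _ _ _
    (fun lam => @intensity_factor R n lam * expR (- (C ^+ 2 / (2 * scaling_radius (n + 1) lam ^+ 2))) * cell_mass j)
    (fun lam => @intensity_factor R n lam * cell_mass j)).
  + apply: filterS hr => lam [l0 r0 _ _ _].
    have le := gauss_intensity_cell_le j (ltW l0) r0.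
    have ge := gauss_intensity_cell_ge j (ltW l0) r0.
    have fin : gauss_intensity lam (aff (scaling_radius (n + 1) lam) @^-1` (cell q j : set E)) \is a fin_num.
      by rewrite ge0_fin_numE ?gauss_intensity_ge0 ?(ltW l0)//; exact: le_lt_trans le (ltry _).
    by rewrite -!lee_fin /gauss_cell fineK// ge le.
  + rewrite -[X in _ --> X]mul1r; apply: cvgM; last exact: cvg_cst.
    exact: intensity_factor_lower_cvg.
  + rewrite -[X in _ --> X]mul1r; apply: cvgM; last exact: cvg_cst.
    exact: intensity_factor_cvg.
- apply: filterS2 hxi hr => lam xiP [l0 r0 _ _ _] q j.
  have [|||D [mD PD hD]] := pr_poisson_double xiP (@continuous_aff (scaling_radius (n + 1) lam))
      (B := cell q j) (M := @intensity_factor R n lam * cell_mass j).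
  + exact: borel_cell.
  + exact: gauss_intensity_ge0 (ltW l0).
  + exact: gauss_intensity_cell_le (ltW l0) r0.
  by exists D; split=> // w nD p p' Zp Zp' jp jp'; exact: hD nD _ _ Zp Zp' jp jp'.
- apply: filterS2 hxi hr => lam xiP [l0 r0 _ _ _] B D.
  apply: (pr_poisson_hit xiP (@continuous_aff (scaling_radius (n + 1) lam))).
  + exact: borel_subgraph.
  + exact: gauss_intensity_ge0 (ltW l0).
  + exact: gauss_intensity_subgraph_le (ltW l0).
Qed.

(** Here the intensities are exact. *)
Lemma limit_family {d : measure_display} {Omega : measurableType d}
    (P : probability Omega R) (xi : Omega -> set E) :
  poisson_process P (@limit_intensity R n) xi ->
  asymptotically_poisson (@cell_mass R n) \oo (fun _ : nat => P)
    (fun _ w => shear @` xi w).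
Proof.
move=> xiP; have [[lfxi _] _ _] := xiP.
apply: (asymptotically_poissonI (c := fun=> 1)).
- exact: cvg_cst.
- exists 0%N => // k _ w; apply: (locally_finite_image (g := unshear)) => //.
    exact: shearK.
  exact: continuous_unshear.
- move=> q J; have [||||mJ eJ] := pr_poisson_misses_all xiP (@continuous_shear R n)
    J (B := fun j => cell q j).
  + by move=> j; exact: borel_cell.
  + by move=> j j' p; exact: cell_inj.
  + by move=> j; exact: limit_intensity_ge0.
  + by move=> j; rewrite limit_intensity_cell ltry.
  split; first by exists 0%N => // k _.
  rewrite /misses eJ (eq_bigr (fun j => expR (- cell_mass j))); last first.
    by move=> j _; rewrite limit_intensity_cell.
  exact: cvg_cst.
- exists 0%N => // k _ q j.
  have [|||D [mD PD hD]] := pr_poisson_double xiP (@continuous_shear R n)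
      (B := cell q j) (M := 1 * cell_mass j).
  + exact: borel_cell.
  + exact: limit_intensity_ge0.
  + by rewrite limit_intensity_cell mul1r.
  by exists D; split=> // w nD p p' Zp Zp' jp jp'; exact: hD nD _ _ Zp Zp' jp jp'.
- exists 0%N => // k _ B D; apply: (pr_poisson_hit xiP (@continuous_shear R n)).
  + exact: borel_subgraph.
  + exact: limit_intensity_ge0.
  + by rewrite limit_intensity_subgraph mul1r.
Qed.

End image_processes.

(** * Samples of independent Gaussian points *)

Section exponential_limit.
Context {R : realType}.

(** The lower bound is [exp (- s / (1 - s)) <= 1 - s], weakened. *)
Lemma one_minus_bounds (s : R) : 0 <= s -> s <= 2^-1 ->
  expR (- (s * (1 + 2 * s))) <= 1 - s <= expR (- s).
Proof.
move=> s0 s1; have h := expR_ge1Dx (- s); rewrite h andbT.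
have h2 := expR_ge1Dx (s * (1 + 2 * s)).
have p0 : 0 < 1 - s by lra.
rewrite expRN -[leRHS]invrK lef_pV2 ?posrE ?invr_gt0 ?expR_gt0//.
apply: le_trans h2; rewrite -[leLHS]mul1r ler_pdivrMr//; nra.
Qed.

Lemma expR_limit (s : nat -> R) (l : R) : (\forall m \near \oo, 0 <= s m) ->
  m%:R * s m @[m --> \oo] --> l -> (1 - s m) ^+ m @[m --> \oo] --> expR (- l).
Proof.
move=> s0 sl.
have inv0 : m.+1%:R^-1 @[m --> \oo] --> (0 : R) by exact: cvg_harmonic.
have scvg : s m @[m --> \oo] --> (0 : R).
  have sl' : m.+1%:R * s m.+1 @[m --> \oo] --> l.
    by have := sl; rewrite -(@cvg_shiftS _ (fun m => m%:R * s m)).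
  rewrite -(@cvg_shiftS _ s); have := cvgM inv0 sl'; rewrite mul0r => h.
  apply: cvg_trans (h _); apply: near_eq_cvg; exists 0%N => // m _ /=.
  by rewrite mulKf.
have s2 : \forall m \near \oo, s m <= 2^-1.
  by apply: (cvgr_le _ scvg); rewrite invr_gt0.
apply: (@squeeze_cvgr _ _ _ _ (fun m => expR (- ((m%:R * s m) * (1 + 2 * s m))))
  (fun m => expR (- (m%:R * s m)))).
- apply: filterS2 s0 s2 => m s0 s2; have /andP[h1 h2] := one_minus_bounds s0 s2.
  have p0 : 0 <= 1 - s m by exact: le_trans (expR_ge0 _) h1.
  rewrite -mulrA -!mulrN !expRM_natl; apply/andP; split.
    by rewrite mulrN lerXn2r ?nnegrE ?expR_ge0.
  by rewrite lerXn2r ?nnegrE ?expR_ge0.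
- rewrite -[l]mulr1; apply: continuous_cvg; first exact: continuous_expR.
  apply: cvgN; apply: cvgM => //.
  have h : 1 + 2 * s m @[m --> \oo] --> (1 + 2 * 0 : R).
    by apply: cvgD; [exact: cvg_cst|apply: cvgM => //; exact: cvg_cst].
  by move: h; rewrite mulr0 addr0.
- by apply: continuous_cvg; [exact: continuous_expR|exact: cvgN].
Qed.

End exponential_limit.

Section samples.
Context {R : realType} {n : nat}.
Local Notation E := ('rV[R]_n * R)%type.
Context {d : measure_display} {Omega : measurableType d} {P : probability Omega R}.
Context {X : nat -> Omega -> 'rV[R]_(n + 1)}.
Hypothesis hX : iid_std_normal P X.

Definition sample (m : nat) (w : Omega) : set 'rV[R]_(n + 1) := [set X i w | i in `I_m].

Lemma measurable_sample_point i B : borel B -> measurable (X i @^-1` B).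
Proof. by have [h _ _] := hX; exact: h. Qed.

Let p (B : set 'rV[R]_(n + 1)) : R := fine (gauss_intensity 1 B).

Let lawE i B : borel B -> P (X i @^-1` B) = gauss_intensity 1 B.
Proof.
have [_ h _] := hX => bB; rewrite h//; apply: eq_integral_rV => x.
by rewrite mul1r.
Qed.

Let pr_point i B : borel B -> pr P (X i @^-1` B) = p B.
Proof. by move=> bB; rewrite /pr lawE. Qed.

Let p_ge0 B : 0 <= p B.
Proof. by apply: fine_ge0; exact: gauss_intensity_ge0. Qed.

Let indep (m : nat) (B : 'I_m -> set 'rV[R]_(n + 1)) : (forall i, borel (B i)) ->
  pr P (\bigcap_(i : 'I_m) (X i @^-1` B i)) = \prod_(i < m) p (B i).
Proof.
have [_ _ h] := hX => bB; rewrite /pr h//.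
rewrite (eq_bigr (fun i => (p (B i))%:E)) ?prodEFin// => i _.
by rewrite -(pr_point i (bB i)) -prE//; exact: measurable_sample_point.
Qed.

Lemma pr_sample_misses m B : borel B ->
  measurable [set w | sample m w `&` B = set0] /\
  pr P [set w | sample m w `&` B = set0] = (1 - p B) ^+ m.
Proof.
move=> bB; have mC : measurable (X 0 @^-1` B) by exact: measurable_sample_point.
have e : [set w | sample m w `&` B = set0] =
    \bigcap_(i : 'I_m) (X i @^-1` (~` B)).
  apply/seteqP; split=> w h.
    move=> i _ Bi; have : (sample m w `&` B) (X i w) by split=> //; exists (val i) => //=.
    by rewrite h.
  by apply/seteqP; split=> // _ [[i im <-]]; exact: (h (Ordinal im) I).
split.
  rewrite e; apply: fin_bigcap_measurable => // i _.
  by apply: measurable_sample_point; exact: borelC.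
rewrite e indep; last by move=> i; exact: borelC.
rewrite prodr_const card_ord -(pr_point 0 (borelC bB)) -(pr_point 0 bB).
by rewrite -preimage_setC prC.
Qed.

(** Independence is given for initial segments of the sequence; the other
    coordinates are left free. *)
Lemma pr_sample_pair a b B : borel B -> a != b ->
  pr P (X a @^-1` B `&` X b @^-1` B) = p B ^+ 2.
Proof.
move=> bB ab; pose M := (maxn a b).+1.
have aM : (a < M)%N by rewrite ltnS leq_maxl.
have bM : (b < M)%N by rewrite ltnS leq_maxr.
pose B' (i : 'I_M) := if (val i == a) || (val i == b) then B else setT.
have bB' i : borel (B' i) by rewrite /B'; case: ifP => // _; exact: borel_open openT.
have := indep bB'.
have -> : \bigcap_(i : 'I_M) (X i @^-1` B' i) = X a @^-1` B `&` X b @^-1` B.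
  apply/seteqP; split=> w.
    move=> h; have := h (Ordinal aM) I; have := h (Ordinal bM) I.
    by rewrite /B' /= !eqxx orbT.
  by move=> [h1 h2] i _; rewrite /B' /=; case: ifP => // /orP[/eqP->|/eqP->].
move=> ->; rewrite (bigD1 (Ordinal aM))//= (bigD1 (Ordinal bM))/=; last first.
  by apply/eqP => -[] /eqP; rewrite eq_sym (negPf ab).
rewrite big1; first by rewrite /B' /= !eqxx orbT mulr1 expr2.
move=> i /andP[ia ib]; rewrite /B'.
have -> : (val i == a) = false by apply/negbTE; apply: contraNneq ia => h; apply/eqP/val_inj.
have -> : (val i == b) = false by apply/negbTE; apply: contraNneq ib => h; apply/eqP/val_inj.
rewrite /= -(pr_point 0 (borel_open openT)).
by rewrite preimage_setT prT.
Qed.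

Lemma pr_exists_disjoint (I : eqType) (r : seq I) (F : I -> set Omega) : uniq r ->
  (forall i, measurable (F i)) -> (forall i i' w, F i w -> F i' w -> i = i') ->
  pr P [set w | exists2 i, i \in r & F i w] = \sum_(i <- r) pr P (F i).
Proof.
move=> + mF dF; elim: r => [_|i r IH /= /andP[ir ur]].
  by rewrite big_nil (_ : mkset _ = set0) ?pr0//; apply/seteqP; split=> w // -[].
rewrite big_cons -IH// -prU_disjoint//.
- congr pr; apply/seteqP; split=> w.
    move=> [k]; rewrite inE => /orP[/eqP->|kr] Fk; first by left.
    by right; exists k.
  move=> [Fi|[k kr Fk]]; first by exists i; rewrite ?inE ?eqxx.
  by exists k; rewrite ?inE ?kr ?orbT.
- exact: measurable_exists_seq.
- apply/seteqP; split=> // w [Fi [k kr Fk]].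
  by move: ir; rewrite (dF _ _ _ Fi Fk) kr.
Qed.

Variable f : 'rV[R]_(n + 1) -> E.
Hypothesis cf : continuous f.

Let bf (B : set E) : borel B -> borel (f @^-1` B).
Proof. exact: borel_continuous. Qed.

Lemma pr_sample_misses_all (J : finType) (A : {set J}) (B : J -> set E) m :
  (forall j, borel (B j)) -> (forall j j' q, B j q -> B j' q -> j = j') ->
  measurable [set w | forall j, j \in A -> f @` sample m w `&` B j = set0] /\
  pr P [set w | forall j, j \in A -> f @` sample m w `&` B j = set0] =
  (1 - \sum_(j in A) p (f @^-1` B j)) ^+ m.
Proof.
move=> bB dB; pose U := [set x | exists2 j, j \in enum A & B j (f x)].
have bU : borel U.
  rewrite /U; elim: (enum A) => [|j r IH].
    by rewrite (_ : mkset _ = set0); [exact: borel0|apply/seteqP; split=> x // -[]].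
  rewrite (_ : mkset _ = f @^-1` B j `|` [set x | exists2 j, j \in r & B j (f x)]).
    by apply: borelU => //; exact: bf.
  apply/seteqP; split=> x.
    move=> [k]; rewrite inE => /orP[/eqP->|kr] Fk; first by left.
    by right; exists k.
  move=> [Fi|[k kr Fk]]; first by exists j; rewrite ?inE ?eqxx.
  by exists k; rewrite ?inE ?kr ?orbT.
have e : [set w | forall j, j \in A -> f @` sample m w `&` B j = set0] =
    [set w | sample m w `&` U = set0].
  apply/seteqP; split=> w h.
    apply/seteqP; split=> // x [sx [j jA Bx]]; rewrite mem_enum in jA.
    have : (f @` sample m w `&` B j) (f x) by split=> //; exists x.
    by rewrite h.
  move=> j jA; apply/seteqP; split=> // _ [[x sx <-] Bx].
  have : (sample m w `&` U) x by split=> //; exists j; rewrite ?mem_enum.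
  by rewrite h.
rewrite e; have [mU ->] := pr_sample_misses m bU; split=> //; congr (_ ^+ _).
rewrite -(pr_point 0 bU); congr (_ - _).
rewrite -(big_enum _ _ _ _) /=; transitivity (\sum_(j <- enum A) pr P (X 0 @^-1` (f @^-1` B j))).
  rewrite -pr_exists_disjoint ?enum_uniq//.
  - by move=> j; apply: measurable_sample_point; exact: bf.
  - by move=> j j' w; exact: dB.
by apply: eq_bigr => j _; rewrite pr_point//; exact: bf.
Qed.

Lemma pr_sample_hit m B (M : R) : borel B -> m%:R * p (f @^-1` B) <= M ->
  exists D, [/\ measurable D, (P D <= M%:E)%E &
    forall w, ~ D w -> f @` sample m w `&` B = set0].
Proof.
move=> bB hM; pose F i := X i @^-1` (f @^-1` B).
have mF i : measurable (F i) by apply: measurable_sample_point; exact: bf.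
exists [set w | exists2 i, i \in iota 0 m & F i w]; split.
- exact: measurable_exists_seq.
- rewrite prE; last exact: measurable_exists_seq.
  rewrite lee_fin; apply: le_trans (pr_exists_seq P (iota 0 m) mF) _.
  apply: le_trans hM; rewrite (eq_bigr (fun=> p (f @^-1` B))).
    by rewrite big_const_seq count_predT size_iota iter_addr_0 mulr_natl.
  by move=> i _; rewrite pr_point//; exact: bf.
- move=> w nD; apply/seteqP; split=> // _ [[_ [i im <-] <-] Bx].
  by apply: nD; exists i; rewrite ?mem_iota.
Qed.

(** A union bound over the ordered pairs of indices. *)
Lemma pr_sample_double m B (M : R) : borel B -> m%:R * p (f @^-1` B) <= M ->
  exists D, [/\ measurable D, (P D <= (M ^+ 2)%:E)%E &
    forall w, ~ D w -> forall q q', (f @` sample m w) q -> (f @` sample m w) q' ->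
      B q -> B q' -> q' = q].
Proof.
move=> bB hM; pose B' := f @^-1` B.
pose F (ab : nat * nat) := if ab.1 == ab.2 then set0 else X ab.1 @^-1` B' `&` X ab.2 @^-1` B'.
have mF ab : measurable (F ab).
  by rewrite /F; case: ifP => // _; apply: measurableI; apply: measurable_sample_point; exact: bf.
pose r := [seq (a, b) | a <- iota 0 m, b <- iota 0 m].
exists [set w | exists2 ab, ab \in r & F ab w]; split.
- exact: measurable_exists_seq.
- rewrite prE; last exact: measurable_exists_seq.
  rewrite lee_fin; apply: le_trans (pr_exists_seq P r mF) _.
  apply: (@le_trans _ _ (\sum_(ab <- r) p B' ^+ 2)).
    apply: ler_sum => -[a b] _; rewrite /F /=; case: eqVneq => ab.
      by rewrite pr0 sqr_ge0.
    by rewrite pr_sample_pair//; exact: bf.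
  rewrite big_const_seq count_predT iter_addr_0 size_allpairs size_iota.
  rewrite -mulr_natl natrM -expr2 -exprMn lerXn2r ?nnegrE ?mulr_ge0//.
  by apply: le_trans hM; rewrite mulr_ge0.
- move=> w nD _ _ [_ [a am <-] <-] [_ [b bm <-] <-] Ba Bb.
  have [->//|ab] := eqVneq a b; case: nD; exists (a, b).
    by apply/allpairsP; exists (a, b); rewrite /= !mem_iota.
  by rewrite /F /= (negPf ab).
Qed.

(** Two sample points are compared through a rational number that separates a
    coordinate. *)
Lemma measurable_sample_eq i j : measurable [set w | X i w = X j w].
Proof.
pose F (k : 'I_(n + 1)) (q : rat) := [set x : 'rV[R]_(n + 1) | x 0 k < ratr q].
pose G (k : 'I_(n + 1)) (q : rat) := [set x : 'rV[R]_(n + 1) | ratr q < x 0 k].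
have bF k q : borel (F k q).
  apply: borel_open; apply: open_lt_fun; last exact: continuous_cst_fun.
  by move=> x; exact: coord_continuous.
have bG k q : borel (G k q).
  apply: borel_open; apply: open_lt_fun; first exact: continuous_cst_fun.
  by move=> x; exact: coord_continuous.
pose D a b (kq : 'I_(n + 1) * rat) := X a @^-1` F kq.1 kq.2 `&` X b @^-1` G kq.1 kq.2.
have mD a b kq : measurable (D a b kq).
  by apply: measurableI; exact: measurable_sample_point.
have sep a b w k : X a w 0 k < X b w 0 k -> (\bigcup_kq D a b kq) w.
  move=> h; have [q] := rat_in_itvoo h; rewrite in_itv /= => /andP[h1 h2].
  by exists (k, q).
rewrite (_ : mkset _ = ~` (\bigcup_kq D i j kq `|` \bigcup_kq D j i kq)).
  apply: measurableC; apply: measurableU; apply: countable_bigcupT_measurable => //;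
    exact: countableP.
apply/seteqP; split=> w /=.
  move=> e [[[k q] _ [h1 h2]]|[[k q] _ [h1 h2]]]; rewrite /F /G /= e in h1 h2;
    by have := lt_trans h1 h2; rewrite ltxx.
move=> /not_orP[h1 h2]; apply/rowP => k; apply/eqP; rewrite eq_le !leNgt.
by apply/andP; split; apply/negP => /sep.
Qed.

Lemma random_sample m : random_set (sample m).
Proof.
have hit B : borel B -> measurable [set w | sample m w `&` B !=set0].
  move=> bB; have [mB _] := pr_sample_misses m bB.
  rewrite (_ : mkset _ = ~` [set w | sample m w `&` B = set0]); first exact: measurableC.
  apply/seteqP; split=> w /=; first by move=> /set0P/eqP.
  by move=> h; apply/set0P/eqP.
split=> // [w|B bB].
  by move=> K _; apply: finite_setIl; apply: finite_image; exact: finite_II.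
pose F (ab : nat * nat) := ~` (X ab.1 @^-1` B `&` X ab.2 @^-1` B) `|`
  [set w | X ab.1 w = X ab.2 w].
have mF ab : measurable (F ab).
  apply: measurableU; last exact: measurable_sample_eq.
  by apply: measurableC; apply: measurableI; exact: measurable_sample_point.
pose r := [seq (a, b) | a <- iota 0 m, b <- iota 0 m].
rewrite (_ : mkset _ = [set w | sample m w `&` B !=set0] `&`
    [set w | forall ab, ab \in r -> F ab w]).
  by apply: measurableI; [exact: hit|exact: measurable_forall_seq].
apply/seteqP; split=> w.
  move=> [x hx]; split; first by exists x; rewrite hx.
  move=> [a b] /allpairsP[[a' b'] [/= ai bi [-> ->]]]; rewrite !mem_iota /= in ai bi.
  have [[Ba Bb]|nB] := pselect ((X a' @^-1` B `&` X b' @^-1` B) w); last by left.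
  right; have : [set x] (X a' w) by rewrite -hx; split=> //; exists a'.
  have : [set x] (X b' w) by rewrite -hx; split=> //; exists b'.
  by move=> /= -> ->.
move=> [[_ [[a am <-] Ba]] h]; exists (X a w); apply/seteqP; split=> [_ [[b bm <-] Bb]|_ ->].
  have [|[]|//] := h (b, a); last by split.
  by apply/allpairsP; exists (b, a); rewrite /= !mem_iota.
by split=> //; exists a.
Qed.

End samples.

Section binomial_family.
Context {R : realType} {n : nat}.
Local Notation E := ('rV[R]_n * R)%type.
Context {d : measure_display} {Omega : measurableType d} {P : probability Omega R}.
Context {X : nat -> Omega -> 'rV[R]_(n + 1)}.
Hypothesis hX : iid_std_normal P X.

Local Notation radius := (@scaling_radius R (n + 1)).

Let near_nat (Q : R -> Prop) : (\forall lam \near +oo, Q lam) ->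
  \forall m \near \oo, Q m%:R.
Proof. by move=> h; exact: (cvgr_idn h). Qed.

Let cvg_nat (f : R -> R) (l : R) : f lam @[lam --> +oo] --> l ->
  f m%:R @[m --> \oo] --> l.
Proof. by move=> h; exact: (cvg_comp _ _ cvgr_idn h). Qed.

(** The number of points is deterministic, so empty cells have probability
    [(1 - s) ^ m], with [m * s] tending to the sum of the limit masses. *)
Lemma binomial_family :
  asymptotically_poisson (@cell_mass R n) \oo (fun _ : nat => P)
    (fun m w => aff (radius m%:R) @` sample (X := X) m w).
Proof.
have hr := near_nat (@near_radius R n _ ltr01 (lexx _)).
have up m (B : set 'rV[R]_(n + 1)) (M : R) : 0 < m%:R :> R -> 0 <= M ->
    (gauss_intensity 1 B <= (1 * @radial_density R n (radius m%:R) * M)%:E)%E ->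
    m%:R * fine (gauss_intensity 1 B) <= @intensity_factor R n m%:R * M.
  move=> m0 M0 h; rewrite /intensity_factor -mulrA ler_pM2l// -lee_fin fineK.
    by rewrite mul1r in h.
  by rewrite ge0_fin_numE ?gauss_intensity_ge0//; exact: le_lt_trans h (ltry _).
have lfs m w : locally_finite (sample (X := X) m w) by have [] := random_sample hX m.
apply: (asymptotically_poissonI (c := fun m => @intensity_factor R n m%:R)).
- exact: cvg_nat (@intensity_factor_cvg R n).
- apply: filterS hr => m [_ r0 _ _ _] w.
  apply: (locally_finite_image (g := @unaff R n (radius m%:R))) => //.
    by apply: affK; rewrite gt_eqF.
  exact: continuous_unaff.
- move=> q J.
  have h m : measurable (misses (fun w => aff (radius m%:R) @` sample (X := X) m w) J) /\
      pr P (misses (fun w => aff (radius m%:R) @` sample (X := X) m w) J) =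
      (1 - \sum_(j in J) fine (gauss_intensity 1 (aff (radius m%:R) @^-1` (cell q j : set E)))) ^+ m.
    apply: (pr_sample_misses_all hX (@continuous_aff R n (radius m%:R)) J (B := fun j => cell q j)).
      by move=> j; exact: borel_cell.
    by move=> j j' p; exact: cell_inj.
  split; first by exists 0%N => // m _; have [] := h m.
  rewrite (_ : (fun m => _) = fun m => (1 - \sum_(j in J)
    fine (gauss_intensity 1 (aff (radius m%:R) @^-1` (cell q j : set E)))) ^+ m); last first.
    by apply/funext => m; have [] := h m.
  rewrite prod_expR_sum; apply: expR_limit.
    by exists 0%N => // m _; apply: sumr_ge0 => j _; apply: fine_ge0; exact: gauss_intensity_ge0.
  rewrite (_ : (fun m => _) = fun m => \sum_(j in J) (m%:R *
    fine (gauss_intensity 1 (aff (radius m%:R) @^-1` (cell q j : set E))))); last first.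
    by apply/funext => m; rewrite mulr_sumr.
  apply: cvg_finite_sum => j _; pose C : R := `|grid q j.2 : R| + `|grid q j.2.+1|.
  apply: (@squeeze_cvgr _ _ _ _
    (fun m => @intensity_factor R n m%:R * expR (- (C ^+ 2 / (2 * radius m%:R ^+ 2))) * cell_mass j)
    (fun m => @intensity_factor R n m%:R * cell_mass j)).
  + apply: filterS hr => m [m0 r0 _ _ _].
    have le := gauss_intensity_cell_le j ler01 r0.
    have ge := gauss_intensity_cell_ge j ler01 r0.
    rewrite up ?(ltW (cell_mass_gt0 _))// andbT /intensity_factor -!mulrA ler_pM2l//.
    rewrite -lee_fin fineK; first by rewrite mul1r -!mulrA in ge.
    by rewrite ge0_fin_numE ?gauss_intensity_ge0//; exact: le_lt_trans le (ltry _).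
  + rewrite -[X in _ --> X]mul1r; apply: cvgM; last exact: cvg_cst.
    exact: (cvg_nat (intensity_factor_lower_cvg C)).
  + rewrite -[X in _ --> X]mul1r; apply: cvgM; last exact: cvg_cst.
    exact: cvg_nat (@intensity_factor_cvg R n).
- apply: filterS hr => m [m0 r0 _ _ _] q j.
  have [||D [mD PD hD]] := pr_sample_double hX (@continuous_aff R n (radius m%:R)) (m := m)
      (B := cell q j) (M := @intensity_factor R n m%:R * cell_mass j).
  + exact: borel_cell.
  + by apply: up => //; [exact: ltW (cell_mass_gt0 _)|exact: gauss_intensity_cell_le].
  by exists D; split=> // w nD p p' Zp Zp' jp jp'; exact: hD nD _ _ Zp Zp' jp jp'.
- apply: filterS hr => m [m0 r0 _ _ _] B D.
  apply: (pr_sample_hit hX (@continuous_aff R n (radius m%:R))).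
  + exact: borel_subgraph.
  + apply: up => //; last exact: gauss_intensity_subgraph_le.
    rewrite mulr_ge0 ?expR_ge0// exprn_ge0// fine_ge0// integral_ge0// => t _.
    by rewrite lee_fin expR_ge0.
Qed.

End binomial_family.

(** * The limit process is in general position *)

Section ambiguous_cells.
Context {R : realType} {n : nat}.
Local Notation E := ('rV[R]_n * R)%type.

(** A weakly exposed point with bounded coordinates and bounded slope that is
    not strictly exposed: its height is determined by the other points. *)
Definition touching (M L : nat) (S : set E) (x : E) : Prop :=
  [/\ S x, `|x| <= L%:R, ~ strictly_exposed S x &
    exists2 a : 'rV[R]_n, `|a| <= M%:R &
      forall y, S y -> x.2 + dotr a (y.1 - x.1) <= y.2].

Definition cone_slope (M L : nat) : nat := (M + L + n * M * L)%N.

(** The cells [j] for which the code [C] of the other points allows a touching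
    point in [j]. *)
Definition ambiguous M L q (C : {set @cell_index n q}) (j : @cell_index n q) : Prop :=
  exists S x, [/\ touching M L S x, cell q j x, code q (S `\ x) = C &
    S `&` far (cone_slope M L) q = set0].

Lemma in_cone_bounded A q (y : E) : (1 < q.+1)%N ->
  A%:R * (1 + n%:R) < q.+1%:R :> R -> cone A y -> ~ far A q y ->
  `|y| < q.+1%:R ^+ 2.
Proof.
move=> q1 qA cy nf; have Q1 : 1 < q.+1%:R :> R by rewrite ltr1n.
have h1 : `|y.1| <= q.+1%:R.
  by rewrite leNgt; apply/negP => h; apply: nf; split=> //; left.
have h2 : - q.+1%:R <= y.2.
  by rewrite leNgt; apply/negP => h; apply: nf; split=> //; right.
have h3 : l1norm y.1 <= n%:R * q.+1%:R.
  by apply: le_trans (l1norm_norm _) _; rewrite ler_wpM2l.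
have A0 : 0 <= A%:R :> R by [].
have n0 : 0 <= n%:R :> R by [].
apply: (@le_lt_trans _ _ (Num.max q.+1%:R (A%:R * (1 + n%:R) * q.+1%:R))); last first.
  rewrite gt_max; apply/andP; split; first by rewrite expr2 ltr_pMl// (lt_trans ltr01).
  by rewrite expr2 ltr_pM2r// (lt_trans ltr01).
apply: normr_pair_le; first by rewrite le_max h1.
rewrite ler_norml; apply/andP; split.
  by apply: le_trans h2; rewrite lerN2 le_max lexx.
rewrite le_max; apply/orP; right; apply: le_trans cy _.
rewrite -mulrA ler_wpM2l//; move: h3 Q1 n0; move: (l1norm _) (q.+1%:R : R) (n%:R : R).
by move=> l Q N; nra.
Qed.

(** Within a column of cells, a code of the other points leaves only boundedly
    many cells for the touching point: two such points see nearly the same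
    supporting hyperplane. *)
Lemma ambiguous_spread M L : \forall q \near \oo,
  forall (C : {set @cell_index n q}) f k k', ambiguous M L C (f, k) ->
  ambiguous M L C (f, k') -> (k <= k' + (2 * n * M + 1))%N.
Proof.
pose A := cone_slope M L.
near=> q.
have q1 : (1 < q.+1)%N.
  by rewrite -(ltr_nat R); near: q; exact: near_natS_gt.
have qA : A%:R * (1 + n%:R) < q.+1%:R :> R by near: q; exact: near_natS_gt.
move=> C f k k' [S1 [x1 [[Sx1 x1L _ [a aM ha]] [jx1 kx1] C1 _]]].
move=> [S2 [x2 [[Sx2 x2L ns _] [jx2 kx2] C2 F2]]].
have Q0 : 0 < q.+1%:R :> R by [].
have [dq dqE] : exists dq : R, dq = q.+1%:R^-1 by exists q.+1%:R^-1.
have dq0 : 0 < dq by rewrite dqE invr_gt0.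
have al1 : l1norm a <= n%:R * M%:R.
  by apply: le_trans (l1norm_norm _) _; rewrite ler_wpM2l.
have nM0 : 0 <= n%:R * M%:R :> R by rewrite mulr_ge0.
have [y [Sy [yx hy]]] : exists y, S2 y /\ y <> x2 /\ y.2 - x2.2 <= dotr a (y.1 - x2.1).
  apply: contra_notP ns => /forallNP h; split=> //; exists a => y Sy yx.
  by rewrite ltNge; apply/negP => hy; exact: (h y).
have low : x1.2 + dotr a (y.1 - x1.1) - (n%:R * M%:R + 1) * dq <= y.2.
  have [cy|cy] := pselect (cone A y); last first.
    have h : A%:R * (1 + l1norm y.1) < y.2 by rewrite ltNge; exact/negP.
    apply: le_trans (ltW h).
    have h1 : dotr a y.1 <= M%:R * l1norm y.1.
      rewrite dotrC; apply: le_trans (ler_norm _) _; apply: le_trans (dotr_l1 _ _) _.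
      by rewrite mulrC ler_wpM2r// l1norm_ge0.
    have h2 : - (n%:R * M%:R * L%:R) <= dotr a x1.1.
      by apply: dotr_l1_ge => //; exact: le_trans (normr_fst _) x1L.
    have h3 : x1.2 <= L%:R by exact: le_trans (ler_norm _) (le_trans (normr_snd _) x1L).
    have h4 := l1norm_ge0 y.1.
    have h5 : 0 <= (n%:R * M%:R + 1) * dq by rewrite mulr_ge0 ?addr_ge0// ltW.
    have h6 : 0 <= n%:R * M%:R * L%:R :> R by rewrite mulr_ge0.
    have L0 : 0 <= L%:R :> R by [].
    have M0 : 0 <= M%:R :> R by [].
    have h7 : 0 <= (L%:R + n%:R * M%:R * L%:R) * l1norm y.1 by rewrite mulr_ge0 ?addr_ge0.
    rewrite /A /cone_slope !(natrD, natrM) dotrBr.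
    move: h1 h2 h3 h4 h5 h6 h7 L0 M0; move: (n%:R * M%:R * L%:R) ((_ + 1) * dq) (dotr a y.1) (dotr a x1.1).
    move: (l1norm y.1) x1.2 (L%:R : R) (M%:R : R) => l u v w c1 c2 c3 c4 *; nra.
  have nf : ~ far A q y by move=> fy; have : (S2 `&` far A q) y by []; rewrite F2.
  have yq := in_cone_bounded q1 qA cy nf.
  have C21 : code q (S2 `\ x2) = code q (S1 `\ x1) by rewrite C1 C2.
  have [y' [Sy' _] [j jy jy']] := code_companion C21 (conj Sy yx) yq.
  have dy := cell_dist jy jy'; rewrite -dqE in dy.
  have h1 := ha y' Sy'.
  have h2 : dotr a (y.1 - y'.1) <= n%:R * M%:R * dq.
    by apply: dotr_l1_le => //; exact: le_trans (normr_fst (y - y')) dy.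
  have : `|y.2 - y'.2| <= dq by exact: le_trans (normr_snd (y - y')) dy.
  rewrite ler_norml => /andP[h3 _].
  move: h1 h2 h3; rewrite !dotrBr mulrDl mul1r; move: (n%:R * M%:R * dq) (dq) y.2 y'.2 x1.2.
  by move: (dotr a y.1) (dotr a y'.1) (dotr a x1.1) => *; lra.
have dx : `|x2.1 - x1.1| <= dq.
  apply: normr_rV_le => [|i]; first exact: ltW.
  by rewrite !mxE dqE; exact: icell_dist (jx2 i) (jx1 i).
have h := dotr_l1_ge al1 dx.
have main : x1.2 <= x2.2 + (2 * (n%:R * M%:R) + 1) * dq.
  move: h low hy; rewrite !dotrBr !mulrDl !mul1r -mulrA; move: (n%:R * M%:R * dq) (dq) y.2 x2.2 x1.2.
  by move: (dotr a y.1) (dotr a x2.1) (dotr a x1.1) => *; lra.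
move: kx1 kx2; rewrite /icell /= => /andP[k1 _] /andP[_ k2].
rewrite -ltnS -(ltr_nat R); apply: le_lt_trans k1 _.
rewrite -addSn natrD; apply: le_lt_trans (_ : _ <= q.+1%:R * x2.2 + q.+1%:R ^+ 3 + (2 * (n%:R * M%:R) + 1)) _; last first.
  by rewrite !(natrD, natrM) -mulrA ltrD2r.
have : q.+1%:R * x1.2 <= q.+1%:R * (x2.2 + (2 * (n%:R * M%:R) + 1) * dq) by rewrite ler_pM2l.
rewrite mulrDr dqE mulrCA divff// mulr1 => h'; rewrite addrAC lerD2r.
exact: h'.
Unshelve. all: by end_near. Qed.

Lemma card_spread (N K : nat) (A : {set 'I_N}) :
  (forall k k' : 'I_N, k \in A -> k' \in A -> (k <= k' + K)%N) -> (#|A| <= K.+1)%N.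
Proof.
move=> h; have [->|[k0 k0A]] := set_0Vmem A; first by rewrite cards0.
pose m := [arg min_(k < k0 in A) (k : nat)].
have [mA mmin] : m \in A /\ forall k, k \in A -> (m <= k)%N.
  by rewrite /m; case: arg_minnP.
rewrite cardE -(size_map val) -(size_iota m K.+1); apply: uniq_leq_size.
  by rewrite map_inj_uniq ?enum_uniq//; exact: val_inj.
move=> _ /mapP[k + ->]; rewrite mem_enum mem_iota => kA.
by rewrite mmin//= addnS ltnS h.
Qed.

(** Discrete form of Mecke's formula: adding a cell to the code multiplies its
    probability by nearly the mass of the cell. *)
Lemma code_mass_setU1 q (C : {set @cell_index n q}) j : j \notin C ->
  code_mass (@cell_mass R n) (j |: C) =
  (expR (cell_mass j) - 1) * code_mass (@cell_mass R n) C.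
Proof.
move=> jC; rewrite /code_mass (bigD1 j)//= [in RHS](bigD1 j)//= (negPf jC) setU11.
rewrite mulrA; congr (_ * _).
  by rewrite mulrBl mul1r -expRD subrr expR0.
by apply: eq_bigr => k kj; rewrite in_setU1 (negPf kj).
Qed.

End ambiguous_cells.

Section almost_sure.
Context {R : realType} {n : nat}.
Local Notation E := ('rV[R]_n * R)%type.
Context {d : measure_display} {Omega : measurableType d} {P : probability Omega R}.
Variable Z : Omega -> set E.
Hypothesis aZ : asymptotically_poisson (@cell_mass R n) \oo (fun _ : nat => P) (fun _ => Z).

Lemma negligible_small (A : set Omega) :
  (forall e : R, 0 < e -> exists D, [/\ measurable D, (P D <= e%:E)%E & A `<=` D]) ->
  P.-negligible A.
Proof.
move=> h; have /choice[D hD] : forall k : nat, exists D,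
    [/\ measurable D, (P D <= (k.+1%:R^-1)%:E)%E & A `<=` D] by move=> k; exact: h.
have mD : measurable (\bigcap_k D k).
  by apply: bigcapT_measurable => k; have [] := hD k.
exists (\bigcap_k D k); split=> //; last by move=> w Aw k _; have [_ _] := hD k; exact.
apply/eqP; rewrite eq_le measure_ge0 andbT prE// lee_fin leNgt; apply/negP => p0.
have [k hk] := filter_ex (near_inv_lt p0).
have [mk Pk _] := hD k; have := pr_le_bound mk Pk.
have : pr P (\bigcap_k D k) <= pr P (D k) by apply: pr_le => // w; exact.
by move=> h1 h2; have := lt_le_trans hk (le_trans h1 h2); rewrite ltxx.
Qed.

Let lfZ w : locally_finite (Z w).
Proof. by have [h _ _ _] := aZ; have [k] := filter_ex h; exact. Qed.

Let far_empty A (e : R) : 0 < e -> \forall q \near \oo,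
  exists D, [/\ measurable D, (P D <= e%:E)%E & forall w, ~ D w -> Z w `&` far A q = set0].
Proof.
by move=> e0; have [_ _ _ h] := aZ; apply: filterS (h A e e0) => q /filter_ex[].
Qed.

Let no_doubles A (e : R) : 0 < e -> \forall q \near \oo,
  exists D, [/\ measurable D, (P D <= e%:E)%E & forall w, ~ D w -> no_double A q (Z w)].
Proof.
by move=> e0; have [_ _ h _] := aZ; apply: filterS (h A e e0) => q /filter_ex[].
Qed.

Lemma finite_cone_ae A : P.-negligible [set w | ~ finite_set (Z w `&` cone A)].
Proof.
apply: negligible_small => e e0.
have q1 : \forall q \near \oo, (1 < q.+1)%N by exists 1%N.
have qA := near_natS_gt (A%:R * (1 + n%:R) : R).
have [q [q1' [qA' [D [mD PD hD]]]]] := filter_ex (filterI q1 (filterI qA (far_empty A e0))).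
exists D; split=> // w nf; apply: contrapT => Dw; apply: nf.
have F := hD w Dw.
apply: sub_finite_set (lfZ w (@compact_pair_ball R n (q.+1%:R ^+ 2))) => y [Zy cy].
split=> //; apply: ltW; apply: (in_cone_bounded q1' qA' cy) => fy.
by have : (Z w `&` far A q) y by []; rewrite F.
Qed.

Let touching_bound M L q : R :=
  (2 * L * q.+1 + 1)%:R ^+ n * (2 * n * M + 2)%:R * (2 * expR (L%:R + 1) / q.+1%:R ^+ n.+1).

Let near_touching_bound M L (e : R) : 0 < e -> \forall q \near \oo, touching_bound M L q <= e.
Proof.
move=> e0; pose D : R := (2 * L + 1)%:R ^+ n * (2 * n * M + 2)%:R * (2 * expR (L%:R + 1)).
have D0 : 0 <= D by rewrite !mulr_ge0 ?expR_ge0 ?exprn_ge0.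
have h : \forall q \near \oo, q.+1%:R^-1 < e / (D + 1).
  by apply: near_inv_lt; rewrite divr_gt0// ltr_wpDl.
apply: filterS h => q hq; set Q : R := q.+1%:R in hq *.
have Q0 : 0 < Q by rewrite /Q.
have hc : (2 * L * q.+1 + 1)%:R ^+ n <= (2 * L + 1)%:R ^+ n * Q ^+ n :> R.
  rewrite -exprMn -natrM -!natrX ler_nat; case: (n) => // n'.
  by rewrite leq_exp2r// mulnDl mul1n leq_add2l.
apply: (@le_trans _ _ (D / Q)).
  have -> : D / Q = (2 * L + 1)%:R ^+ n * Q ^+ n * (2 * n * M + 2)%:R *
      (2 * expR (L%:R + 1) / Q ^+ n.+1).
    rewrite /D exprS; field; rewrite expf_neq0 ?gt_eqF//.
  rewrite /touching_bound ler_wpM2r ?divr_ge0 ?mulr_ge0 ?expR_ge0 ?exprn_ge0//.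
  by rewrite ler_wpM2r.
move: hq; rewrite ltr_pdivlMr ?ltr_wpDl// => hq.
have y0 : 0 < Q^-1 by rewrite invr_gt0.
by move: (Q^-1) hq y0 => y hq y0; nra.
Qed.

Hypothesis code_law : forall q (C : {set @cell_index n q}),
  measurable (code_event Z C) /\ pr P (code_event Z C) = code_mass (@cell_mass R n) C.

(** Off small events a touching point is alone in its cell, which is then
    ambiguous for the code of the other points. By independence the expected
    number of such cells is a sum over columns near the origin, of order
    [q ^ n], of boundedly many masses of order [q ^- n.+1]. *)
Lemma touching_ae M L : P.-negligible [set w | exists x, touching M L (Z w) x].
Proof.
apply: negligible_small => e e0.
have e3 : 0 < e / 3 by rewrite divr_gt0.
have qL := near_natS_sqr_gt (L%:R : R).
have hm : \forall q \near \oo, forall j : @cell_index n q, j.2 \in near_index L q ->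
    expR (cell_mass j : R) - 1 <= 2 * (expR (L%:R + 1) / q.+1%:R ^+ n.+1).
  have e2 : 0 < (2 * expR (L%:R + 1))^-1 :> R by rewrite invr_gt0 mulr_gt0 ?expR_gt0.
  apply: filterS (near_inv_lt e2) => q hq j jL.
  have m0 : 0 < cell_mass j :> R by exact: cell_mass_gt0.
  have mle : (cell_mass j : R) <= expR (L%:R + 1) / q.+1%:R ^+ n.+1 := cell_mass_le jL.
  have half : expR (L%:R + 1) / q.+1%:R ^+ n.+1 <= 2^-1 :> R.
    apply: (@le_trans _ _ (expR (L%:R + 1) * q.+1%:R^-1)).
      rewrite ler_pM2l ?expR_gt0// lef_pV2 ?posrE ?exprn_gt0// exprS ler_peMr//.
      by rewrite exprn_ege1// ler1n.
    move: hq; rewrite invfM => hq; apply: ltW.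
    by rewrite -ltr_pdivlMl ?expR_gt0// mulrC.
  have := expR_ge1Dx (- cell_mass j : R); rewrite expRN => h.
  have x0 := expR_gt0 (cell_mass j : R).
  have : (1 - cell_mass j) * expR (cell_mass j) <= 1 :> R.
    by rewrite -ler_pdivlMr// mul1r.
  move: half mle m0 x0; move: (expR _ / _) (cell_mass j) => u v.
  by move: (expR v) => x *; nra.
(* Off [D1] there are no nearby double points, off [D2] no far points, and off
   [D3] no occupied cell is ambiguous for the rest of the code. *)
have [q [[sp bq] [[qL' hm'] [[D1 [mD1 PD1 hD1]] [D2 [mD2 PD2 hD2]]]]]] := filter_ex
  (filterI (filterI (@ambiguous_spread R n M L) (near_touching_bound M L e3))
  (filterI (filterI qL hm) (filterI (no_doubles L e3) (far_empty (@cone_slope n M L) e3)))).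
pose cond (jC : cell_index q * {set @cell_index n q}) : bool :=
  [&& jC.1 \in near_cells L q, jC.1 \notin jC.2 & `[< ambiguous (R := R) M L jC.2 jC.1 >]].
pose r := [seq jC <- enum {: cell_index q * {set @cell_index n q}} | cond jC].
pose F (jC : cell_index q * {set @cell_index n q}) : set Omega := code_event Z (jC.1 |: jC.2).
have mF jC : measurable (F jC) by have [] := code_law (jC.1 |: jC.2).
pose D3 := [set w | exists2 jC, jC \in r & F jC w].
have mD3 : measurable D3 by exact: measurable_exists_seq.
have PD3 : pr P D3 <= e / 3.
  apply: le_trans bq; apply: le_trans (pr_exists_seq P r mF) _.
  rewrite big_filter big_enum_cond /=.
  pose tau : R := 2 * expR (L%:R + 1) / q.+1%:R ^+ n.+1.
  have tau0 : 0 <= tau by rewrite divr_ge0 ?mulr_ge0 ?expR_ge0 ?exprn_ge0.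
  have cm0 (C : {set @cell_index n q}) : 0 <= code_mass (@cell_mass R n) C.
    by have [_ <-] := code_law C; exact: pr_ge0.
  have cm1 : \sum_(C : {set @cell_index n q}) code_mass (@cell_mass R n) C <= 1.
    rewrite (eq_bigr (fun C => pr P (code_event Z C))); last first.
      by move=> C _; have [_ ->] := code_law C.
    rewrite -big_enum -(pr_exists_disjoint (P := P)) ?enum_uniq//.
    - apply: pr_le1; apply: measurable_exists_seq => C; by have [] := code_law C.
    - by move=> C; have [] := code_law C.
    - by move=> C C' w; rewrite /code_event /= => -> ->.
  apply: (@le_trans _ _ (\sum_(jC | cond jC) tau * code_mass (@cell_mass R n) jC.2)).
    apply: ler_sum => -[j C] /and3P[/= jn jC _].
    rewrite /F /=; have [_ ->] := code_law (j |: C); rewrite code_mass_setU1//.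
    rewrite ler_wpM2r//; apply: le_trans (hm' j _) _; last by rewrite mulrA.
    by move: jn; case: (j) => f k; rewrite finset.in_setX => /andP[].
  rewrite (eq_bigl (fun jC => xpredT jC.1 && cond (jC.1, jC.2))); last by case.
  rewrite -(pair_big_dep xpredT (fun j C => cond (j, C))
    (fun j C => tau * code_mass (@cell_mass R n) C)) /=.
  rewrite (exchange_big_dep xpredT)//=.
  apply: (@le_trans _ _ (\sum_(C : {set @cell_index n q})
      touching_bound M L q * code_mass (@cell_mass R n) C)); last first.
    have tb0 : 0 <= touching_bound M L q.
      by rewrite /touching_bound -/tau; apply: mulr_ge0 => //; rewrite mulr_ge0 ?exprn_ge0.
    by rewrite -mulr_sumr ler_piMr.
  apply: ler_sum => C _; rewrite -mulr_suml ler_wpM2r//.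
  pose cf (f : {ffun 'I_n -> 'I_(2 * q.+1 ^ 3)}) k := cond ((f, k), C).
  rewrite (eq_bigl (fun j : cell_index q => xpredT j.1 && cf j.1 j.2)); last by case.
  rewrite -(pair_big_dep xpredT cf (fun _ _ => tau)) /=.
  have cfn f k : cf f k -> f \in near_columns L q.
    by move=> /and3P[/=]; rewrite finset.in_setX => /andP[].
  rewrite (bigID (mem (near_columns L q))) /= [X in _ + X]big1 ?addr0; last first.
    by move=> f fn; rewrite big_pred0// => k; apply/negbTE; apply: contra fn; exact: cfn.
  apply: (@le_trans _ _ (\sum_(f in near_columns L q) (2 * n * M + 2)%:R * tau)).
    apply: ler_sum => f _; rewrite sumr_const -[tau *+ _]mulr_natl ler_wpM2r// ler_nat.
    rewrite -cardsE (_ : (2 * n * M + 2 = (2 * n * M + 1).+1)%N); last by rewrite addnS.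
    apply: card_spread => k k'.
    rewrite !inE => /and3P[_ _ /asboolP a1] /and3P[_ _ /asboolP a2].
    exact: sp a1 a2.
  rewrite sumr_const -[_ *+ #|_|]mulr_natl /touching_bound -mulrA ler_wpM2r//.
    by rewrite mulr_ge0.
  by rewrite -natrX ler_nat card_near_columns.
exists (D1 `|` D2 `|` D3); split.
- by apply: measurableU => //; exact: measurableU.
- have m12 : measurable (D1 `|` D2) by exact: measurableU.
  rewrite prE; last exact: measurableU.
  rewrite lee_fin; apply: le_trans (prU P m12 mD3) _.
  have := prU P mD1 mD2; have := pr_le_bound mD1 PD1; have := pr_le_bound mD2 PD2.
  by move: PD3; lra.
- move=> w [x tx]; apply: contrapT => /not_orP[/not_orP[n1 n2] n3]; apply: n3.
  have [Zx xL _ _] := tx.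
  have [j jx] := cell_cover (le_lt_trans xL qL').
  have jn : j \notin code q (Z w `\ x).
    apply/negP => /in_code[y [Zy yx] jy]; apply: yx.
    exact: (hD1 w n1 j x y Zx Zy jx jy xL).
  exists (j, code q (Z w `\ x)).
    rewrite mem_filter mem_enum andbT /cond /= jn (near_cellsP jx xL) /=.
    by apply/asboolP; exists (Z w), x; split=> //; exact: hD2.
  rewrite /F /code_event /=; apply/setP => k; rewrite in_setU1; apply/idP/idP.
    move=> /in_code[y Zy ky]; have [->|kj] := eqVneq k j; first by [].
    apply/in_code; exists y => //; split=> // yx; move/eqP: kj; apply.
    by apply: cell_inj ky _; rewrite yx.
  move=> /orP[/eqP->|/in_code[y [Zy _] ky]]; apply/in_code; first by exists x.
  by exists y.
Qed.

End almost_sure.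

Section general_position.
Context {R : realType} {n : nat}.
Local Notation E := ('rV[R]_n * R)%type.
Context {d : measure_display} {Omega : measurableType d} {P : probability Omega R}.
Variable xi : Omega -> set E.
Hypothesis xiP : poisson_process P (@limit_intensity R n) xi.

Let Z w : set E := shear @` xi w.

Let aZ : asymptotically_poisson (@cell_mass R n) \oo (fun _ : nat => P) (fun _ => Z).
Proof. exact: limit_family xiP. Qed.

(** A box over the unit cube at distance [B] in the orthant [s], of height [N]. *)
Let column (s : 'I_n -> bool) (B N : nat) : set E :=
  box (fun i => if s i then - (B.+1%:R) else B%:R)
      (fun i => if s i then - B%:R else B.+1%:R) B%:R (B%:R + N.+1%:R).

(** The limit intensity of a column is infinite. *)
Lemma column_ae (s : 'I_n -> bool) (B : nat) : P.-negligible [set w |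
  ~ exists2 y, Z w y & (forall i, B%:R <= (-1) ^+ s i * y.1 0 i) /\ B%:R <= y.2].
Proof.
pose a i : R := if s i then - (B.+1%:R) else B%:R.
pose b i : R := if s i then - B%:R else B.+1%:R.
have ab i : a i < b i.
  by rewrite /a /b; case: (s i); rewrite ?ltrN2 ltr_nat.
pose g := \prod_i gauss_mass (a i) (b i).
have g0 : 0 < g by apply: prodr_gt0 => i _; exact: gauss_mass_gt0.
apply: negligible_small => e e0.
have [N hN] := filter_ex (near_natS_gt ((g * e)^-1)).
have bN : borel (column s B N).
  rewrite /column /box; apply: borelI.
    apply: borel_forall => i; set l := (if s i then _ else _); set u := (if s i then _ else _).
    set D := (X in borel X).
    have -> : D = [set p : E | l <= p.1 0 i] `&` [set p : E | p.1 0 i < u].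
      by apply/seteqP; split=> p; rewrite /D /=; [move=> /andP[]|move=> [-> ->]].
    apply: borelI; first apply: borel_closed; last apply: borel_open.
      by apply: closed_le_fun; [exact: continuous_cst_fun|exact: coord_fst_continuous].
    by apply: open_lt_fun; [exact: coord_fst_continuous|exact: continuous_cst_fun].
  set D := (X in borel X).
  have -> : D = [set p : E | B%:R <= p.2] `&` [set p : E | p.2 < B%:R + N.+1%:R].
    by apply/seteqP; split=> p; rewrite /D /=; [move=> /andP[]|move=> [-> ->]].
  apply: borelI; first apply: borel_closed; last apply: borel_open.
    by apply: closed_le_fun; [exact: continuous_cst_fun|exact: coord_snd_continuous].
  by apply: open_lt_fun; [exact: coord_snd_continuous|exact: continuous_cst_fun].
have mu : limit_intensity (shear @^-1` column s B N) =
    ((expR (B%:R + N.+1%:R) - expR B%:R) * g)%:E.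
  by apply: limit_intensity_box => [i|]; [exact: ltW (ab i)|rewrite ltrDl].
have cs : continuous (@shear R n) by exact: continuous_shear.
have mD := measurable_poisson_misses xiP cs bN.
exists [set w | Z w `&` column s B N = set0]; split=> //.
  rewrite prE// lee_fin (pr_poisson_misses xiP cs bN) ?limit_intensity_ge0 ?mu ?ltry//=.
  have h1 : N.+1%:R <= expR (B%:R + N.+1%:R) - expR B%:R :> R.
    rewrite expRD; have := expR_ge1Dx (N.+1%:R : R).
    have : 1 <= expR B%:R :> R by rewrite -[leLHS]expR0 ler_expR.
    have : 0 <= N.+1%:R :> R by [].
    by generalize (expR B%:R : R) (expR N.+1%:R : R) (N.+1%:R : R) => x y z; nra.
  apply: (@le_trans _ _ (expR (- (N.+1%:R * g)))).
    by rewrite ler_expR lerN2 ler_pM2r.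
  rewrite expRN; have h2 := expR_ge1Dx (N.+1%:R * g).
  move: hN; rewrite invfM -[_ * _]mulrC ltr_pdivrMl// => h3.
  rewrite -[leRHS]invrK lef_pV2 ?posrE ?invr_gt0 ?expR_gt0//.
  have h4 : 1 < g * (e * N.+1%:R) by rewrite -ltr_pdivrMl// mulr1.
  apply: le_trans h2; rewrite -[leLHS]mul1r ler_pdivrMr//.
  by move: h4 e0; move: (N.+1%:R : R) => x; nra.
move=> w nh; apply/seteqP; split=> // y [Zy [h1 /andP[h2 _]]].
apply: nh; exists y => //; split=> // i; have := h1 i.
case: (s i) => /andP[h3 h4]; first by rewrite expr1 mulN1r lerNr ltW.
by rewrite expr0 mul1r.
Qed.

Lemma negligible_exists (T : countType) (F : T -> set Omega) :
  (forall t, P.-negligible (F t)) -> P.-negligible [set w | exists t, F t w].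
Proof.
move=> nF; pose G k := if unpickle k is Some t then F t else set0.
have nG k : P.-negligible (G k).
  rewrite /G; case: unpickle => [t|]; first exact: nF.
  by exists set0; split=> //; exact: measure0.
apply: negligibleS (negligible_bigcup nG) => w [t Ft].
by exists (pickle t) => //; rewrite /G pickleK.
Qed.

(** With points in every orthant, supporting hyperplanes are not vertical. *)
Lemma weakly_exposed_slope (S : set E) x :
  (forall (s : 'I_n -> bool) (B : nat), exists2 y, S y &
    (forall i, B%:R <= (-1) ^+ s i * y.1 0 i) /\ B%:R <= y.2) ->
  weakly_exposed S x ->
  exists a : 'rV[R]_n, forall y, S y -> x.2 + dotr a (y.1 - x.1) <= y.2.
Proof.
move=> orth [Sx [c c0 hc]].
have c2 : 0 < c.2.
  rewrite ltNge; apply/negP => c2.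
  pose tau : R := l1norm c.1 + `|c.2|.
  have tau0 : 0 < tau.
    rewrite lt_neqAle eq_sym addr_ge0 ?l1norm_ge0// andbT; apply: contra c0.
    rewrite paddr_eq0 ?l1norm_ge0// normr_eq0 => /andP[/eqP h1 /eqP h2].
    apply/eqP; rewrite [c]surjective_pairing h2; congr pair; apply/rowP => i.
    rewrite mxE; apply/eqP; rewrite -normr_le0 -h1 /l1norm (bigD1 i)//= lerDl.
    exact: sumr_ge0.
  pose B := (Num.truncn (`|pairing c x| / tau)).+1.
  have hB : `|pairing c x| < B%:R * tau by rewrite -ltr_pdivrMr// truncnS_gt.
  have [y Sy [hy1 hy2]] := orth (fun i => 0 < c.1 0 i) B.
  have h1 : dotr c.1 y.1 <= - (B%:R * l1norm c.1).
    rewrite /dotr /l1norm mulr_sumr -sumrN; apply: ler_sum => i _.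
    have := hy1 i; case: ltP => ci; rewrite ?expr1 ?expr0 ?mulN1r ?mul1r => h.
      by rewrite (gtr0_norm ci); nra.
    by rewrite (ler0_norm ci); nra.
  have h2 : c.2 * y.2 <= - (B%:R * `|c.2|) by rewrite (ler0_norm c2); nra.
  have := hc y Sy; rewrite {2}/pairing; move: hB; rewrite /tau mulrDr.
  have := ler_norm (- pairing c x); rewrite normrN; move: h1 h2.
  by move: (`|pairing c x|) (pairing c x) (dotr c.1 y.1) (B%:R * l1norm c.1) (B%:R * `|c.2|) (c.2 * y.2) => *; lra.
exists (- c.2^-1 *: c.1) => y Sy; have := hc y Sy.
rewrite /pairing dotrZl dotrBr mulNr -lerBrDl => h.
rewrite -(ler_pM2l c2) mulrDr mulrN mulrA divff ?gt_eqF// mul1r.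
by move: h; move: (dotr _ _) (dotr _ _) (c.2 * _) (c.2 * _) => *; lra.
Qed.

(** The exceptional set is a countable union over the parameters of the previous
    lemmas. *)
Lemma nice_ae : P.-negligible [set w | ~ nice (Z w)].
Proof.
have law q C := limit_code_event aZ (q := q) C.
have lfZ w : locally_finite (Z w).
  by have [h _ _ _] := aZ; have [k] := filter_ex h; exact.
have n1 := negligible_exists (finite_cone_ae aZ).
have n2 := negligible_exists (T := ({ffun 'I_n -> bool} * nat)%type)
  (fun sB => column_ae sB.1 sB.2).
have n3 := negligible_exists (T := (nat * nat)%type)
  (fun ML => touching_ae aZ law ML.1 ML.2).
apply: negligibleS (negligibleU (negligibleU n1 n2) n3) => w nn.
apply: contrapT => /not_orP[/not_orP[/forallNP h1 /forallNP h2] /forallNP h3]; apply: nn.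
have orth (s : 'I_n -> bool) (B : nat) : exists2 y, Z w y &
    (forall i, B%:R <= (-1) ^+ s i * y.1 0 i) /\ B%:R <= y.2.
  have := h2 (finfun s, B) => /= /contrapT[y Zy [hy1 hy2]]; exists y => //; split=> // i.
  by have := hy1 i; rewrite ffunE.
split=> //; first by move=> A; have := h1 A; move=> /contrapT.
move=> x wx; have [a ha] := weakly_exposed_slope orth wx; apply: contrapT => ns.
pose M := (Num.truncn `|a|).+1; pose L := (Num.truncn `|x|).+1.
apply: (h3 (M, L)); exists x; split=> //=; first by case: wx.
  by apply: ltW; exact: truncnS_gt.
by exists a => //; apply: ltW; exact: truncnS_gt.
Qed.

End general_position.

(** * The exponential map of the sphere *)

Section trigonometric_bounds.
Context {R : realType}.
Implicit Types t : R.

Lemma derive_ge0 (f df : R -> R) : (forall x, is_derive x (1 : R) f (df x)) ->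
  (forall x, 0 <= x -> 0 <= df x) -> f 0 = 0 -> forall t, 0 <= t -> 0 <= f t.
Proof.
move=> hf hdf f0 t; rewrite le_eqVlt => /orP[/eqP<-|t0]; first by rewrite f0.
have cf : {within `[0, t], continuous f}.
  apply: continuous_subspaceT => x; apply: differentiable_continuous.
  by apply/derivable1_diffP; exact: (@ex_derive _ _ _ _ _ _ _ (hf x)).
have [c + h] := MVT_segment (ltW t0) (fun x _ => hf x) cf.
rewrite in_itv /= => /andP[c0 _]; move: h; rewrite f0 !subr0 => ->.
by rewrite mulr_ge0 ?hdf// ltW.
Qed.

Lemma sin_le_id t : 0 <= t -> sin t <= t.
Proof.
have d1 (x : R) : is_derive x (1 : R) (fun t => t - sin t) (1 - cos x).
  by apply: is_derive_eq.
have d2 (x : R) : 0 <= x -> 0 <= 1 - cos x.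
  by move=> _; rewrite subr_ge0 cos_le1.
move=> t0; rewrite -subr_ge0; apply: (derive_ge0 d1 d2) => //.
by rewrite sin0 subr0.
Qed.

Lemma cos_ge t : 0 <= t -> 1 - t ^+ 2 / 2 <= cos t.
Proof.
have d1 (x : R) : is_derive x (1 : R) (fun t => cos t - (1 - t ^+ 2 / 2)) (x - sin x).
  by apply: is_derive_eq; rewrite /GRing.scale /=; field.
have d2 (x : R) : 0 <= x -> 0 <= x - sin x.
  by move=> x0; rewrite subr_ge0 sin_le_id.
move=> t0; rewrite -subr_ge0; apply: (derive_ge0 d1 d2) => //.
by rewrite cos0 expr0n /= mul0r subr0 subrr.
Qed.

Lemma sin_ge t : 0 <= t -> t - t ^+ 3 / 6 <= sin t.
Proof.
have d1 (x : R) : is_derive x (1 : R) (fun t => sin t - (t - t ^+ 3 / 6)) (cos x - (1 - x ^+ 2 / 2)).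
  by apply: is_derive_eq; rewrite /GRing.scale /=; field.
have d2 (x : R) : 0 <= x -> 0 <= cos x - (1 - x ^+ 2 / 2).
  by move=> x0; rewrite subr_ge0 cos_ge.
move=> t0; rewrite -subr_ge0; apply: (derive_ge0 d1 d2) => //.
by rewrite sin0 expr0n /= mul0r !subr0.
Qed.

Lemma cos_le t : 0 <= t -> cos t <= 1 - t ^+ 2 / 2 + t ^+ 4 / 24.
Proof.
have d1 (x : R) : is_derive x (1 : R) (fun t => 1 - t ^+ 2 / 2 + t ^+ 4 / 24 - cos t) (sin x - (x - x ^+ 3 / 6)).
  by apply: is_derive_eq; rewrite /GRing.scale /=; field.
have d2 (x : R) : 0 <= x -> 0 <= sin x - (x - x ^+ 3 / 6).
  by move=> x0; rewrite subr_ge0 sin_ge.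
move=> t0; rewrite -subr_ge0; apply: (derive_ge0 d1 d2) => //.
by rewrite cos0 !expr0n /= !mul0r subr0 addr0 subrr.
Qed.

Definition sinc t : R := if t == 0 then 1 else sin t / t.

Lemma sincM t : sinc t * t = sin t.
Proof.
rewrite /sinc; case: eqVneq => [->|t0]; first by rewrite sin0 mulr0.
by rewrite divfK.
Qed.

Lemma sinc_bounds t : 0 <= t -> 1 - t ^+ 2 / 6 <= sinc t <= 1.
Proof.
move=> t0; rewrite /sinc; case: eqVneq => [->|tn].
  by rewrite expr0n /= mul0r subr0 lexx.
have tp : 0 < t by rewrite lt_neqAle eq_sym tn.
rewrite ler_pdivlMr// ler_pdivrMr// mul1r sin_le_id// andbT.
by apply: le_trans (sin_ge t0); rewrite le_eqVlt; apply/orP; left; apply/eqP; field.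
Qed.

Lemma continuous_sinc : continuous sinc.
Proof.
move=> t; have [->|t0] := eqVneq t 0.
  have e : sinc 0 = 1 by rewrite /sinc eqxx.
  apply/cvgrPdist_le => e' e'0; rewrite e.
  have m0 : 0 < Num.min e' 1 by rewrite lt_min e'0 ltr01.
  have hn : \forall x \near (0 : R), `|x| <= Num.min e' 1 by exact: nbhs0_le.
  apply: filterS hn => x; rewrite le_min => /andP[xe x1].
  have ev : sinc x = sinc `|x|.
    rewrite /sinc normr_eq0; case: eqP => // _; case: (ger0P x) => // _.
    by rewrite sinN invrN mulrNN.
  rewrite ev; have := sinc_bounds (normr_ge0 x); have := normr_ge0 x.
  move: (`|x|) xe x1 => y ye y1 y0 /andP[h1 h2]; rewrite ger0_norm ?subr_ge0//.
  nra.
apply: cvg_trans (_ : (sin x / x) @[x --> t] --> _).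
  have tp : 0 < `|t| by rewrite normr_gt0.
  have hn : \forall x \near t, `|t - x| < `|t| by have := nbhsx_ballx t `|t| tp; rewrite -ball_normE.
  apply: near_eq_cvg; apply: filterS hn => x hx; rewrite /sinc ifF//; apply/negbTE.
  by apply: contraTneq hx => ->; rewrite subr0 ltxx.
rewrite /sinc (negPf t0); apply: cvgM; first exact: continuous_sin.
exact: cvgV t0 cvg_id.
Qed.

Lemma sinc_gt0 t : 0 <= t < pi -> 0 < sinc t.
Proof.
move=> /andP[t0 tp]; rewrite /sinc; case: eqVneq => [//|tn].
have tq : 0 < t by rewrite lt_neqAle eq_sym tn.
by rewrite divr_gt0// sin_gt0_pi// tq.
Qed.

End trigonometric_bounds.

Section exponential_map.
Context {R : realType} {n : nat}.
Local Notation E := ('rV[R]_n * R)%type.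
Implicit Types (v w : 'rV[R]_n) (u x : 'rV[R]_(n + 1)).

Lemma enorm_sqrt (m : nat) (y : 'rV[R]_m) : enorm y = Num.sqrt (dotr y y).
Proof. by rewrite -enormE sqrtr_sqr ger0_norm ?enorm_ge0. Qed.

Lemma enormZ (m : nat) (a : R) (y : 'rV[R]_m) : enorm (a *: y) = `|a| * enorm y.
Proof.
by rewrite !enorm_sqrt dotrZl dotrZr mulrA -expr2 sqrtrM ?sqr_ge0// sqrtr_sqr.
Qed.

Lemma enorm_eq0 (m : nat) (y : 'rV[R]_m) : enorm y = 0 -> y = 0.
Proof.
move=> y0; apply: contrapT => /eqP /dotr_gt0; rewrite -enormE y0 expr0n.
by rewrite ltxx.
Qed.

Lemma enorm0 (m : nat) : enorm (0 : 'rV[R]_m) = 0.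
Proof. by rewrite -(scale0r 0) enormZ normr0 mul0r. Qed.

Lemma exp_mapE v : exp_map v = row_mx (sinc (enorm v) *: v) (cos (enorm v))%:M.
Proof.
rewrite /exp_map; case: eqVneq => [->|v0].
  by rewrite enorm0 scaler0 cos0.
have e0 : enorm v != 0 by apply: contra_neq v0 => /enorm_eq0.
rewrite /north !scale_row_mx add_row_mx !scaler0 add0r addr0 scalerA scalemx1.
by rewrite /sinc (negPf e0).
Qed.

Lemma continuous_enorm (m : nat) : continuous (@enorm R m).
Proof.
move=> y; rewrite (_ : @enorm R m = fun y => Num.sqrt (dotr y y)); last first.
  by apply/funext => z; exact: enorm_sqrt.
apply: (@continuous_comp _ _ _ (fun y : 'rV[R]_m => dotr y y) Num.sqrt).
  by apply: continuous_dotr => z; exact: cvg_id.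
exact: sqrt_continuous.
Qed.

Lemma continuous_row_mx (T : topologicalType) (f : T -> 'rV[R]_n) (g : T -> R) :
  continuous f -> continuous g ->
  continuous (fun t => row_mx (f t) (g t)%:M : 'rV[R]_(n + 1)).
Proof.
move=> cf cg; apply: rV_continuous => i; case: (splitP i) => k ik.
  rewrite (_ : (fun t => _) = fun t => f t 0 k).
    by move=> t; apply: (@continuous_comp _ _ _ f (fun v : 'rV[R]_n => v 0 k));
      [exact: cf|exact: coord_continuous].
  by apply/funext => t; have -> : i = lshift 1 k; [exact/val_inj|rewrite row_mxEl].
rewrite (_ : (fun t => _) = g)//; apply/funext => t.
have -> : i = rshift n k by exact/val_inj.
by rewrite row_mxEr (ord1 k) mxE eqxx mulr1n.
Qed.

Lemma continuous_scale_fun (m : nat) (T : topologicalType) (f : T -> R) (g : T -> 'rV[R]_m) :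
  continuous f -> continuous g -> continuous (fun t => f t *: g t).
Proof.
move=> cf cg; apply: rV_continuous => i.
rewrite (_ : (fun t => _) = fun t => f t * g t 0 i); last first.
  by apply/funext => t; rewrite mxE.
apply: continuousM_fun => // t.
by apply: (@continuous_comp _ _ _ g (fun v : 'rV[R]_m => v 0 i));
  [exact: cg|exact: coord_continuous].
Qed.

Lemma continuous_exp_map : continuous (@exp_map R n).
Proof.
rewrite (_ : @exp_map R n = fun v => row_mx (sinc (enorm v) *: v) (cos (enorm v))%:M); last first.
  by apply/funext => v; exact: exp_mapE.
have ce := @continuous_enorm n.
apply: continuous_row_mx.
  apply: continuous_scale_fun => v; last exact: cvg_id.
  by apply: (continuous_comp (ce v)); exact: continuous_sinc.
by move=> v; apply: (continuous_comp (ce v)); exact: continuous_cos.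
Qed.

Lemma enorm_split x : enorm x ^+ 2 = enorm (lsubmx x) ^+ 2 + height x ^+ 2.
Proof. by rewrite !enormE dotr_split -expr2. Qed.

Lemma height_exp_map v : height (exp_map v) = cos (enorm v).
Proof. by rewrite exp_mapE /height row_mxKr mxE eqxx mulr1n. Qed.

Lemma lsubmx_exp_map v : lsubmx (exp_map v) = sinc (enorm v) *: v.
Proof. by rewrite exp_mapE row_mxKl. Qed.

Lemma split_eq x y : lsubmx x = lsubmx y -> height x = height y :> R -> x = y :> 'rV[R]_(n + 1).
Proof.
move=> h1 h2; rewrite -[x]hsubmxK -[y]hsubmxK h1; congr row_mx.
by apply/rowP => i; rewrite (ord1 i).
Qed.

Lemma enorm_exp_map v : enorm (exp_map v) = 1.
Proof.
apply/eqP; rewrite -(@eqrXn2 _ 2)// ?enorm_ge0//; apply/eqP.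
rewrite enorm_split height_exp_map lsubmx_exp_map enormZ exprMn real_normK ?num_real//.
by rewrite -exprMn sincM addrC cos2Dsin2 expr1n.
Qed.

(** The angle is the arc cosine of the last coordinate. *)
Lemma exp_map_surjective u : enorm u = 1 -> u != - north n ->
  exists2 v, enorm v < pi & exp_map v = u.
Proof.
move=> u1 un; have := enorm_split u; rewrite u1 expr1n => h.
set s := enorm (lsubmx u) in h *; set z := height u in h *.
have s0 : 0 <= s by exact: enorm_ge0.
have z1 : -1 <= z <= 1 by apply/andP; split; nra.
have [sz|sn] := eqVneq s 0.
  have l0 := enorm_eq0 sz.
  have h' : z ^+ 2 = 1 by rewrite [RHS]h sz expr0n add0r.
  have : (z - 1) * (z + 1) = 0 by transitivity (z ^+ 2 - 1); [ring|rewrite h' subrr].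
  move=> /eqP; rewrite mulf_eq0 subr_eq0 addr_eq0 => /orP[/eqP zz|/eqP zz].
    exists 0; first by rewrite enorm0 pi_gt0.
    apply: split_eq; first by rewrite lsubmx_exp_map scaler0 l0.
    by rewrite height_exp_map enorm0 cos0 -zz.
  case/eqP: un; apply: split_eq; rewrite /north.
    by rewrite l0 linearN /= row_mxKl oppr0.
  by rewrite -/z zz /height linearN /= row_mxKr !mxE eqxx.
have sp : 0 < s by rewrite lt_neqAle eq_sym sn.
have zlt : -1 < z < 1 by apply/andP; split; nra.
have [zl zr] := andP zlt.
have t0 : 0 < acos z by apply: acos_gt0; rewrite (ltW zl) zr.
have tpi : acos z < pi by apply: acos_ltpi; rewrite zl (ltW zr).
have ev : enorm ((acos z / s) *: lsubmx u) = acos z.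
  by rewrite enormZ ger0_norm ?divr_ge0 ?(ltW t0)// -/s divfK.
exists ((acos z / s) *: lsubmx u); first by rewrite ev.
apply: split_eq.
  rewrite lsubmx_exp_map ev scalerA mulrA sincM sin_acos//.
  have -> : 1 - z ^+ 2 = s ^+ 2 by rewrite h addrK.
  by rewrite sqrtr_sqr ger0_norm// divff// scale1r.
by rewrite height_exp_map ev acosK// in_itv /= z1.
Qed.

(** The last coordinate gives the norm, the others the direction. *)
Lemma exp_map_inj v w : enorm v < pi -> enorm w < pi -> exp_map v = exp_map w -> v = w.
Proof.
move=> vp wp e; have vw : enorm v = enorm w.
  apply: cos_inj; rewrite ?in_itv /= ?enorm_ge0 ?(ltW vp) ?(ltW wp)//.
  by rewrite -!height_exp_map e.
have := lsubmx_exp_map v; rewrite e lsubmx_exp_map -vw => h.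
have s0 : sinc (enorm v) != 0 by rewrite gt_eqF// sinc_gt0// enorm_ge0.
exact: esym (scalerI s0 h).
Qed.

Definition pole : 'rV[R]_n := \row_(i < n) (if i.+1 == n then pi else 0).

Hypothesis n0 : (0 < n)%N.

Lemma enorm_pole : enorm pole = pi.
Proof.
rewrite /enorm (_ : \sum_i _ = pi ^+ 2); first by rewrite sqrtr_sqr ger0_norm ?pi_ge0.
have nl : (n.-1 < n)%N by rewrite prednK.
rewrite (bigD1 (Ordinal nl))//= mxE /= prednK// eqxx big1 ?addr0// => i ni.
rewrite mxE; case: eqP => [e|_]; last by rewrite expr0n.
by case/eqP: ni; apply/val_inj; exact: (congr1 predn e).
Qed.

Lemma exp_map_pole : exp_map pole = - north n.
Proof.
apply: split_eq.
  rewrite lsubmx_exp_map enorm_pole /sinc gt_eqF ?pi_gt0// sinpi mul0r scale0r.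
  by rewrite /north linearN /= row_mxKl oppr0.
by rewrite height_exp_map enorm_pole cospi /height linearN /= row_mxKr !mxE eqxx.
Qed.

Lemma exp_map_invP u : enorm u = 1 ->
  exp_map (exp_map_inv u) = u /\
  (enorm (exp_map_inv u) < pi \/ exp_map_inv u = pole).
Proof.
move=> u1; rewrite /exp_map_inv; case: eqVneq => [->|un].
  by split; [exact: exp_map_pole|right].
have [v v1 v2] := exp_map_surjective u1 un.
have [h1 h2] : [set v | enorm v < pi /\ exp_map v = u] (xget 0 [set v | enorm v < pi /\ exp_map v = u]).
  by apply: xgetPex; exists v.
by split=> //; left.
Qed.

Lemma exp_mapK v : enorm v < pi \/ v = pole -> exp_map_inv (exp_map v) = v.
Proof.
move=> [vp|->]; last by rewrite exp_map_pole /exp_map_inv eqxx.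
have un : exp_map v != - north n.
  apply/eqP => e; have : enorm v = pi.
    apply: cos_inj; rewrite ?in_itv /= ?enorm_ge0 ?pi_ge0 ?(ltW vp) ?lexx//.
    by rewrite -height_exp_map e -exp_map_pole height_exp_map enorm_pole.
  by move=> e'; move: vp; rewrite e' ltxx.
rewrite /exp_map_inv (negPf un).
have [h1 h2] : [set v' | enorm v' < pi /\ exp_map v' = exp_map v]
    (xget 0 [set v' | enorm v' < pi /\ exp_map v' = exp_map v]).
  by apply: xgetPex; exists v.
exact: exp_map_inj h2.
Qed.


(** ** The scaling transform *)

Section transform.
Variable lam : R.
Local Notation r := (scaling_radius (n + 1) lam).
Hypothesis r0 : 0 < r.
Local Notation T := (@scaling_transform R n lam).

Definition untransform (p : E) : 'rV[R]_(n + 1) :=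
  (r - p.2 / r) *: exp_map (r^-1 *: p.1).

Lemma scaling_transformK : cancel T untransform.
Proof.
move=> x; rewrite /untransform /scaling_transform.
have rn : r != 0 by rewrite gt_eqF.
case: eqVneq => [->|x0] /=.
  by rewrite expr2 mulfK// subrr scale0r.
have e0 : enorm x != 0 by apply: contra_neq x0 => /enorm_eq0.
have u1 : enorm ((enorm x)^-1 *: x) = 1.
  by rewrite enormZ ger0_norm ?invr_ge0 ?enorm_ge0// mulVf.
have [hx _] := exp_map_invP u1.
rewrite scalerA mulVf// scale1r hx scalerA.
have -> : (r - r ^+ 2 * (1 - enorm x / r) / r) = enorm x by field.
by rewrite divff// scale1r.
Qed.

Lemma scaling_transform_inj : injective T.
Proof. exact: can_inj scaling_transformK. Qed.

Lemma continuous_untransform : continuous untransform.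
Proof.
apply: continuous_scale_fun.
  apply: continuousD_fun; first exact: continuous_cst_fun.
  apply: continuousN_fun; apply: continuousM_fun; last exact: continuous_cst_fun.
  exact: coord_snd_continuous.
have cs : continuous (fun p : E => r^-1 *: p.1).
  by apply: continuous_scale_fun; [exact: continuous_cst_fun|move=> p; exact: cvg_fst].
by move=> p; apply: (continuous_comp (cs p)); exact: continuous_exp_map.
Qed.

(** Closed pieces that exhaust the range of the transform, which is neither
    open nor closed because of the cut at the south pole. *)
Let piece (j : nat) : set E :=
  [set p : E | (enorm (r^-1 *: p.1) <= pi - j.+1%:R^-1 \/ p.1 = r *: pole) /\
    p.2 <= r ^+ 2 - j.+1%:R^-1] `|` [set (0, r ^+ 2)].

Let closed_piece j : closed (piece j).
Proof.
apply: closedU; last by apply: compact_closed; [exact: norm_hausdorff|exact: compact_set1].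
have cs : continuous (fun p : E => r^-1 *: p.1).
  by apply: continuous_scale_fun; [exact: continuous_cst_fun|move=> p; exact: cvg_fst].
rewrite (_ : mkset _ = ([set p : E | enorm (r^-1 *: p.1) <= pi - j.+1%:R^-1] `|`
    [set p : E | enorm (p.1 - r *: pole) <= 0]) `&` [set p : E | p.2 <= r ^+ 2 - j.+1%:R^-1]).
  apply: closedI; last first.
    by apply: closed_le_fun; [exact: coord_snd_continuous|exact: continuous_cst_fun].
  apply: closedU.
    apply: closed_le_fun; last exact: continuous_cst_fun.
    by move=> p; apply: (continuous_comp (cs p)); exact: continuous_enorm.
  apply: closed_le_fun; last exact: continuous_cst_fun.
  have cd : continuous (fun p : E => p.1 - r *: pole).
    by move=> p; apply: cvgB; [exact: cvg_fst|exact: cvg_cst].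
  by move=> p; apply: (continuous_comp (cd p)); exact: continuous_enorm.
apply/seteqP; split=> p [h1 h2]; split=> //; case: h1 => h1; [by left|right|by left|right].
  by rewrite /= h1 subrr enorm0.
apply/eqP; rewrite -subr_eq0; apply/eqP/enorm_eq0/eqP.
by rewrite eq_le enorm_ge0 andbT.
Qed.

Let range_piece x : exists j, piece j (T x).
Proof.
rewrite /scaling_transform; case: eqVneq => [_|x0]; first by exists 0%N; right.
have e0 : 0 < enorm x.
  by rewrite lt_neqAle enorm_ge0 andbT eq_sym; apply: contra_neq x0 => /enorm_eq0.
have u1 : enorm ((enorm x)^-1 *: x) = 1.
  by rewrite enormZ ger0_norm ?invr_ge0 ?enorm_ge0// mulVf// gt_eqF.
have [_ hv] := exp_map_invP u1; set v := exp_map_inv _ in hv *.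
have rx : 0 < r * enorm x by rewrite mulr_gt0.
have hh j : j.+1%:R^-1 < r * enorm x -> r ^+ 2 * (1 - enorm x / r) <= r ^+ 2 - j.+1%:R^-1.
  move=> h; have -> : r ^+ 2 * (1 - enorm x / r) = r ^+ 2 - r * enorm x.
    by field; rewrite gt_eqF.
  by rewrite lerD2l lerN2 ltW.
case: hv => hv; last first.
  have [j hj] := filter_ex (near_inv_lt rx).
  by exists j; left; split; [right; rewrite hv|exact: hh].
have pv : 0 < pi - enorm v by rewrite subr_gt0.
have [j [hj hj']] := filter_ex (filterI (near_inv_lt rx) (near_inv_lt pv)).
exists j; left; split; last exact: hh.
left; rewrite /= scalerA mulVf ?gt_eqF// scale1r.
by move: hj'; move: (j.+1%:R^-1) => z; lra.
Qed.

Let pieceK j p : piece j p -> T (untransform p) = p.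
Proof.
have rn : r != 0 by rewrite gt_eqF.
move=> [[hv hh]|->]; last first.
  by rewrite /untransform /= expr2 mulfK// subrr scale0r /scaling_transform eqxx expr2.
have j0 : 0 < j.+1%:R^-1 :> R by [].
have rho0 : 0 < r - p.2 / r.
  rewrite subr_gt0 ltr_pdivrMr// -expr2; apply: le_lt_trans hh _.
  by rewrite ltrBlDr ltrDl.
have en : enorm (untransform p) = r - p.2 / r.
  by rewrite enormZ enorm_exp_map mulr1 gtr0_norm.
have un : untransform p != 0.
  by apply/eqP => e; move: rho0; rewrite -en e enorm0 ltxx.
rewrite /scaling_transform (negPf un) en /untransform scalerA mulVf ?gt_eqF// scale1r.
rewrite exp_mapK; last first.
  case: hv => hv; [left|right].
    by apply: le_lt_trans hv _; rewrite ltrBlDr ltrDl.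
  by rewrite hv scalerA mulVf// scale1r.
rewrite scalerA divff// scale1r [RHS]surjective_pairing; congr pair.
by field.
Qed.

(** The transform is not continuous at the cut, but its left inverse is: the
    preimage of [K] is the image of [K] intersected with the range. *)
Lemma preimage_compact (K : set E) : compact K ->
  exists L : nat -> set 'rV[R]_(n + 1), (forall j, compact (L j)) /\
    T @^-1` K = \bigcup_j L j.
Proof.
move=> cK; exists (fun j => untransform @` (K `&` piece j)); split=> [j|].
  apply: continuous_compact; first exact/continuous_subspaceT/continuous_untransform.
  by apply: compact_closedI => //; exact: closed_piece.
apply/seteqP; split=> [x Kx|_ [j _ [p [Kp jp] <-]]].
  have [j jx] := range_piece x; exists j => //; exists (T x) => //.
  exact: scaling_transformK.
by rewrite /preimage /= (pieceK jp).
Qed.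

Lemma preimage_bounded (K : set E) : compact K ->
  exists M : R, forall x, K (T x) -> enorm x <= M.
Proof.
move=> cK; have [M hM] := compact_pair_bounded cK.
exists (r + `|M| / r) => x Kx; have := hM _ Kx; rewrite /scaling_transform.
case: eqVneq => [->|x0] h.
  by rewrite enorm0 addr_ge0 ?divr_ge0 ?(ltW r0).
have := le_trans (normr_snd _) h; rewrite /= ler_norml => /andP[h1 _].
have h2 : r * enorm x <= r ^+ 2 + `|M|.
  have -> : r * enorm x = r ^+ 2 - r ^+ 2 * (1 - enorm x / r).
    by field; rewrite gt_eqF.
  by have := ler_norm M; move: h1; move: (r ^+ 2 * _) => z; lra.
have -> : r + `|M| / r = (r ^+ 2 + `|M|) / r by field; rewrite gt_eqF.
by rewrite ler_pdivlMr// mulrC.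
Qed.

End transform.

End exponential_map.

Section closeness.
Context {R : realType} {n : nat}.
Hypothesis n0 : (0 < n)%N.
Local Notation E := ('rV[R]_n * R)%type.

Definition rescaled (lam : R) (p : E) : E :=
  scaling_transform lam (unaff (scaling_radius (n + 1) lam) p).

Lemma norm_enorm (v : 'rV[R]_n) : `|v| <= enorm v.
Proof.
apply: normr_rV_le => [|i]; first exact: enorm_ge0.
rewrite -(@ler_pXn2r _ 2) ?nnegrE ?enorm_ge0// real_normK ?num_real//.
by rewrite enormE /dotr (bigD1 i)//= -expr2 lerDl sumr_ge0// => k _; exact: sqr_ge0.
Qed.

Section one_radius.
Variable lam : R.
Local Notation r := (scaling_radius (n + 1) lam).
Hypothesis r1 : 1 <= r.

Let r0 : 0 < r. Proof. exact: lt_le_trans r1. Qed.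
Let rn : r != 0. Proof. by rewrite gt_eqF. Qed.
Let rr1 : 1 <= r ^+ 2. Proof. by rewrite exprn_ege1. Qed.
Let rr0 : 0 < r ^+ 2. Proof. by rewrite exprn_gt0. Qed.

Lemma rescaled_inj : injective (rescaled lam).
Proof.
move=> p q /(scaling_transform_inj n0 r0) /(congr1 (aff r)).
by rewrite !unaffK.
Qed.

Lemma rescaled_unaff S : rescaled lam @` (aff r @` S) = scaling_transform lam @` S.
Proof.
apply/seteqP; split=> [_ [_ [x Sx <-] <-]|_ [x Sx <-]].
  by exists x => //; rewrite /rescaled affK.
by exists (aff r x); [exists x|rewrite /rescaled affK].
Qed.

(** All estimates go through the inverse, which is explicit, whereas the
    transform itself involves an arc cosine. *)
Lemma rescaled_inv p (t : R) : t = enorm (rescaled lam p).1 / r ->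
  p.1 = ((1 - (rescaled lam p).2 / r ^+ 2) * sinc t) *: (rescaled lam p).1 /\
  p.2 = r ^+ 2 * (1 - cos t) + (rescaled lam p).2 * cos t.
Proof.
move=> tE; have := congr1 (aff r) (scaling_transformK n0 r0 (unaff r p)).
rewrite unaffK// -/(rescaled lam p); case: (rescaled lam p) tE => w h /= tE.
rewrite /untransform /= /aff => <- /=.
have et : enorm (r^-1 *: w) = t.
  by rewrite enormZ ger0_norm ?invr_ge0 ?(ltW r0)// mulrC.
have hz (a : R) (x : 'rV[R]_(n + 1)) : height (a *: x) = a * height x.
  by rewrite /height !mxE.
split; first by rewrite linearZ /= lsubmx_exp_map et !scalerA; congr (_ *: _); field.
by rewrite hz height_exp_map et; field.
Qed.

(** From the explicit inverse, with [|sinc| <= 1] and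
    [r ^ 2 * (1 - cos t) <= (r * t) ^ 2 / 2]. *)
Lemma rescaled_proper q : n%:R * q%:R ^+ 2 + q%:R <= r -> forall M, (M <= q)%N ->
  forall p, `|rescaled lam p| <= M%:R -> `|p| <= (properness_radius n M)%:R.
Proof.
move=> rq M Mq p pM.
have [t tE] : exists t, t = enorm (rescaled lam p).1 / r by eexists.
have [e1 e2] := rescaled_inv tE.
have wM := le_trans (normr_fst _) pM; have hM := le_trans (normr_snd _) pM.
set w := (rescaled lam p).1 in e1 tE wM *; set h := (rescaled lam p).2 in e1 e2 hM *.
have MqR : M%:R <= q%:R :> R by rewrite ler_nat.
have M0 : 0 <= M%:R :> R by [].
have n0' : 0 <= n%:R :> R by [].
have nq0 : 0 <= n%:R * q%:R ^+ 2 :> R by rewrite mulr_ge0// sqr_ge0.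
have q0 : 0 <= q%:R :> R by [].
have rr : r <= r ^+ 2 by rewrite expr2 ler_peMr ?(ltW r0).
have t0 : 0 <= t by rewrite tE divr_ge0 ?enorm_ge0 ?(ltW r0).
have rt : r ^+ 2 * t ^+ 2 = enorm w ^+ 2 by rewrite tE; field.
have wE : enorm w ^+ 2 <= n%:R * M%:R ^+ 2.
  apply: le_trans (enorm2_le w) _; rewrite ler_wpM2l// lerXn2r// ?nnegrE//.
have MMq : n%:R * M%:R ^+ 2 <= n%:R * q%:R ^+ 2 :> R.
  by rewrite ler_wpM2l// lerXn2r ?nnegrE.
have t1 : t ^+ 2 <= 1.
  rewrite -(@ler_pM2l _ (r ^+ 2))// rt mulr1; move: wE MMq rq rr.
  by move: (enorm w ^+ 2) (n%:R * M%:R ^+ 2) (n%:R * q%:R ^+ 2) nq0 q0 => *; lra.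
have [s0 s1] : 0 <= sinc t /\ sinc t <= 1.
  by have /andP[h1 h2] := sinc_bounds t0; split=> //; move: h1 t1; move: (t ^+ 2) (sinc t) => *; lra.
have c1 : `|1 - h / r ^+ 2| <= 2.
  have : `|h / r ^+ 2| <= 1.
    rewrite normrM normfV (gtr0_norm rr0) ler_pdivrMr// mul1r; apply: le_trans hM _.
    by move: MqR rq rr nq0; move: (n%:R * q%:R ^+ 2) => *; lra.
  by move=> h1; apply: le_trans (ler_normB _ _) _; rewrite normr1; lra.
have pr : (properness_radius n M)%:R = n.+2%:R * (M%:R + 1) ^+ 2 :> R.
  by rewrite /properness_radius natrM natrX -(natr1 M).
apply: normr_pair_le.
  rewrite e1 normrZ normrM (ger0_norm s0) pr.
  apply: (@le_trans _ _ (2 * 1 * M%:R)).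
    by apply: ler_pM => //; [rewrite mulr_ge0|apply: ler_pM].
  by rewrite -(natr1 n.+1) -(natr1 n); move: (n%:R : R) (M%:R : R) n0' M0 => *; nra.
rewrite e2 pr; have c0 := cos_ge t0; have cl := cos_le1 t.
have cn : -1 <= cos t by exact: cos_geN1.
apply: le_trans (ler_normD _ _) _.
have h1 : `|r ^+ 2 * (1 - cos t)| <= n%:R * M%:R ^+ 2.
  rewrite ger0_norm; last by rewrite (mulr_ge0 (ltW rr0))// subr_ge0.
  apply: (@le_trans _ _ (r ^+ 2 * (t ^+ 2 / 2))).
    by rewrite ler_pM2l//; move: c0; move: (t ^+ 2) (cos t) => *; lra.
  rewrite mulrA rt; move: wE (sqr_ge0 (enorm w)).
  by move: (enorm w ^+ 2) (n%:R * M%:R ^+ 2) => *; lra.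
have h2 : `|h * cos t| <= M%:R.
  rewrite normrM; apply: (@le_trans _ _ (M%:R * 1)); last by rewrite mulr1.
  by apply: ler_pM => //; rewrite ler_norml cn cl.
apply: le_trans (lerD h1 h2) _; rewrite -(natr1 n.+1) -(natr1 n).
by move: (n%:R : R) (M%:R : R) n0' M0 => *; nra.
Qed.

Lemma cos_gt0_lt2 (t : R) : 0 <= t <= pi -> 0 < cos t -> t < 2.
Proof.
move=> /andP[t0 tpi] ct; apply: lt_trans (@pihalf_lt2 R).
rewrite ltNge; apply/negP => th; move: ct; rewrite ltNge => /negP; apply.
rewrite -(subrK (pi / 2) t) cosDpihalf oppr_le0; apply: sin_ge0_pi.
have := @pi_ge0 R; move: th tpi; move: (pi : R) => *; apply/andP; split; lra.
Qed.

(** The height is estimated through [r ^ 2 - |x| ^ 2], the angle [t] through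
    [t / 3 <= sin t], valid as the point is in the upper half-space. *)
Lemma rescaled_bounded (B : R) p : 0 <= B -> 2 * B <= r ^+ 2 -> `|p| <= B ->
  `|(rescaled lam p).2| <= 2 * B + (n%:R + 1) * B ^+ 2 /\
  enorm (rescaled lam p).1 ^+ 2 <= 36 * (n%:R * B ^+ 2).
Proof.
move=> B0 Br pB; set x := unaff r p.
have lx : lsubmx x = p.1 by rewrite /x /unaff row_mxKl.
have hx : height x = r - p.2 / r by rewrite /x /height /unaff row_mxKr mxE eqxx mulr1n.
have p1B := le_trans (normr_fst p) pB; have p2B := le_trans (normr_snd p) pB.
have vB : enorm p.1 ^+ 2 <= n%:R * B ^+ 2.
  by apply: le_trans (enorm2_le _) _; rewrite ler_wpM2l// lerXn2r ?nnegrE.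
have hr : r / 2 <= height x.
  rewrite hx -(ler_pM2l r0) mulrBr [r * (_ / r)]mulrCA divff// mulr1 mulrA -expr2.
  by have := ler_norm p.2; move: Br p2B; move: (r ^+ 2) (`|p.2|) => *; lra.
have hx0 : 0 < height x by apply: lt_le_trans hr; rewrite divr_gt0.
have ex2 := enorm_split x; rewrite lx in ex2.
have exh : height x <= enorm x.
  rewrite -(@ler_pXn2r _ 2) ?nnegrE ?enorm_ge0 ?(ltW hx0)// ex2 lerDr.
  exact: sqr_ge0.
have ex0 : 0 < enorm x by exact: lt_le_trans exh.
have xn : x != 0 by apply/eqP => x0; move: ex0; rewrite x0 enorm0 ltxx.
have u1 : enorm ((enorm x)^-1 *: x) = 1.
  by rewrite enormZ ger0_norm ?invr_ge0 ?enorm_ge0// mulVf// gt_eqF.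
have [hv tv] := exp_map_invP n0 u1.
have TE : rescaled lam p = (r *: exp_map_inv ((enorm x)^-1 *: x), r ^+ 2 * (1 - enorm x / r)).
  by rewrite /rescaled /scaling_transform -/x (negPf xn).
set v := exp_map_inv _ in hv tv TE; rewrite TE /=; split.
  have -> : r ^+ 2 * (1 - enorm x / r) = r * (r - enorm x) by field.
  have e : (r * (r - enorm x)) * (r + enorm x) =
      r * (2 * p.2 - p.2 ^+ 2 / r ^+ 2 - enorm p.1 ^+ 2).
    by rewrite -mulrA -subr_sqr ex2 hx; field.
  have ge : r <= r + enorm x by rewrite lerDl ltW.
  have b1 : `|2 * p.2 - p.2 ^+ 2 / r ^+ 2 - enorm p.1 ^+ 2| <= 2 * B + (n%:R + 1) * B ^+ 2.
    have a1 : 0 <= p.2 ^+ 2 / r ^+ 2 by rewrite divr_ge0 ?sqr_ge0.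
    have a2 : p.2 ^+ 2 / r ^+ 2 <= B ^+ 2.
      rewrite ler_pdivrMr//; apply: le_trans (_ : B ^+ 2 <= _); last by rewrite ler_peMr ?sqr_ge0.
      by rewrite -(real_normK (num_real p.2)) lerXn2r ?nnegrE.
    have a3 := sqr_ge0 (enorm p.1); move: p2B; rewrite ler_norml => /andP[a4 a5].
    rewrite mulrDl mul1r ler_norml; move: a1 a2 a3 vB (sqr_ge0 B).
    move: (p.2 ^+ 2 / r ^+ 2) (enorm p.1 ^+ 2) (n%:R * B ^+ 2) (B ^+ 2) => *.
    by apply/andP; split; lra.
  rewrite -(ler_pM2l r0); apply: le_trans (_ : _ <= `|r * (r - enorm x)| * (r + enorm x)) _.
    by rewrite mulrC ler_wpM2l.
  rewrite -(ger0_norm (le_trans (ltW r0) ge)) -normrM e normrM (gtr0_norm r0).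
  by rewrite ler_pM2l.
pose t := enorm v.
have t0 : 0 <= t by exact: enorm_ge0.
have tpi : t <= pi.
  by case: tv => [/ltW//|tv]; rewrite /t tv enorm_pole.
have ct : cos t = height x / enorm x.
  by rewrite -height_exp_map hv /height !mxE mulrC.
have t2 : t < 2.
  by apply: cos_gt0_lt2; rewrite ?t0 ?tpi// ct divr_gt0.
have st : sin t * enorm x = enorm p.1.
  have := congr1 (@enorm R n) (lsubmx_exp_map v); rewrite hv linearZ /= lx !enormZ -/t.
  rewrite ger0_norm ?invr_ge0 ?enorm_ge0// => h.
  have s0 : 0 <= sinc t.
    have /andP[h1 _] := sinc_bounds t0; apply: le_trans h1.
    by move: t2 t0 => *; nra.
  by move: h; rewrite (ger0_norm s0) sincM => <-; rewrite mulrAC mulVf ?mul1r// gt_eqF.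
have t3 : t / 3 <= sin t.
  by apply: le_trans (sin_ge t0); move: t2 t0; move: (t) => y *; nra.
have rw : enorm (r *: v) <= 6 * enorm p.1.
  rewrite enormZ (gtr0_norm r0) -/t -st.
  have : r * t <= 6 * (t / 3 * (r / 2)) by rewrite le_eqVlt; apply/orP; left; apply/eqP; field.
  move=> /le_trans; apply; rewrite ler_pM2l//; apply: ler_pM => //.
  - by rewrite divr_ge0.
  - by rewrite divr_ge0 ?(ltW r0).
  - exact: le_trans exh.
have -> : 36 * (n%:R * B ^+ 2) = 6 ^+ 2 * (n%:R * B ^+ 2) :> R by congr (_ * _); ring.
apply: (@le_trans _ _ ((6 * enorm p.1) ^+ 2)).
  by rewrite lerXn2r ?nnegrE ?enorm_ge0 ?mulr_ge0 ?enorm_ge0.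
by rewrite exprMn ler_pM2l.
Qed.

(** [H] bounds the heights, and [W] the squared norms of the first coordinates,
    of the images of the ball of radius [B]. *)
Definition closeness_bound (B : R) : R :=
  let H := 2 * B + (n%:R + 1) * B ^+ 2 in let W := 36 * (n%:R * B ^+ 2) in
  (H + W) * (1 + W) + H * W + W ^+ 2 + 2 * W * (H + W).

(** With [t] of order [1 / r], the explicit inverse and the expansions of [sinc]
    and [cos] at [0] give an error of order [1 / r ^ 2]. *)
Lemma rescaled_close (B : R) p : 0 <= B -> 2 * B <= r ^+ 2 ->
  2 * B + (n%:R + 1) * B ^+ 2 + 36 * (n%:R * B ^+ 2) <= r ^+ 2 -> `|p| <= B ->
  `|rescaled lam p - unshear p| <= closeness_bound B / r ^+ 2.
Proof.
move=> B0 Br; rewrite /closeness_bound /=.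
set H := 2 * B + _; set W := 36 * _ => HW pB.
have [hH wW] := rescaled_bounded B0 Br pB; rewrite -/H -/W in hH wW.
have [t tE] : exists t, t = enorm (rescaled lam p).1 / r by eexists.
have [e1 e2] := rescaled_inv tE.
set w := (rescaled lam p).1 in e1 tE wW *; set h := (rescaled lam p).2 in e1 e2 hH *.
have H0 : 0 <= H by exact: le_trans hH.
have W0 : 0 <= W by apply: le_trans wW; exact: sqr_ge0.
have t0 : 0 <= t by rewrite tE divr_ge0 ?enorm_ge0 ?(ltW r0).
have rt : enorm w ^+ 2 = r ^+ 2 * t ^+ 2 by rewrite tE; field.
have [i iE] : exists i : R, i = (r ^+ 2)^-1 by exists (r ^+ 2)^-1.
have i0 : 0 < i by rewrite iE invr_gt0.
have ri : r ^+ 2 * i = 1 by rewrite iE divff// gt_eqF.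
have tW : t ^+ 2 <= W * i.
  rewrite -(@ler_pM2l _ (r ^+ 2))// -rt mulrCA ri mulr1; exact: wW.
have HWi : (H + W) * i <= 1.
  by rewrite -ri ler_pM2r.
have /andP[s1 s2] := sinc_bounds t0.
set c := (1 - h / r ^+ 2) * sinc t in e1.
have tt0 := sqr_ge0 t.
have hi : `|h * i| <= H * i by rewrite normrM (gtr0_norm i0) ler_pM2r.
have cE : `|1 - c| <= (H + W) * i.
  have -> : 1 - c = (1 - sinc t) + h * i * sinc t by rewrite /c -iE; ring.
  have a1 : 0 <= 1 - sinc t <= W * i.
    rewrite subr_ge0 s2 /=; move: s1 tW tt0; move: (t ^+ 2) (sinc t) (W * i) => *; lra.
  have sn : `|sinc t| <= 1.
    rewrite ler_norml s2 andbT; have : W * i <= 1.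
      by move: HWi H0 i0; rewrite mulrDl; move: (W * i) => *; nra.
    by move: s1 tW tt0; move: (t ^+ 2) (sinc t) (W * i) => *; lra.
  have a2 : `|h * i * sinc t| <= H * i.
    rewrite normrM -[H * i]mulr1; apply: ler_pM => //.
  case/andP: a1 => a1 a1'; apply: le_trans (ler_normD _ _) _.
  by rewrite (ger0_norm a1) mulrDl addrC; apply: lerD.
have wn : `|w| <= 1 + W.
  apply: le_trans (norm_enorm w) _; move: wW W0 (enorm_ge0 w).
  by move: (enorm w) => y *; nra.
have ri' : (r ^+ 2)^-1 = i by rewrite iE.
rewrite [_ / r ^+ 2]mulrDl [(_ + H * W + W ^+ 2) * _]mulrDl [(_ + H * W) * _]mulrDl ri'.
have HW0 : 0 <= H + W by exact: addr_ge0.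
have W1 : 0 <= 1 + W by exact: addr_ge0.
have X1 : 0 <= (H + W) * (1 + W) * i by apply: mulr_ge0 (ltW i0); exact: mulr_ge0.
have X2 : 0 <= H * W * i by apply: mulr_ge0 (ltW i0); exact: mulr_ge0.
have X3 : 0 <= W ^+ 2 * i by apply: mulr_ge0 (ltW i0); exact: sqr_ge0.
have X4 : 0 <= 2 * W * (H + W) * i.
  by apply: mulr_ge0 (ltW i0); apply: mulr_ge0 => //; exact: mulr_ge0.
apply: normr_pair_le.
  have -> : (rescaled lam p - unshear p).1 = (1 - c) *: w.
    by rewrite /unshear /= -/w scalerBl scale1r -e1.
  rewrite normrZ; apply: (@le_trans _ _ ((H + W) * i * (1 + W))); first by apply: ler_pM.
  have -> : (H + W) * i * (1 + W) = (H + W) * (1 + W) * i by ring.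
  by move: X1 X2 X3 X4; move: (_ * _ * i) (H * W * i) (W ^+ 2 * i) (2 * W * _ * i) => *; lra.
have pw : enorm p.1 ^+ 2 = c ^+ 2 * enorm w ^+ 2.
  by rewrite e1 enormZ exprMn real_normK ?num_real.
(* The error comes from the factor [cos t] of [h], from the expansion of [cos] at
   [0] and from the factor [c] between the first coordinates. *)
have -> : (rescaled lam p - unshear p).2 =
    h * (1 - cos t) - (r ^+ 2 * (1 - cos t) - enorm w ^+ 2 / 2) -
    (1 - c) * (1 + c) * enorm w ^+ 2 / 2.
  by rewrite /unshear /= -/h e2 pw; field.
have c0 := cos_ge t0; have cl := cos_le t0; have c1 := cos_le1 t.
have Y1 : `|h * (1 - cos t)| <= H * W * i.
  rewrite normrM -mulrA; apply: ler_pM => //.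
  by rewrite ger0_norm ?subr_ge0//; move: c0 tW tt0; move: (t ^+ 2) (cos t) (W * i) => *; lra.
have Y2 : `|r ^+ 2 * (1 - cos t) - enorm w ^+ 2 / 2| <= W ^+ 2 * i.
  have -> : r ^+ 2 * (1 - cos t) - enorm w ^+ 2 / 2 = - (r ^+ 2 * (cos t - (1 - t ^+ 2 / 2))).
    by rewrite rt; field.
  rewrite normrN ger0_norm; last by rewrite mulr_ge0 ?(ltW rr0)// subr_ge0.
  apply: (@le_trans _ _ (r ^+ 2 * (t ^+ 2 * t ^+ 2))).
    rewrite ler_pM2l//; have : t ^+ 4 = t ^+ 2 * t ^+ 2 by rewrite -exprD.
    have : 0 <= t ^+ 2 * t ^+ 2 by rewrite mulr_ge0.
    by move: cl; move: (t ^+ 4) (t ^+ 2 * t ^+ 2) (t ^+ 2) (cos t) => *; lra.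
  rewrite mulrA -rt [W ^+ 2]expr2 -mulrA; apply: ler_pM => //; exact: sqr_ge0.
have Y3 : `|(1 - c) * (1 + c) * enorm w ^+ 2 / 2| <= 2 * W * (H + W) * i.
  have -> : (1 - c) * (1 + c) * enorm w ^+ 2 / 2 = (1 - c) * ((1 + c) / 2 * enorm w ^+ 2) by field.
  rewrite normrM; have -> : 2 * W * (H + W) * i = (H + W) * i * (2 * W) by ring.
  apply: ler_pM => //; rewrite normrM; apply: ler_pM => //.
    have : `|1 - c| <= 1 by exact: le_trans cE HWi.
    by rewrite !ler_norml => /andP[? ?]; apply/andP; split; lra.
  by rewrite ger0_norm ?sqr_ge0.
apply: le_trans (ler_normB _ _) _; apply: le_trans (lerD (ler_normB _ _) (lexx _)) _.
apply: le_trans (lerD (lerD Y1 Y2) Y3) _.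
by move: X1 X2 X3 X4; move: (_ * _ * i) (H * W * i) (W ^+ 2 * i) (2 * W * _ * i) => *; lra.
Qed.

End one_radius.

Lemma rescaled_close_to_unshear q : \forall lam \near +oo,
  close_to_unshear q (rescaled lam).
Proof.
have hr (M : R) : \forall lam \near +oo, M <= scaling_radius (n + 1) lam.
  by move: M; apply/cvgryPge; exact: radius_cvg.
near=> lam.
have r1 : 1 <= scaling_radius (n + 1) lam by near: lam.
have rr : scaling_radius (n + 1) lam <= scaling_radius (n + 1) lam ^+ 2.
  by rewrite expr2 ler_peMr// (le_trans ler01).
split; first exact: rescaled_inj.
  move=> p pq; apply: le_trans (rescaled_close r1 _ _ _ pq) _ => //.
  - by apply: le_trans rr; near: lam.
  - by apply: le_trans rr; near: lam.
  - rewrite ler_pdivrMr ?exprn_gt0 ?(lt_le_trans ltr01)// mulrC ler_pdivlMr//.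
    by apply: le_trans rr; near: lam.
by apply: rescaled_proper => //; near: lam.
Unshelve. all: by end_near. Qed.

End closeness.

(** * Convergence of the rescaled extreme points *)

Section convergence.
Context {R : realType} {n : nat}.
Hypothesis n0 : (0 < n)%N.
Local Notation E := ('rV[R]_n * R)%type.
Local Notation radius := (@scaling_radius R (n + 1)).
Local Notation T := (@scaling_transform R n).

Section vertices.
Context {d : measure_display} {Omega : measurableType d}.
Variables (lam : R) (S : Omega -> set 'rV[R]_(n + 1)).
Hypothesis r1 : 1 <= radius lam.
Hypothesis rS : random_set S.

Let r0 : 0 < radius lam. Proof. exact: lt_le_trans r1. Qed.

Lemma locally_finite_vertices w : locally_finite (T lam @` hull_vertices (S w)).
Proof.
have [lfS _ _] := rS => K cK; have [M hM] := preimage_bounded r0 cK.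
have cB := @compact_rV_ball R (n + 1) M.
apply: sub_finite_set (finite_image (T lam) (lfS w _ cB)) => _ [[x Vx <-] Kx].
exists x => //; split; first exact: hull_vertices_sub Vx.
exact: le_trans (norm_enorm _) (hM _ Kx).
Qed.

Lemma point_process_vertices :
  point_process (R := R) (fun w => T lam @` hull_vertices (S w)).
Proof.
apply: hits_point_process => [w|K cK]; first exact: locally_finite_vertices.
have [L [cL TL]] := preimage_compact n0 r0 cK.
rewrite (_ : mkset _ = \bigcup_j [set w | hull_vertices (S w) `&` L j !=set0]).
  by apply: bigcup_measurable => j _; exact: measurable_hit_hull_vertices.
apply/seteqP; split=> w.
  move=> [_ [[x Vx <-] Kx]]; have : (T lam @^-1` K) x by [].
  by rewrite TL => -[j _ Lx]; exists j => //; exists x.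
move=> [j _ [x [Vx Lx]]]; exists (T lam x); split; first by exists x.
have : (\bigcup_j L j) x by exists j.
by rewrite -TL.
Qed.

End vertices.

Section limit.
Context {dL : measure_display} {OmegaL : measurableType dL}.
Context {PL : probability OmegaL R} {Plim : OmegaL -> set E}.
Hypothesis hPlim : poisson_process PL (@limit_intensity R n) Plim.

Let lfP w : locally_finite (Plim w).
Proof. by have [[h _] _ _] := hPlim. Qed.

Lemma paraboloid_ext_sub (S : set E) : paraboloid_ext S `<=` S.
Proof. by move=> x []. Qed.

Lemma point_process_limit : point_process (R := R) (fun w => paraboloid_ext (Plim w)).
Proof.
apply: hits_point_process => [w K cK|K cK].
  apply: sub_finite_set (lfP w cK) => x [/paraboloid_ext_sub Px Kx].
  by split.
apply: measurable_hit_paraboloid_ext => //.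
by have [h _ _] := hPlim; exact: point_process_random_set h.
Qed.

(** The vertices, in affine coordinates, and the extreme points of the limit, in
    sheared coordinates, both satisfy the sandwich required by
    [family_convergence]. *)
Lemma rescaled_vertices_convergence {I : Type} (F : set_system I) {FF : ProperFilter F}
    {d : I -> measure_display} {Omega : forall i, measurableType (d i)}
    (P : forall i, probability (Omega i) R)
    (S : forall i, Omega i -> set 'rV[R]_(n + 1)) (lam : I -> R) :
  lam i @[i --> F] --> +oo ->
  (\forall i \near F, 1 <= radius (lam i)) ->
  (\forall i \near F, random_set (S i)) ->
  asymptotically_poisson (@cell_mass R n) F P
    (fun i w => aff (radius (lam i)) @` S i w) ->
  converges_in_distribution F P
    (fun i w => T (lam i) @` hull_vertices (S i w))
    PL (fun w => paraboloid_ext (Plim w)).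
Proof.
move=> lamF hr rS aS.
have ppS : \forall i \near F, point_process (R := R) (fun w => T (lam i) @` hull_vertices (S i w)).
  by apply: filterS2 hr rS => i; exact: point_process_vertices.
split=> [//||G cG bG]; first exact: point_process_limit.
have [b hb] : exists b, forall W : set E, locally_finite W -> `|G W| <= b.
  have [M [Mr hM]] := bG; exists (M + 1) => W lfW; apply: (hM (M + 1)) => //.
  by rewrite ltrDl.
have bm (d' : measure_display) (Om : measurableType d') (xi : Om -> set E) :
    point_process (R := R) xi -> bounded_measurable (fun w => G (xi w)).
  move=> pp; split; last by exists b => w; apply: hb; have [h _] := pp.
  by apply: measurable_functional => //; exact: point_process_random_set pp.
rewrite (expectation_mean PL (bm _ _ _ point_process_limit)).
apply: cvg_trans (_ : (mean (P i) (fun w => G (T (lam i) @` hull_vertices (S i w))))%:E @[i --> F] --> _).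
  apply: near_eq_cvg; apply: filterS ppS => i pp.
  by rewrite (expectation_mean (P i) (bm _ _ _ pp)).
apply/cvg_EFin; first by apply: nearW.
rewrite (_ : _ \o _ = fun i => mean (P i) (fun w => G (T (lam i) @` hull_vertices (S i w))))//.
pose VL w := shear @` paraboloid_ext (Plim w).
have eL w : unshear @` VL w = paraboloid_ext (Plim w).
  apply/seteqP; split=> [_ [_ [x Px <-] <-]|x Px]; first by rewrite shearK.
  by exists (shear x); [exists x|rewrite shearK].
rewrite (_ : (fun w => G (paraboloid_ext (Plim w))) = fun w => G (unshear @` VL w)); last first.
  by apply/funext => w; rewrite eL.
pose V i w := aff (radius (lam i)) @` hull_vertices (S i w).
have r0 : \forall i \near F, 0 < radius (lam i).
  by apply: filterS hr => i; exact: lt_le_trans.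
have eV i w : 1 <= radius (lam i) -> rescaled (lam i) @` V i w = T (lam i) @` hull_vertices (S i w).
  by move=> h; exact: rescaled_unaff.
apply: cvg_trans (_ : mean (P i) (fun w => G (rescaled (lam i) @` V i w)) @[i --> F] --> _).
  apply: near_eq_cvg; apply: filterS hr => i h; congr mean; apply/funext => w.
  by rewrite eV.
apply: (family_convergence cG hb (limit_family hPlim) (nice_ae hPlim) aS (V := V)).
- apply: filterS2 r0 rS => i r0 [lfS _ _] w; split.
    exact: strict_aff_hull_vertices.
  exact: aff_hull_vertices_weak.
- by move=> q; exact: (lamF _ (rescaled_close_to_unshear n0 q)).
- by apply: filterS2 hr rS => i h rSi w; rewrite eV//; exact: locally_finite_vertices.
- apply: filterS2 hr ppS => i h pp.
  have [mG _] := bm _ _ _ pp.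
  by apply: eq_measurable_fun mG => w _; rewrite eV.
- move=> w; split; first exact: strict_shear_paraboloid_ext.
  exact: shear_paraboloid_ext_weak.
- by move=> w; rewrite eL; have [h _] := point_process_limit.
- have [mG _] := bm _ _ _ point_process_limit.
  by apply: eq_measurable_fun mG => w _; rewrite eL.
Qed.

End limit.
End convergence.

(* The dimension is d = n + 1. *)
Theorem theorem1p1 (R : realType) (n : nat) (hd : (2 <= n + 1)%N)
  (lambda0 : R)
  (hlambda0 : forall lambda, lambda0 <= lambda ->
    1 <= scaling_radius (n + 1) lambda)
  (dO : R -> measure_display) (Omega : forall lambda, measurableType (dO lambda))
  (P : forall lambda, probability (Omega lambda) R)
  (Plambda : forall lambda, Omega lambda -> set 'rV[R]_(n + 1))
  (hPlambda : forall lambda, lambda0 <= lambda ->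
    poisson_process (P lambda) (gauss_intensity lambda) (Plambda lambda))
  (dX : measure_display) (OmegaX : measurableType dX)
  (PX : probability OmegaX R) (X : nat -> OmegaX -> 'rV[R]_(n + 1))
  (hX : iid_std_normal PX X)
  (dL : measure_display) (OmegaL : measurableType dL)
  (PL : probability OmegaL R) (Plim : OmegaL -> set ('rV[R]_n * R))
  (hPlim : poisson_process PL (@limit_intensity R n) Plim) :
  converges_in_distribution (pinfty_nbhs R) P
    (fun lambda w =>
      scaling_transform lambda @` hull_vertices (Plambda lambda w))
    PL (fun w => paraboloid_ext (Plim w))
  /\
  converges_in_distribution \oo (fun _ : nat => PX)
    (fun m w =>
      scaling_transform m%:R @` hull_vertices [set X i w | i in `I_m])
    PL (fun w => paraboloid_ext (Plim w)).
Proof.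
have n0 : (0 < n)%N by rewrite -(leq_add2r 1).
have l0 : \forall lam \near +oo, lambda0 <= lam by apply: nbhs_pinfty_ge; exact: num_real.
have m0 : \forall m \near \oo, lambda0 <= (m%:R : R) := cvgr_idn l0.
split.
  apply: (rescaled_vertices_convergence n0 hPlim (lam := id)) => //.
  - exact: filterS hlambda0 l0.
  - by apply: filterS l0 => lam /hPlambda[h _ _]; exact: point_process_random_set h.
  - by apply: poisson_family; exact: filterS hPlambda l0.
apply: (rescaled_vertices_convergence n0 hPlim (F := \oo) (P := fun _ : nat => PX)
  (S := fun m => sample (X := X) m) (lam := fun m => m%:R)).
- exact: cvgr_idn.
- by apply: filterS m0 => m; exact: hlambda0.
- by exists 0%N => // m _; exact: random_sample hX m.
- exact: binomial_family.
Qed.
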